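(* Let $\phi$ be a father wavelet that is of bounded $p$-variation for some $1\le p<\infty$, vanishes on $(B_1,B_2]^c$ with $B_1<B_2$, $B_1,B_2\in\mathbb Z$, and is uniformly continuous on $(B_1,B_2]$. Suppose $P$ has a bounded uniformly continuous density $p_0$. Let $j_n\nearrow\infty$ be a sequence of nonnegative integers such that $\frac{n}{j_n2^{j_n}}\to\infty$, $\frac{j_n}{\log\log n}\to\infty$ as $n\to\infty$, and $\sup_{n\ge n_0}(j_{2n}-j_n)\le\tau$ for some $\tau\ge1$ and some $n_0<\infty$. Then $$\lim_{n\to\infty}\sqrt{\frac{n}{2(\log2)j_n2^{j_n}}}\,\sup_{y\in\mathbb R}\left|\frac{p_n(y)-Ep_n(y)}{\sqrt{\sum_{k\in\mathbb Z}\phi^2(2^{j_n}y-k)}}\right|=\|p_0\|_\infty^{1/2}\quad\text{almost surely}.$$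
   Context: $X,X_1,X_2,\dots$ are i.i.d. real random variables with absolutely continuous law $P$ with density $p_0$, realized as the coordinate projections of $(\mathbb R^{\mathbb N},\mathcal B^{\mathbb N},P^{\mathbb N})$. $\|h\|_\infty=\sup_{x\in\mathbb R}|h(x)|$. A father wavelet is a function $\phi\in\mathcal L^2(\mathbb R)$ such that $\{\phi(\cdot-k):k\in\mathbb Z\}$ is an orthonormal system in $\mathcal L^2(\mathbb R)$ and the spaces $V_0=\{\sum_kc_k\phi(\cdot-k):\{c_k\}\in\ell^2\}$, $V_j=\{f(2^j\cdot):f\in V_0\}$ are nested ($V_{j-1}\subseteq V_j$ for $j\in\mathbb N$) with $\bigcup_{j\ge0}V_j$ dense in $\mathcal L^2(\mathbb R)$. A function $h:\mathbb R\to\mathbb R$ is of bounded $p$-variation if $v_p(h)=\sup\{\sum_{i=1}^n|h(x_i)-h(x_{i-1})|^p:n\in\mathbb N,\ -\infty<x_0<\dots<x_n<\infty\}<\infty$. $K(y,x)=\sum_{k\in\mathbb Z}\phi(y-k)\phi(x-k)$, and the linear wavelet density estimator is $p_n(y)=\frac1n\sum_{i=1}^n2^{j_n}K(2^{j_n}y,2^{j_n}X_i)$. (One has $\inf_y\sum_k\phi^2(y-k)>0$.) *)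

(* Defs.v *)
From HB Require Import structures.
From mathcomp Require Import all_boot all_order all_algebra.
From mathcomp Require Import all_classical all_reals all_analysis.
From mathcomp Require Import summability.

Set Implicit Arguments.
Unset Strict Implicit.
Unset Printing Implicit Defensive.

Import Order.TTheory GRing.Theory Num.Theory.
Import numFieldNormedType.Exports.

Local Open Scope classical_set_scope.
Local Open Scope ring_scope.

(* Unconditional sum over Z: the limit of the sums over finite subsets of Z. *)
Definition zsum (R : realType) (f : int -> R) : R :=
  summability.sum (f : int -> R^o).

Definition sup_norm (R : realType) (h : R -> R) : \bar R :=
  ereal_sup (range (fun x => (`|h x|)%:E)).

Section father_wavelet.
Variable R : realType.
Implicit Types (phi f g : R -> R).

Local Notation mu := (@lebesgue_measure R).

Definition L2 : set (R -> R) := [set f | f \in Lfun mu 2%:E].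

(* In [V0] the series converges in L^2; the space is closed under a.e. equality. *)
Definition V0 phi : set (R -> R) :=
  [set f | L2 f /\ exists c : int -> R,
    (\esum_(k in [set: int]) (c k ^+ 2)%:E < +oo)%E /\
    (fun A => Lnorm mu 2%:E (
       EFin \o (fun x => f x - partial_sum (fun k => c k * phi (x - k%:~R)) A)))
      @ totally --> 0%E].

Definition V phi (j : nat) : set (R -> R) :=
  [set f | exists2 g, V0 phi g & f = fun x => g (2 ^+ j * x)].

Definition father_wavelet phi : Prop :=
  [/\ L2 phi,
      forall k l : int,
        Rintegral mu setT (fun x => phi (x - k%:~R) * phi (x - l%:~R))
          = (k == l)%:R,
      forall j : nat, V phi j `<=` V phi j.+1 &
      forall f, L2 f -> forall e : R, 0 < e -> exists (j : nat) (g : R -> R),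
        V phi j g /\
        (Lnorm mu 2%:E (EFin \o (fun x => (f x - g x)%R)) < e%:E)%E].

End father_wavelet.

Definition p_variation (R : realType) (p : R) (h : R -> R) : \bar R :=
  ereal_sup [set v | exists (n : nat) (x : nat -> R),
    (forall i, (i < n)%N -> x i < x i.+1) /\
    v = (\sum_(i < n) `|h (x i.+1) - h (x i)| `^ p)%:E].

Definition is_density (R : realType) (p0 : R -> R)
    (P : probability (measurableTypeR R) R) : Prop :=
  [/\ measurable_fun [set: R] p0, forall x, 0 <= p0 x &
      forall A : set (measurableTypeR R), measurable A ->
        P A = (\int[lebesgue_measure]_(x in A) (p0 x)%:E)%E].

(* R^N with the sigma-algebra generated by the coordinate projections. *)
Definition seq_space (R : realType) :=
  g_sigma_algebraType (\bigcup_(i in [set: nat])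
    preimage_set_system [set: nat -> R]
      (fun x => x i : measurableTypeR R) measurable).

(* [is_power PN P] characterizes PN = P^N: finite-dimensional cylinders form a
   pi-system generating the sigma-algebra, so at most one PN satisfies it. *)
Definition is_power (R : realType) (PN : probability (seq_space R) R)
    (P : probability (measurableTypeR R) R) : Prop :=
  forall (n : nat) (A : nat -> set (measurableTypeR R)),
    (forall i, measurable (A i)) ->
    PN [set x | forall i, (i < n)%N -> A i (x i)] = (\prod_(i < n) P (A i))%E.

Definition wavelet_kernel (R : realType) (phi : R -> R) (y x : R) : R :=
  zsum (fun k => phi (y - k%:~R) * phi (x - k%:~R)).

(* Coordinates are numbered from 0, so that X_i is [x i.-1]. *)
Definition wavelet_estimator (R : realType) (phi : R -> R) (j : nat -> nat)
    (n : nat) (x : seq_space R) (y : R) : R :=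
  n%:R^-1 * \sum_(i < n)
    2 ^+ j n * wavelet_kernel phi (2 ^+ j n * y) (2 ^+ j n * x i).

(* Main.v *)
(* Writing 2^j y = m + th with 0 < th <= 1 and L = B2 - B1, at most L translates of
   phi are nonzero at 2^j y.  Hence the normalized deviation of the estimator at y is
   2^j / n times a sum over l <= n of centered copies of F_u(2^j X_l - k), where
   F_u = sum_{i < L} u_i phi(. - i), u is a unit vector of R^L depending only on th, and
   k is an integer.  By orthonormality Var F_u(2^j X - k) is at most 2^-j sup p0, and
   nearly equal to it for k chosen near a point where p0 is almost maximal.  The
   denominators are bounded away from 0 because density of the V_j in L^2 forces
   (int phi) * sum_k phi(. - k) = 1.

   Upper bound: Doob's inequality for the submartingale exp(lam S) - 1 - lam S gives a
   bound proportional to the variance of S, so that the bounds for all translates k in Z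
   add up to a bound of order j 2^(-del j).  Borel-Cantelli is applied to blocks of
   indices whose end points have ratio close to 1; on each dyadic range j_n takes boundedly
   many values, and j_n / log log n -> oo makes the bounds summable.  A finite grid of
   values of th suffices because phi is uniformly continuous on ]B1, B2].

   Lower bound: on an interval where p0 is almost maximal there are about 2^j windows
   with disjoint supports.  The indicator of {S < t} is bounded above by a combination of
   four exponentials; after Poissonization the expectations factor over the windows, and
   the probability that all sums stay below the level is at most
   e n exp(- c 2^(h j)), which is summable in n. *)

Require Import Defs.
From HB Require Import structures.
From mathcomp Require Import all_boot all_order all_algebra.
From mathcomp Require Import all_classical all_reals all_analysis.
From mathcomp Require Import ring lra.
From mathcomp Require Import measurable_realfun summability finmap.

Set Implicit Arguments.
Unset Strict Implicit.
Unset Printing Implicit Defensive.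

Import Order.TTheory GRing.Theory Num.Theory.
Import numFieldNormedType.Exports.

Local Open Scope classical_set_scope.
Local Open Scope ring_scope.

(** * Product measures and expectations *)

(** Origin of the constant: with [l = j log 2] and [sigma ^ 2 = n p / 2 ^ j], where [p] is the
    supremum of the density, a Gaussian tail beyond [sqrt (2 l) * sigma] weighs about
    [e ^ (- l) = 2 ^ (- j)], and about [2 ^ j] windows compete. Two obstacles shape the proof. The
    line carries infinitely many windows, so a union bound needs estimates that vanish with the
    variance of the window. A Chernoff bound does not: at variance zero it is still [e ^ (- lam s)].
    The mean of [e ^ (lam S) - 1 - lam S] is of second order in [S] and does. For the lower bound,
    windows with disjoint supports remain dependent at a fixed sample size. The exponential majorant
    of the indicator bounds the joint probability for sample size [N] by a combination of powers
    [kappa ^ N]. Weighted by [n ^ N / N!], these sum to exponentials that split over the windows.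
    The bounds for the separate [N] are nonnegative, so the one for [N = n] can be singled out. No
    normal approximation of a single sum is needed: the mass near the level is found by comparing
    three exponential tilts. *)

Section power_measure.
Variable R : realType.
Variable P : probability (measurableTypeR R) R.
Variable PN : probability (seq_space R) R.
Hypothesis PN_power : is_power PN P.

Definition scons (a : R) (x : seq_space R) : seq_space R :=
  fun i => if i is k.+1 then x k else a.

Lemma measurable_coord (i : nat) :
  measurable_fun [set: seq_space R] (fun x => x i : measurableTypeR R).
Proof.
move=> _ A mA; apply: sub_sigma_algebra; exists i => //.
by exists A.
Qed.

Lemma measurable_fun_seq_space d (T : measurableType d) (f : T -> seq_space R) :
  (forall i, measurable_fun setT (fun t => f t i : measurableTypeR R)) ->
  measurable_fun setT f.
Proof.
move=> mf; apply: measurability; first reflexivity.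
move=> _ [B [i _ [A mA <-]] <-].
rewrite !setTI; have := mf i measurableT A mA.
by rewrite setTI.
Qed.

Let scons2 (ax : measurableTypeR R * seq_space R) := scons ax.1 ax.2.

Lemma measurable_scons : measurable_fun setT scons2.
Proof.
apply: measurable_fun_seq_space => -[|i]; first exact: measurable_fst.
exact: measurableT_comp (measurable_coord i) measurable_snd.
Qed.

Definition cylinder (n : nat) (A : nat -> set (measurableTypeR R)) :
  set (seq_space R) := [set x | forall i, (i < n)%N -> A i (x i)].

Lemma measurable_cylinder n A : (forall i, measurable (A i)) ->
  measurable (cylinder n A).
Proof.
move=> mA.
have -> : cylinder n A = \bigcap_i
    (fun x : seq_space R => x i : measurableTypeR R) @^-1`
      (if (i < n)%N then A i else setT).
  apply/seteqP; split => x xA i /=; first by move=> _; case: ifP => // /xA.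
  by move=> ilt; have := xA i I; rewrite /= ilt.
apply: bigcap_measurable => [|i _]; first by exists 0%N.
by rewrite -[X in measurable X]setTI; apply: measurable_coord => //; case: ifP.
Qed.

Definition cylinders : set (set (seq_space R)) :=
  [set B | exists n A, (forall i, measurable (A i)) /\ B = cylinder n A].

Lemma cylinders_setI : setI_closed cylinders.
Proof.
move=> _ _ [n [A [mA ->]]] [m [B [mB ->]]].
exists (maxn n m), (fun i => (if (i < n)%N then A i else setT) `&`
                             (if (i < m)%N then B i else setT)); split.
  by move=> i; apply: measurableI; case: ifP.
apply/seteqP; split=> x /=.
  move=> [xA xB] i _; split; case: ifP => // ?; [exact: xA|exact: xB].
move=> xAB; split=> i ilt.
  by have [] := xAB i (leq_trans ilt (leq_maxl _ _)); rewrite ilt.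
by have [_] := xAB i (leq_trans ilt (leq_maxr _ _)); rewrite ilt.
Qed.

Lemma measurable_cylinders :
  @measurable _ (seq_space R) = <<s cylinders >>.
Proof.
apply/seteqP; split.
  apply: smallest_sub; first exact: smallest_sigma_algebra.
  move=> _ [i _ [A mA <-]].
  apply: sub_sigma_algebra.
  exists i.+1, (fun k => if k == i then A else setT); split.
    by move=> k; case: ifP.
  apply/seteqP; split => x /=.
    by move=> [_ xA] k _; case: eqP => [->|].
  by move=> /(_ i (ltnSn _)); rewrite eqxx.
apply: smallest_sub; first exact: sigma_algebra_measurable.
by move=> _ [n [A [mA ->]]]; exact: measurable_cylinder.
Qed.

(** Prepending an independent coordinate to a [PN]-sequence reproduces [PN], because both laws agree
    on the pi-system of cylinders. The inductions on the sample size use independence only in this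
    form. *)
Lemma power_shift (A : set (seq_space R)) : measurable A ->
  PN A = (\int[P]_a PN (scons a @^-1` A))%E.
Proof.
move=> mA.
pose f := scons2.
pose mf : measurable_fun setT f := measurable_scons.
pose Q : {measure set (seq_space R) -> \bar R} :=
  measure_function_pushforward__canonical__measure_function_Measure (P \x PN)%E mf.
rewrite (_ : (\int[P]_a _)%E = Q A); last first.
  rewrite /Q/= /pushforward /product_measure1; apply: eq_integral => a _ /=.
  by congr (PN _); apply/seteqP; split => x; rewrite xsectionP.
apply: (measure_unique cylinders (fun=> setT)) => //.
- exact: measurable_cylinders.
- exact: cylinders_setI.
- by move=> _; exists 0%N, (fun=> setT); split => //; apply/seteqP; split.
- by apply/seteqP; split => // x _; exists 0%N.
- move=> _ [n [B [mB ->]]]; rewrite [LHS](PN_power n mB).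
  case: n => [|n].
    rewrite big_ord0 /Q /= /pushforward.
    rewrite (_ : _ @^-1` _ = setT) ?probability_setT//.
    by apply/seteqP; split => // x _ i.
  rewrite big_ord_recl /= /Q /= /pushforward.
  rewrite (_ : f @^-1` _ = B 0%N `*` cylinder n (fun i => B i.+1)); last first.
    apply/seteqP; split => -[a x] /=.
      by move=> aB; split=> [|i ilt]; [exact: (aB 0%N)|exact: (aB i.+1)].
    by move=> [aB xB] [|i] //; exact: xB.
  rewrite product_measure1E//; last exact: measurable_cylinder.
  by congr (_ * _)%E; rewrite [RHS](PN_power n (fun i => mB i.+1)).
- by move=> _; rewrite (le_lt_trans (probability_le1 _ _))// ?ltry.
Qed.

Lemma power_coord (i : nat) (A : set (measurableTypeR R)) : measurable A ->
  PN [set x | A (x i)] = P A.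
Proof.
move=> mA; have := PN_power i.+1
  (A := fun k => if k == i then A else setT).
rewrite (_ : [set x | _] = [set x : seq_space R | A (x i)]); last first.
  apply/seteqP; split => x /=.
    by move=> /(_ i (ltnSn _)); rewrite eqxx.
  by move=> xA k _; case: eqP => [->|].
move=> ->; last by move=> k; case: ifP.
rewrite big_ord_recr /= eqxx big1 ?mul1e// => k _.
by rewrite ltn_eqF// probability_setT.
Qed.

End power_measure.

(** * Expectations of bounded functions *)

Section bounded_expectation.
Context d (T : measurableType d) (R : realType).
Variable P : probability T R.
Implicit Types f g : T -> R.

(** Unlike integrability, this class is closed under products and exponentials, so the side
    conditions of the expectation rules below can be discharged structurally. *)
Definition bdd_meas f :=
  measurable_fun setT f /\ exists C, forall x, `|f x| <= C.

Lemma bdd_meas_cst (c : R) : bdd_meas (fun=> c).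
Proof. by split=> //; exists `|c|. Qed.

Lemma bdd_measD f g : bdd_meas f -> bdd_meas g -> bdd_meas (fun x => f x + g x).
Proof.
move=> [mf [C fC]] [mg [D gD]]; split; first exact: measurable_funD.
by exists (C + D) => x; rewrite (le_trans (ler_normD _ _))// lerD.
Qed.

Lemma bdd_measM f g : bdd_meas f -> bdd_meas g -> bdd_meas (fun x => f x * g x).
Proof.
move=> [mf [C fC]] [mg [D gD]]; split; first exact: measurable_funM.
by exists (C * D) => x; rewrite normrM ler_pM.
Qed.

Lemma bdd_measZ (c : R) f : bdd_meas f -> bdd_meas (fun x => c * f x).
Proof. by move=> bf; apply: bdd_measM => //; exact: bdd_meas_cst. Qed.

Lemma bdd_meas_affine (c k : R) f : bdd_meas f ->
  bdd_meas (fun x => c + k * f x).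
Proof.
by move=> bf; apply: bdd_measD; [exact: bdd_meas_cst|exact: bdd_measZ].
Qed.

Lemma bdd_measN f : bdd_meas f -> bdd_meas (fun x => - f x).
Proof.
move=> [mf [C fC]]; split; first exact: measurableT_comp.
by exists C => x; rewrite normrN.
Qed.

Lemma bdd_measB f g : bdd_meas f -> bdd_meas g -> bdd_meas (fun x => f x - g x).
Proof. by move=> bf bg; apply: bdd_measD => //; exact: bdd_measN. Qed.

Lemma bdd_meas_sum (I : Type) (s : seq I) (Q : pred I) (F : I -> T -> R) :
  (forall i, bdd_meas (F i)) -> bdd_meas (fun x => \sum_(i <- s | Q i) F i x).
Proof.
move=> bF; elim: s => [|i s IH].
  rewrite (_ : (fun x => _) = fun=> 0); first exact: bdd_meas_cst.
  by apply/funext => x; rewrite big_nil.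
rewrite (_ : (fun x => _) = fun x =>
  (if Q i then F i x else 0) + \sum_(i <- s | Q i) F i x).
  by apply: bdd_measD => //; case: (Q i) => //; exact: bdd_meas_cst.
by apply/funext => x; rewrite big_cons; case: ifP; rewrite ?add0r.
Qed.

Lemma bdd_meas_expR f : bdd_meas f -> bdd_meas (fun x => expR (f x)).
Proof.
move=> [mf [C fC]]; split; first exact: measurableT_comp.
exists (expR C) => x; rewrite ger0_norm ?expR_ge0// ler_expR.
by rewrite (le_trans (ler_norm _)).
Qed.

Lemma bdd_meas_integrable f : bdd_meas f -> P.-integrable setT (EFin \o f).
Proof.
move=> [mf [C fC]]; apply: measurable_bounded_integrable => //.
  by rewrite (le_lt_trans (probability_le1 _ _)) ?ltry.
exists C; split; first exact: num_real.
by move=> x Cx y _; apply: le_trans (fC y) (ltW Cx).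
Qed.

Lemma EFin_expect f : bdd_meas f ->
  ((\int[P]_x f x)%:E = \int[P]_x (f x)%:E)%E.
Proof.
move=> /bdd_meas_integrable bf; rewrite /Rintegral fineK//.
exact: integrable_fin_num.
Qed.

Lemma expectD f g : bdd_meas f -> bdd_meas g ->
  \int[P]_x (f x + g x) = \int[P]_x f x + \int[P]_x g x.
Proof. by move=> bf bg; rewrite RintegralD//; exact: bdd_meas_integrable. Qed.

Lemma expectB f g : bdd_meas f -> bdd_meas g ->
  \int[P]_x (f x - g x) = \int[P]_x f x - \int[P]_x g x.
Proof. by move=> bf bg; rewrite RintegralB//; exact: bdd_meas_integrable. Qed.

Lemma expectZ (c : R) f : bdd_meas f ->
  \int[P]_x (c * f x) = c * \int[P]_x f x.
Proof. by move=> bf; rewrite RintegralZl//; exact: bdd_meas_integrable. Qed.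

Lemma expect_cst (c : R) : \int[P]_x c = c.
Proof. by rewrite Rintegral_cst// [X in fine X](probability_setT P) mulr1. Qed.

Lemma expect_affine (c k : R) f : bdd_meas f ->
  \int[P]_x (c + k * f x) = c + k * \int[P]_x f x.
Proof.
move=> bf; rewrite (@expectD (fun=> c) (fun x => k * f x)) ?expect_cst ?expectZ//.
- exact: bdd_meas_cst.
- exact: bdd_measZ.
Qed.

Lemma expect_sum (I : Type) (s : seq I) (Q : pred I) (F : I -> T -> R) :
  (forall i, bdd_meas (F i)) ->
  \int[P]_x (\sum_(i <- s | Q i) F i x) = \sum_(i <- s | Q i) \int[P]_x F i x.
Proof.
move=> bF; elim: s => [|i s IH].
  by rewrite big_nil; under eq_Rintegral do rewrite big_nil; exact: expect_cst.
rewrite big_cons; under eq_Rintegral do rewrite big_cons.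
case: ifP => Qi; last exact: IH.
by rewrite expectD ?IH//; exact: bdd_meas_sum.
Qed.

Lemma expect_le f g : bdd_meas f -> bdd_meas g -> (forall x, f x <= g x) ->
  \int[P]_x f x <= \int[P]_x g x.
Proof.
by move=> bf bg fg; apply: le_Rintegral => //; exact: bdd_meas_integrable.
Qed.

Lemma expect_le_cst f (c : R) : bdd_meas f -> (forall x, f x <= c) ->
  \int[P]_x f x <= c.
Proof.
by move=> bf fc; rewrite -[leRHS]expect_cst; apply: expect_le => //; exact: bdd_meas_cst.
Qed.

Lemma expect_ge0 f : (forall x, 0 <= f x) -> 0 <= \int[P]_x f x.
Proof. by move=> f0; apply: Rintegral_ge0. Qed.

End bounded_expectation.

#[local] Hint Resolve bdd_meas_cst : core.

(** * Exponential bounds for sums *)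

Section exponential_function.
Variable R : realType.
Implicit Types x y : R.

Lemma expRB1D_ge0 x : 0 <= expR x - 1 - x.
Proof. by have := expR_ge1Dx x; lra. Qed.

Lemma expRB1D_gt0 x : 0 < x -> 0 < expR x - 1 - x.
Proof. by move=> x0; have := @expR_gt1Dx R x; rewrite gt_eqF// => /(_ isT); lra. Qed.

Lemma expRB1D_le x y : 0 <= x -> x <= y ->
  expR x - 1 - x <= expR y - 1 - y.
Proof.
move=> x0 xy; have := expR_ge1Dx (y - x).
rewrite -(ler_pM2l (expR_gt0 x)) -expRD.
have -> : x + (y - x) = y by ring.
by have := expR_ge1Dx x; nra.
Qed.

(** A weak Stirling bound, by induction from [(1 - 1 / (n + 2)) ^ (n + 2) <= e ^ (- 1)]. It is the
    price of keeping only the term [N = n] of a Poisson sum. *)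
Lemma fact_le_expR (n : nat) : (0 < n)%N ->
  n`!%:R * expR n%:R <= expR 1 * n%:R * n%:R ^+ n :> R.
Proof.
case: n => // n _; elim: n => [|n IH]; first by rewrite expr1n !mulr1 mul1r.
have n1 : (0 : R) < n.+1%:R by rewrite ltr0n.
have n2 : (0 : R) < n.+2%:R by rewrite ltr0n.
have nE : n.+2%:R = n.+1%:R + 1 :> R by rewrite natr1.
have key : (n.+1%:R / n.+2%:R) ^+ n.+2 <= expR (- 1) :> R.
  have -> : - 1 = - (1 / n.+2%:R) * n.+2%:R :> R by field; rewrite gt_eqF.
  rewrite expRM_natr.
  apply: lerXn2r; rewrite ?nnegrE ?expR_ge0 ?divr_ge0 ?ler0n//.
  have := expR_ge1Dx (- (1 / n.+2%:R) : R).
  have -> : 1 + - (1 / n.+2%:R) = n.+1%:R / n.+2%:R :> R.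
    rewrite nE; field.
    rewrite gt_eqF//; have := ler0n R n; lra.
  by [].
rewrite factS natrM nE expRD.
have -> : (n.+1%:R + 1) * n.+1`!%:R * (expR n.+1%:R * expR 1) =
  (n.+1%:R + 1) * expR 1 * (n.+1`!%:R * expR n.+1%:R) :> R by ring.
apply: le_trans (ler_wpM2l _ IH) _; first by rewrite mulr_ge0 ?expR_ge0// addr_ge0.
have e0 := expR_gt0 (1 : R).
rewrite -nE.
have -> : expR 1 * n.+2%:R * n.+2%:R ^+ n.+2 =
    n.+2%:R * expR 1 * (n.+2%:R ^+ n.+2) :> R by ring.
rewrite ler_pM2l; last exact: mulr_gt0.
rewrite -mulrA -exprS.
move: key; rewrite expr_div_n ler_pdivrMr ?exprn_gt0// => key.
rewrite -(ler_pM2l (expR_gt0 (-1 : R))) mulrA -expRD addrC subrr expR0 mul1r.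
by [].
Qed.

End exponential_function.

(** * Maximal inequality for partial sums *)

Section tail_bounds.
Variable R : realType.
Variable P : probability (measurableTypeR R) R.
Variable PN : probability (seq_space R) R.
Hypothesis PN_power : is_power PN P.

Lemma measurable_fun_partial_sum (h : R -> R) (n : nat) :
  measurable_fun [set: measurableTypeR R] h ->
  measurable_fun [set: seq_space R] (fun x => \sum_(i < n) h (x i)).
Proof.
move=> mh; apply: measurable_sum => i.
exact: measurableT_comp mh (measurable_coord i).
Qed.

Lemma power_shift_le (A : set (seq_space R)) (G : R -> R) :
  measurable A -> bdd_meas (G : measurableTypeR R -> R) ->
  (forall a, (PN (scons a @^-1` A) <= (G a)%:E)%E) ->
  (PN A <= (\int[P]_a G a)%:E)%E.
Proof.
move=> mA bG AG; rewrite (power_shift PN_power mA) (EFin_expect P bG).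
apply: ge0_le_integral => //.
- have mX := @measurable_fun_xsection _ _ (measurableTypeR R) (seq_space R) R PN
    _ (measurable_scons (R:=R) measurableT mA).
  move: mX; rewrite (_ : _ \o _ = fun a => PN (scons a @^-1` A))//.
  apply/funext => a /=; congr (PN _).
  by apply/seteqP; split => x; rewrite xsectionP setTI.
- by apply/measurable_EFinP; exact: bG.1.
Qed.

(** The offset [c] is there for induction on [N]: after a first observation [a], with [c] still
    below [s], the event is the same one with offset [c + h a] and one step fewer. *)
Definition max_event (h : R -> R) (N : nat) (c s : R) : set (seq_space R) :=
  [set x : seq_space R | exists2 n, (n <= N)%N & s <= c + \sum_(i < n) h (x i)].

Lemma measurable_max_event (h : R -> R) N c s :
  measurable_fun [set: measurableTypeR R] h -> measurable (max_event h N c s).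
Proof.
move=> mh.
have -> : max_event h N c s = \bigcup_n (if (n <= N)%N then
    (fun x : seq_space R => c + \sum_(i < n) h (x i)) @^-1` `[s, +oo[ else set0).
  apply/seteqP; split=> x /=.
    by move=> [n nN H]; exists n; rewrite // nN /= in_itv /= H.
  by move=> [n _]; case: ifP => // nN; rewrite /= in_itv /= andbT; exists n.
apply: bigcup_measurable => n _; case: ifP => // _.
rewrite -[X in measurable X]setTI; apply: measurable_funD => //.
exact: measurable_fun_partial_sum.
Qed.

(* Doob's inequality for the submartingale [expR (lam * S) - 1 - lam * S]. *)
Lemma maximal_inequality (h : R -> R) (lam s : R) (N : nat) (c : R) :
  bdd_meas (h : measurableTypeR R -> R) -> \int[P]_a h a = 0 ->
  0 < lam -> 0 < s ->
  (PN (max_event h N c s) <=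
   ((expR (lam * c) * (\int[P]_a expR (lam * h a)) ^+ N - 1 - lam * c)
    / (expR (lam * s) - 1 - lam * s))%:E)%E.
Proof.
move=> bh h0 lam0 s0; set mu := \int[P]_a _.
have bl : bdd_meas (fun a : measurableTypeR R => lam * h a) by exact: bdd_measZ.
have be := bdd_meas_expR bl.
have mu1 : 1 <= mu.
  have -> : 1 = \int[P]_a (1 + lam * h a).
    by rewrite (@expect_affine _ (measurableTypeR R))// h0 mulr0 addr0.
  apply: expect_le => //; first exact: bdd_meas_affine.
  by move=> a; exact: expR_ge1Dx.
have g0 : 0 < expR (lam * s) - 1 - lam * s by rewrite expRB1D_gt0// mulr_gt0.
(* A start at or beyond [s] makes the claimed bound at least 1, since [mu >= 1] and [e ^ x - 1 - x]
   is nondecreasing for [x >= 0]. *)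
have step (M : nat) (b : R) : s <= b ->
   (PN (max_event h M b s) <=
   ((expR (lam * b) * mu ^+ M - 1 - lam * b)
    / (expR (lam * s) - 1 - lam * s))%:E)%E.
  move=> sb; apply: (le_trans (probability_le1 _ _)).
    by apply: measurable_max_event; exact: bh.1.
  rewrite lee_fin ler_pdivlMr// mul1r.
  apply: (@le_trans _ _ (expR (lam * b) - 1 - lam * b)).
    by apply: expRB1D_le; rewrite ?mulr_ge0 ?ler_pM2l// ltW.
  by rewrite !lerD2r ler_peMr ?expR_ge0// exprn_ege1.
elim: N c => [|N IH] c; have [sc|cs] := leP s c; try exact: step.
  rewrite (_ : max_event _ _ _ _ = set0) ?measure0.
    rewrite expr0 mulr1 lee_fin divr_ge0//; last exact: ltW.
    exact: expRB1D_ge0.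
  apply/seteqP; split => x //= -[n]; rewrite leqn0 => /eqP ->.
  by rewrite big_ord0 addr0 leNgt cs.
(* [G a] is the bound for [N] steps from [c + h a]. As [h] has mean zero, its expectation is exactly
   the bound for [N + 1] steps from [c]. *)
pose G a := (expR (lam * (c + h a)) * mu ^+ N - 1 - lam * (c + h a))
    / (expR (lam * s) - 1 - lam * s).
set K := (X in (_ <= X)%E).
have GE a : G a = (expR (lam * s) - 1 - lam * s)^-1 *
   (expR (lam * c) * mu ^+ N * expR (lam * h a) - (1 + lam * c + lam * h a)).
  by rewrite /G mulrDr expRD; ring.
have b1 : bdd_meas (fun a : measurableTypeR R =>
    expR (lam * c) * mu ^+ N * expR (lam * h a)) by exact: bdd_measZ.
have b2 : bdd_meas (fun a : measurableTypeR R => 1 + lam * c + lam * h a).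
  exact: bdd_meas_affine.
have bG : bdd_meas (G : measurableTypeR R -> R).
  by rewrite (funext GE); apply: bdd_measZ; exact: bdd_measB.
have -> : K = (\int[P]_a G a)%:E.
  rewrite /K (funext GE) expectZ ?expectB ?expectZ//; last exact: bdd_measB.
  rewrite expect_affine// h0 -/mu exprSr; congr (_%:E); ring.
apply: power_shift_le => //.
  by apply: measurable_max_event; exact: bh.1.
move=> a; rewrite (_ : _ @^-1` _ = max_event h N (c + h a) s) ?IH//.
apply/seteqP; split => x /=.
  move=> [[|n]].
    by rewrite big_ord0 addr0 leNgt cs.
  by rewrite ltnS big_ord_recl /= => nN; exists n; rewrite // -addrA.
by move=> [n nN]; exists n.+1; rewrite // big_ord_recl/= addrA.
Qed.

End tail_bounds.

(** * Poissonization over disjoint windows *)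

Section poissonization.
Variable R : realType.
Variable P : probability (measurableTypeR R) R.
Variable PN : probability (seq_space R) R.
Hypothesis PN_power : is_power PN P.
Variables (M q : nat) (f : 'I_M -> R -> R) (K lam : 'I_q -> R) (t : R).
Hypothesis bdd_f : forall m, bdd_meas (f m : measurableTypeR R -> R).
Hypothesis disjoint_f : forall a m m', m != m' -> f m a = 0 \/ f m' a = 0.
Let G (x : R) := \sum_(r < q) K r * expR (lam r * x).
Hypothesis G_ge0 : forall x, 0 <= G x.
Hypothesis G_ge1 : forall x, x < t -> 1 <= G x.

(** At most one summand is nonzero, so the exponential of the sum is additive over windows. This is
    what lets the Poissonized expectation become a product. *)
Lemma expR_sum_disjoint (u : 'I_M -> R) :
  (forall m m', m != m' -> u m = 0 \/ u m' = 0) ->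
  expR (\sum_m u m) = 1 + \sum_m (expR (u m) - 1).
Proof.
move=> du; have [m um|u0] := pickP (fun m => u m != 0).
  have z m' : m' != m -> u m' = 0.
    by move=> /du [//|um0]; move: um; rewrite um0 eqxx.
  rewrite (bigD1 m)//= [in RHS](bigD1 m)//= big1 => [|m' /z //].
  rewrite big1 ?addr0 => [|m' /z ->]; last by rewrite expR0 subrr.
  by rewrite addrC subrK.
have z m : u m = 0 by apply/eqP; have := u0 m; case: eqP.
rewrite !big1 ?expR0 ?addr0//.
by move=> m _; rewrite z expR0 subrr.
Qed.

Definition below_event (N : nat) (c : 'I_M -> R) : set (seq_space R) :=
  [set x : seq_space R | forall m, c m + \sum_(i < N) f m (x i) < t].

Lemma measurable_below_event N c : measurable (below_event N c).
Proof.
have -> : below_event N c = \bigcap_(m in [set: 'I_M])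
    (fun x : seq_space R => c m + \sum_(i < N) f m (x i)) @^-1` `]-oo, t[.
  apply/seteqP; split=> x /=.
    by move=> H m _; rewrite /= in_itv /=.
  by move=> H m; have := H m I; rewrite /= in_itv.
apply: fin_bigcap_measurable => [|m _]; first exact: finite_finset.
rewrite -[X in measurable X]setTI; apply: measurable_funD => //.
by apply: measurable_fun_partial_sum; exact: (bdd_f m).1.
Qed.

Let psi (r : 'I_q) (m : 'I_M) := \int[P]_a (expR (lam r * f m a) - 1).

(** [H N c] is the expectation of the product over [m] of [G] at [c m] plus the sum of [N] copies of
    [f m]. Expanding the product gives one term for each choice [r] of an exponent per window, and
    independence makes that term an [N]-th power. *)
Let H (N : nat) (c : 'I_M -> R) :=
  \sum_(r : {ffun 'I_M -> 'I_q})
    (\prod_m (K (r m) * expR (lam (r m) * c m))) *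
    (1 + \sum_m psi (r m) m) ^+ N.

(** The product of the [G (c m)] dominates the indicator of the event without observations, since
    [G] is at least 1 below [t] and nonnegative elsewhere. Induction then averages over the first
    coordinate. *)
Let below_le N c : (PN (below_event N c) <= (H N c)%:E)%E.
Proof.
elim: N c => [|N IH] c.
  have -> : H 0%N c = \prod_m G (c m).
    rewrite /H bigA_distr_bigA/=.
    by apply: eq_bigr => r _; rewrite expr0 mulr1.
  have [cP|/existsNP[m /negP]] := pselect (forall m, c m < t).
    apply: (le_trans (probability_le1 _ _)); first exact: measurable_below_event.
    rewrite lee_fin; elim/big_rec : _ => // m x _ x1.
    by rewrite mulr_ege1// G_ge1.
  rewrite -leNgt => ct; rewrite (_ : below_event _ _ = set0) ?measure0.
    by rewrite lee_fin prodr_ge0.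
  apply/seteqP; split => x //= /(_ m).
  by rewrite big_ord0 addr0 ltNge ct.
pose A (r : {ffun 'I_M -> 'I_q}) :=
  (\prod_m (K (r m) * expR (lam (r m) * c m))) * (1 + \sum_m psi (r m) m) ^+ N.
pose B (r : {ffun 'I_M -> 'I_q}) m a := expR (lam (r m) * f m a) - 1.
have bB r m : bdd_meas (B r m : measurableTypeR R -> R).
  apply: bdd_measB; last exact: bdd_meas_cst.
  by apply: bdd_meas_expR; exact: bdd_measZ.
have bS r : bdd_meas ((fun a => 1 + \sum_m B r m a) : measurableTypeR R -> R).
  apply: bdd_measD; first exact: bdd_meas_cst.
  by apply: bdd_meas_sum => m; exact: bB.
have HE a : H N (fun m => c m + f m a) = \sum_r A r * (1 + \sum_m B r m a).
  apply: eq_bigr => r _; rewrite /A -expR_sum_disjoint; last first.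
    by move=> m m' /(disjoint_f a) [] ->; rewrite mulr0; [left|right].
  rewrite mulrAC; congr (_ * _); rewrite expR_sum -big_split/=.
  by apply: eq_bigr => m _; rewrite mulrDr expRD mulrA.
have -> : H N.+1 c = \int[P]_a (H N (fun m => c m + f m a)).
  rewrite (funext HE) (@expect_sum _ (measurableTypeR R)); last first.
    by move=> r; exact: bdd_measZ.
  apply: eq_bigr => r _; rewrite expectZ// /A exprSr mulrA; congr (_ * _).
  rewrite (@expectD _ (measurableTypeR R) _ _ (fun=> 1)).
  - by rewrite (expect_cst P) (@expect_sum _ (measurableTypeR R)).
  - exact: bdd_meas_cst.
  - by apply: bdd_meas_sum => m; exact: bB.
apply: (power_shift_le PN_power).
- exact: measurable_below_event.
- rewrite (funext HE); apply: bdd_meas_sum => r; exact: bdd_measZ.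
- move=> a; rewrite (_ : _ @^-1` _ = below_event N (fun m => c m + f m a)) ?IH//.
  apply/seteqP; split => x /= + m => /(_ m).
    by rewrite big_ord_recl /= addrA.
  by rewrite big_ord_recl /= addrA.
Qed.

(* Weight the bounds [H N c] by [n ^ N / N`!] and sum over [N]: the sum over the
   choices of exponents becomes a product over [m].  Keeping only [N = n] on the
   left costs the factor [n`! * e ^ n / n ^ n <= e * n]. *)
Lemma poisson_below (n : nat) (c : 'I_M -> R) : (0 < n)%N ->
  (PN (below_event n c) <= (expR 1 * n%:R *
    \prod_m \sum_(r < q) K r * expR (lam r * c m + n%:R * psi r m))%:E)%E.
Proof.
move=> n0.
have n0' : (0 : R) < n%:R by rewrite ltr0n.
have [v PNv] : exists v : R, PN (below_event n c) = v%:E.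
  by exists (fine (PN (below_event n c))); rewrite fineK// fin_num_measure//;
    exact: measurable_below_event.
have vH : v <= H n c by rewrite -lee_fin -PNv.
have H0 N : 0 <= H N c.
  by rewrite -lee_fin; apply: le_trans (below_le N c).
pose C (r : {ffun 'I_M -> 'I_q}) := \prod_m (K (r m) * expR (lam (r m) * c m)).
pose kap (r : {ffun 'I_M -> 'I_q}) := 1 + \sum_m psi (r m) m.
pose S (k : nat) := \sum_r C r * series (exp_coeff (n%:R * kap r)) k.
have SE k : S k = \sum_(0 <= N < k) n%:R ^+ N / N`!%:R * H N c.
  rewrite /S /H /series /=.
  under eq_bigr do rewrite mulr_sumr.
  rewrite exchange_big /=; apply: eq_bigr => N _.
  rewrite mulr_sumr; apply: eq_bigr => r _.
  rewrite /exp_coeff/= -/(C r) -/(kap r) exprMn; ring.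
have Scvg : S k @[k --> \oo] --> \sum_r C r * expR (n%:R * kap r).
  rewrite /S; apply: cvg_big => [|r _].
    by apply: add_continuous.
  by apply: cvgM; [exact: cvg_cst|exact: is_cvg_series_exp_coeff].
have Sge k : (n < k)%N -> n%:R ^+ n / n`!%:R * v <= S k.
  move=> nk; rewrite SE (big_cat_nat (n := n.+1))//= big_nat_recr//=.
  rewrite -addrA addrC -addrA ler_wpDr//.
    rewrite addr_ge0//; apply: sumr_ge0 => N _;
      by rewrite mulr_ge0// divr_ge0// exprn_ge0// ltW.
  by rewrite ler_wpM2l// divr_ge0// exprn_ge0// ltW.
have : n%:R ^+ n / n`!%:R * v <= \sum_r C r * expR (n%:R * kap r).
  apply: (cvgr_to_ge Scvg); exists n.+1 => // k /= nk; exact: Sge.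
rewrite (_ : \sum_r _ = expR n%:R * \prod_m \sum_(r < q)
    K r * expR (lam r * c m + n%:R * psi r m)); last first.
  rewrite bigA_distr_bigA mulr_sumr; apply: eq_bigr => r _.
  rewrite /kap mulrDr mulr1 expRD mulrCA; congr (_ * _).
  rewrite mulr_sumr expR_sum -big_split/=; apply: eq_bigr => m _.
  by rewrite expRD mulrA.
set Q := \prod_m _ => vQ.
have v0 : 0 <= v by rewrite -lee_fin -PNv.
have p0 : 0 < n%:R ^+ n / n`!%:R :> R.
  by rewrite divr_gt0 ?exprn_gt0// ltr0n fact_gt0.
have Q0 : 0 <= Q.
  rewrite -(pmulr_rge0 _ (expR_gt0 (n%:R : R))).
  by apply: le_trans vQ; rewrite mulr_ge0// ltW.
rewrite PNv lee_fin -(ler_pM2l p0); apply: (le_trans vQ).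
rewrite mulrA ler_wpM2r// mulrAC ler_pdivlMr ?ltr0n ?fact_gt0//.
by have := @fact_le_expR R n n0; rewrite [n`!%:R * _]mulrC [X in _ <= X]mulrC.
Qed.

End poissonization.

(** * Quadratic bounds for logarithmic moments *)

Section exponential_taylor.
Variable R : realType.

(** From the third power on, each term of the exponential series is at most [|x| ^ 3] times the
    corresponding term of the series at 1. *)
Lemma expR_taylor2 (x : R) : `|x| <= 1 ->
  `|expR x - (1 + x + x ^+ 2 / 2)| <= `|x| ^+ 3 * expR 1.
Proof.
move=> x1; set T := 1 + _ + _.
have e1_le n : series (exp_coeff 1) n <= expR 1 :> R.
  apply: nondecreasing_cvgn_le; last exact: is_cvg_series_exp_coeff.
  by apply: nondecreasing_series => k _ _; rewrite /exp_coeff/= expr1n divr_ge0.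
have partial n : `|series (exp_coeff x) (n + 3)%N - T| <=
    `|x| ^+ 3 * series (exp_coeff 1) (n + 3)%N.
  elim: n => [|n IH].
    rewrite (_ : _ - T = 0) ?normr0.
      rewrite mulr_ge0// /series/= sumr_ge0// => k _.
      by rewrite /exp_coeff/= expr1n divr_ge0.
    rewrite /T /series/= big_nat_recr//= big_nat_recr//= big_nat_recr//= big_nil.
    by rewrite /exp_coeff/= expr0 expr1 !factS fact0 !muln1; field.
  rewrite addSn !seriesSr mulrDr addrAC (le_trans (ler_normD _ _))// lerD//.
  rewrite /exp_coeff/= expr1n normrM normrX (ger0_norm (x := _^-1)); last first.
    by rewrite invr_ge0.
  rewrite div1r ler_wpM2r ?invr_ge0// exprD ler_piMl// ?exprn_ge0//.
  by rewrite exprn_ile1.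
have cvgx : `|series (exp_coeff x) n - T| @[n --> \oo] --> `|expR x - T|.
  apply: cvg_norm; apply: cvgB; last exact: cvg_cst.
  exact: is_cvg_series_exp_coeff.
apply: (cvgr_to_le cvgx); exists 3%N => // n /= n3.
rewrite -(subnK n3) (le_trans (partial _))// ler_wpM2l// exprn_ge0//.
Qed.

Lemma expR_quadratic (eps : R) : 0 < eps -> exists2 eta : R, 0 < eta &
  forall x, `|x| <= eta ->
    (1 - eps) * (x ^+ 2 / 2) <= expR x - 1 - x <= (1 + eps) * (x ^+ 2 / 2).
Proof.
move=> eps0; have e0 := expR_gt0 (1 : R).
(* With this bound on [|x|] the cubic remainder [e * |x| ^ 3] is at most [eps * x ^ 2 / 2]. *)
exists (Num.min 1 (eps / (2 * expR 1))).
  by rewrite lt_min ltr01 divr_gt0// mulr_gt0.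
move=> x; rewrite le_min => /andP[x1 xe].
have := expR_taylor2 x1.
have -> : `|x| ^+ 3 = `|x| * x ^+ 2 by rewrite exprS real_normK ?num_real.
have x2 : 0 <= x ^+ 2 by rewrite sqr_ge0.
move: xe; rewrite ler_pdivlMr ?mulr_gt0// => xe.
have h : `|x| * x ^+ 2 * expR 1 <= eps * (x ^+ 2 / 2).
  have := ler_wpM2r x2 xe; lra.
move=> /le_trans /(_ h); rewrite ler_norml => /andP[]; lra.
Qed.

End exponential_taylor.

Section log_moment.
Variable R : realType.
Variable P : probability (measurableTypeR R) R.
Variables (f : R -> R) (C : R).
Hypothesis mf : measurable_fun [set: measurableTypeR R] f.
Hypothesis fC : forall a, `|f a| <= C.

(** For a sum over a Poisson number of observations, minus its mean, this is the exact logarithm of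
    the moment generating function, per unit of intensity. For a single centered variable it is an
    upper bound, see [centered_mgf_le]. *)
Definition log_moment (l : R) := \int[P]_a (expR (l * f a) - 1 - l * f a).

Lemma bounded_bdd_meas : bdd_meas (f : measurableTypeR R -> R).
Proof. by split=> //; exists C. Qed.

Let bf := bounded_bdd_meas.

Lemma bdd_meas_sqr : bdd_meas ((fun a => f a ^+ 2) : measurableTypeR R -> R).
Proof. exact: bdd_measM. Qed.

Let bl l : bdd_meas ((fun a => expR (l * f a) - 1 - l * f a)
  : measurableTypeR R -> R).
Proof.
apply: bdd_measB; last exact: bdd_measZ.
apply: bdd_measB; last exact: bdd_meas_cst.
by apply: bdd_meas_expR; exact: bdd_measZ.
Qed.

Lemma log_momentE l :
  log_moment l = \int[P]_a (expR (l * f a) - 1) - l * \int[P]_a f a.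
Proof.
rewrite /log_moment (@expectB _ (measurableTypeR R)).
- by rewrite (expectZ _ _ bf).
- apply: bdd_measB; last exact: bdd_meas_cst.
  by apply: bdd_meas_expR; exact: bdd_measZ.
- exact: bdd_measZ.
Qed.

Lemma log_moment_bounds (eps eta l : R) :
  (forall x, `|x| <= eta ->
    (1 - eps) * (x ^+ 2 / 2) <= expR x - 1 - x <= (1 + eps) * (x ^+ 2 / 2)) ->
  `|l| * C <= eta ->
  (1 - eps) * (l ^+ 2 / 2) * \int[P]_a (f a ^+ 2) <= log_moment l <=
  (1 + eps) * (l ^+ 2 / 2) * \int[P]_a (f a ^+ 2).
Proof.
move=> Q lC.
have lf a : `|l * f a| <= eta.
  by rewrite normrM (le_trans _ lC)// ler_wpM2l.
rewrite -!(expectZ _ _ bdd_meas_sqr) /log_moment.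
apply/andP; split; apply: expect_le => //; try exact: (bdd_measZ _ bdd_meas_sqr).
  by move=> a; have /andP[+ _] := Q _ (lf a); rewrite exprMn; lra.
by move=> a; have /andP[_ +] := Q _ (lf a); rewrite exprMn; lra.
Qed.

(** The uncentered moment generating function is [1 + log_moment l + l * mu]; apply [1 + x <= e ^ x]
    and cancel the factor [e ^ (- l * mu)] of the centering. *)
Lemma centered_mgf_le l :
  \int[P]_a expR (l * (f a - \int[P]_b f b)) <= expR (log_moment l).
Proof.
set mu := \int[P]_b f b.
have be : bdd_meas ((fun a => expR (l * f a)) : measurableTypeR R -> R).
  by apply: bdd_meas_expR; exact: bdd_measZ.
have -> : (fun a => expR (l * (f a - mu))) = fun a => expR (- (l * mu)) * expR (l * f a).
  by apply/funext => a; rewrite -expRD; congr expR; ring.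
rewrite (expectZ _ _ be).
have -> : \int[P]_a expR (l * f a) = 1 + log_moment l + l * mu.
  rewrite log_momentE (@expectB _ (measurableTypeR R))//.
  by rewrite (expect_cst P) -/mu; ring.
have -> : log_moment l = - (l * mu) + (log_moment l + l * mu) by ring.
rewrite [leRHS]expRD ler_wpM2l ?expR_ge0//.
by have := expR_ge1Dx (log_moment l + l * mu); lra.
Qed.

End log_moment.

(** * Upper tail over infinitely many windows *)

Section upper_tail.
Variable R : realType.
Variable P : probability (measurableTypeR R) R.
Variable PN : probability (seq_space R) R.
Hypothesis PN_power : is_power PN P.
Variables (f : nat -> R -> R) (C V D : R).
Hypothesis mf : forall m, measurable_fun [set: measurableTypeR R] (f m).
Hypothesis fC : forall m a, `|f m a| <= C.
Hypothesis fV : forall m, \int[P]_a (f m a ^+ 2) <= V.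
Hypothesis fD : forall K, \sum_(0 <= m < K) \int[P]_a (f m a ^+ 2) <= D.

Definition centered (g : R -> R) (a : R) := g a - \int[P]_b g b.

Lemma measurable_centered (g : R -> R) :
  measurable_fun [set: measurableTypeR R] g ->
  measurable_fun [set: measurableTypeR R] (centered g).
Proof. by move=> mg; apply: measurable_funB. Qed.

(** With [w = W * v], the numerator of the maximal inequality is at most [e ^ w - 1 <= w * e ^ w].
    The variance [v] of this particular window is kept as a factor, to be summed over [m], and is
    replaced by the uniform bound [V] only in the exponent. *)
Lemma single_upper_tail (eps eta lam s : R) (N m : nat) :
  0 <= eps ->
  (forall x, `|x| <= eta ->
    (1 - eps) * (x ^+ 2 / 2) <= expR x - 1 - x <= (1 + eps) * (x ^+ 2 / 2)) ->
  0 < lam -> 0 < s -> lam * C <= eta ->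
  (PN (max_event (centered (f m)) N 0 s) <=
    (N%:R * (1 + eps) * lam ^+ 2 / 2 *
      expR (N%:R * (1 + eps) * lam ^+ 2 / 2 * V) /
      (expR (lam * s) - 1 - lam * s) * \int[P]_a (f m a ^+ 2))%:E)%E.
Proof.
move=> eps0 Q lam0 s0 lC; set v := \int[P]_a _.
have bf := bounded_bdd_meas (mf m) (fC m).
have bh : bdd_meas (centered (f m) : measurableTypeR R -> R).
  by apply: bdd_measB => //; exact: bdd_meas_cst.
have h0 : \int[P]_a centered (f m) a = 0.
  rewrite (@expectB _ (measurableTypeR R))//.
  by rewrite (expect_cst P) subrr.
apply: (le_trans (maximal_inequality PN_power N 0 bh h0 lam0 s0)).
rewrite mulr0 expR0 mul1r subr0 lee_fin.
have g0 : 0 < expR (lam * s) - 1 - lam * s by rewrite expRB1D_gt0// mulr_gt0.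
set W := N%:R * _ * _ / 2.
have W0 : 0 <= W by rewrite divr_ge0// !mulr_ge0// ?addr_ge0// ltW.
have v0 : 0 <= v by apply: expect_ge0 => a; exact: sqr_ge0.
rewrite [leRHS]mulrAC ler_wpM2r ?invr_ge0 ?(ltW g0)//.
set mu := \int[P]_a _.
have muN : mu ^+ N <= expR (W * v).
  have mu_le : mu <= expR (log_moment P (f m) lam).
    exact: centered_mgf_le (mf m) (fC m) lam.
  apply: (@le_trans _ _ (expR (log_moment P (f m) lam) ^+ N)).
    by rewrite lerXn2r ?nnegrE ?expR_ge0// expect_ge0// => a; exact: expR_ge0.
  rewrite -expRM_natl ler_expR.
  have /andP[_ lb] := log_moment_bounds P (mf m) (fC m) Q
    (eq_ind_r (fun u => u * C <= eta) lC (gtr0_norm lam0)).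
  apply: le_trans (ler_wpM2l (ler0n _ _) lb) _.
  by rewrite /W -/v le_eqVlt; apply/orP; left; apply/eqP; ring.
apply: (@le_trans _ _ (expR (W * v) - 1)); first by rewrite lerB.
apply: (@le_trans _ _ (W * v * expR (W * v))).
  have := expR_ge1Dx (- (W * v)); rewrite expRN => h.
  have e0 := expR_gt0 (W * v).
  have := ler_wpM2r (ltW e0) h; rewrite mulVf ?gt_eqF//; lra.
rewrite mulrAC ler_wpM2r// ler_wpM2l// ler_expR ler_wpM2l//; exact: fV.
Qed.

Lemma upper_tail (eps eta lam s : R) (N : nat) :
  0 <= eps ->
  (forall x, `|x| <= eta ->
    (1 - eps) * (x ^+ 2 / 2) <= expR x - 1 - x <= (1 + eps) * (x ^+ 2 / 2)) ->
  0 < lam -> 0 < s -> lam * C <= eta ->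
  (PN (\bigcup_m max_event (centered (f m)) N 0 s) <=
    (N%:R * (1 + eps) * lam ^+ 2 / 2 *
      expR (N%:R * (1 + eps) * lam ^+ 2 / 2 * V) /
      (expR (lam * s) - 1 - lam * s) * D)%:E)%E.
Proof.
move=> eps0 Q lam0 s0 lC; set B := _ / (_ - _).
have g0 : 0 < expR (lam * s) - 1 - lam * s by rewrite expRB1D_gt0// mulr_gt0.
have B0 : 0 <= B.
  rewrite divr_ge0 ?(ltW g0)// mulr_ge0 ?expR_ge0// divr_ge0//.
  by rewrite !mulr_ge0// ?addr_ge0// ltW.
have mE m : measurable (max_event (centered (f m)) N 0 s).
  by apply: measurable_max_event; apply: measurable_centered; exact: mf.
apply: (@le_trans _ _ (\sum_(0 <= m <oo) PN (max_event (centered (f m)) N 0 s))%E).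
  by apply: measure_sigma_subadditive => //; exact: bigcup_measurable.
apply: lime_le; first exact: is_cvg_nneseries.
apply: nearW => K.
apply: (@le_trans _ _ (\sum_(0 <= m < K) (B * \int[P]_a (f m a ^+ 2))%:E)%E).
  by apply: lee_sum => m _; exact: single_upper_tail eps0 Q lam0 s0 lC.
by rewrite sumEFin lee_fin -mulr_sumr ler_wpM2l.
Qed.

End upper_tail.

Section upper_tail_scaled.
Variable R : realType.
Variable P : probability (measurableTypeR R) R.
Variable PN : probability (seq_space R) R.
Hypothesis PN_power : is_power PN P.

(** This is [sqrt (2 l) * sigma] with [l = j log 2] and [sigma ^ 2 = n p / 2 ^ j], the largest
    possible variance of a sum of [n] window values when the density is bounded by [p]. *)
Definition threshold (p : R) (j n : nat) : R :=
  Num.sqrt (2 * (j%:R * ln 2) * (n%:R / 2 ^+ j * p)).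

Lemma expR_ln2 j : expR (j%:R * ln 2) = 2 ^+ j :> R.
Proof. by rewrite expRM_natl lnK// posrE. Qed.

Lemma ln2_gt0 : 0 < ln 2 :> R.
Proof. by rewrite ln_gt0// ltr1n. Qed.

Lemma upper_tail_scaled (p del C D : R) : 0 < p -> 0 < del -> 0 <= C ->
  exists2 eta : R, 0 < eta & forall (f : nat -> R -> R) (j N : nat),
  (0 < N)%N -> 3 <= j%:R * ln 2 :> R ->
  (forall m, measurable_fun [set: measurableTypeR R] (f m)) ->
  (forall m a, `|f m a| <= C) ->
  (forall m, \int[P]_a (f m a ^+ 2) <= p / 2 ^+ j) ->
  (forall K, \sum_(0 <= m < K) \int[P]_a (f m a ^+ 2) <= D) ->
  j%:R * 2 ^+ j / N%:R <= eta ->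
  (PN (\bigcup_m max_event (centered P (f m)) N 0 ((1 + del) * threshold p j N)) <=
    (4 * (1 + del) ^+ 2 * (D / p) * (j%:R * ln 2) *
      expR (- (del * (j%:R * ln 2))))%:E)%E.
Proof.
move=> p0 del0 C0.
have C1 : 0 < C + 1 by rewrite ltr_wpDl.
(* Chosen so that [(1 - eps) * (1 + del) ^ 2 = 1 + del]. The exponential factor is then
   [e ^ (- (1 + del) * l)], and the factor [2 ^ j = e ^ l] leaves [e ^ (- del * l)]. *)
pose eps := del / (1 + del).
have d1 : 0 < 1 + del by rewrite addr_gt0.
have eps0 : 0 < eps by rewrite divr_gt0.
have [eta' eta0 Q] := expR_quadratic eps0.
(* The value that [lam * C <= eta'] requires, as [lam ^ 2 = 2 * (1 + del) ^ 2 * ln 2 * (j * 2 ^ j /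
   N) / p]; writing [C + 1] avoids a zero denominator. *)
exists (p * eta' ^+ 2 / (2 * ln 2 * (1 + del) ^+ 2 * (C + 1) ^+ 2)).
  by rewrite divr_gt0 ?mulr_gt0 ?exprn_gt0 ?ln2_gt0.
move=> f j N N0 j1 mf fC fV fD jN.
set l := j%:R * ln 2.
have l1 : 3 <= l by [].
have l0 : 0 < l by lra.
have l2 : 0 < 2 * l by lra.
have N0' : 0 < N%:R :> R by rewrite ltr0n.
have tj0 : 0 < 2 ^+ j :> R by rewrite exprn_gt0.
set Sg := N%:R / 2 ^+ j * p.
have S0 : 0 < Sg by rewrite mulr_gt0// divr_gt0.
(* The optimal Gaussian tilt: the level divided by the variance [Sg]. *)
pose lam := (1 + del) * Num.sqrt (2 * l / Sg).
have lS0 : 0 < 2 * l / Sg by rewrite divr_gt0.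
have lS1 : 0 < 2 * l * Sg by rewrite mulr_gt0.
have lam0 : 0 < lam by rewrite mulr_gt0// sqrtr_gt0.
have s0 : 0 < (1 + del) * threshold p j N by rewrite mulr_gt0// sqrtr_gt0.
have lam2 : lam ^+ 2 = (1 + del) ^+ 2 * (2 * l / Sg).
  by rewrite exprMn sqr_sqrtr// ltW.
have lams : lam * ((1 + del) * threshold p j N) = 2 * ((1 + del) ^+ 2 * l).
  rewrite /lam /threshold -/l -/Sg mulrACA -sqrtrM ?(ltW lS0)//.
  have -> : 2 * l / Sg * (2 * l * Sg) = (2 * l) ^+ 2 by field; rewrite gt_eqF.
  by rewrite sqrtr_sqr gtr0_norm//; ring.
have lC : lam * C <= eta'.
  rewrite -(ler_pXn2r (n := 2)) ?nnegrE ?(ltW eta0) ?(mulr_ge0 (ltW lam0) C0)//.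
  rewrite exprMn lam2.
  move: jN; rewrite ler_pdivlMr; last first.
    by rewrite !mulr_gt0 ?exprn_gt0 ?ln2_gt0.
  move=> jN; apply: (@le_trans _ _ ((1 + del) ^+ 2 * (2 * l / Sg) * (C + 1) ^+ 2)).
    rewrite ler_wpM2l//; first by rewrite -lam2 sqr_ge0.
    by rewrite lerXn2r ?nnegrE ?(ltW C1)// lerDl.
  rewrite -(ler_pM2l p0); apply: le_trans jN.
  rewrite /Sg /l le_eqVlt; apply/orP; left; apply/eqP; field.
  by rewrite !gt_eqF.
have := upper_tail PN_power mf fC fV fD N (ltW eps0) Q lam0 s0 lC.
move=> /le_trans; apply; rewrite lee_fin lams.
have D0 : 0 <= D by have := fD 0%N; rewrite big_nil.
set b := (1 + del) ^+ 2 * l.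
have lb : l <= b.
  rewrite ler_peMl ?(ltW l0)// exprn_ege1//; lra.
(* Here [3 <= l] enters: from 6 on, [1 + x] is at most half of [e ^ x]. *)
have den : expR (2 * b) / 2 <= expR (2 * b) - 1 - 2 * b.
  have hx (x : R) : 6 <= x -> expR x / 2 <= expR x - 1 - x.
    move=> x6; have -> : expR x = expR (x / 2) * expR (x / 2).
      by rewrite -expRD; congr expR; lra.
    by have := expR_ge1Dx (x / 2); nra.
  by apply: hx; lra.
have NlamV : N%:R * (1 + eps) * lam ^+ 2 / 2 * (p / 2 ^+ j) = (1 + eps) * b.
  rewrite lam2 /Sg /b; field; by rewrite !gt_eqF.
have NlamV' : N%:R * (1 + eps) * lam ^+ 2 / 2 = (1 + eps) * b * (2 ^+ j / p).
  by rewrite -NlamV; field; rewrite !gt_eqF.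
rewrite NlamV NlamV'.
have e2 := expR_gt0 (2 * b).
apply: (@le_trans _ _ ((1 + eps) * b * (2 ^+ j / p) * expR ((1 + eps) * b) /
   (expR (2 * b) / 2) * D)).
  rewrite ler_wpM2r// ler_wpM2l//.
    have b0 : 0 <= b by lra.
    have e10 : 0 <= 1 + eps by lra.
    have q0 : 0 <= 2 ^+ j / p by rewrite divr_ge0 ?(ltW p0) ?(ltW tj0).
    exact: mulr_ge0 (mulr_ge0 (mulr_ge0 e10 b0) q0) (expR_ge0 _).
  by rewrite lef_pV2 ?posrE// ?divr_gt0//; apply: lt_le_trans den; rewrite divr_gt0.
have -> : (1 + eps) * b * (2 ^+ j / p) * expR ((1 + eps) * b) /
   (expR (2 * b) / 2) * D = 2 * (1 + eps) * b * (D / p) *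
     (2 ^+ j * expR ((1 + eps) * b) / expR (2 * b)).
  by field; rewrite !gt_eqF.
have -> : 2 ^+ j * expR ((1 + eps) * b) / expR (2 * b) = expR (- (del * l)).
  rewrite -expR_ln2 -/l -expRD -expRN -expRD; congr expR.
  by rewrite /eps /b; field; rewrite gt_eqF.
rewrite ler_wpM2r ?expR_ge0// /b.
have -> : 4 * (1 + del) ^+ 2 * (D / p) * l =
  2 * 2 * ((1 + del) ^+ 2 * l) * (D / p) by ring.
rewrite ler_wpM2r ?divr_ge0 ?(ltW p0)// ler_wpM2r//.
  exact: mulr_ge0 (exprn_ge0 _ (ltW d1)) (ltW l0).
have : eps <= 1 by rewrite ler_pdivrMr//; lra.
lra.
Qed.

End upper_tail_scaled.

(** * Lower tail over disjoint windows *)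

Section lower_tail.
Variable R : realType.

(* With [x] in units of [sqrt (2 l) * sigma], the exponential weight of slope [a]
   restricted to the window [a - h, a + h]; the two subtracted terms are the
   exponential tilts that dominate the mass on either side of the window. *)
Lemma window_weight (h l a A1 A2 A3 w : R) : 0 < h -> h <= 1 / 4 ->
  4 <= h ^+ 2 * l -> a = 1 - 2 * h ->
  (a ^+ 2 - h ^+ 2 / 4) * l <= A1 -> A1 <= (a ^+ 2 + h ^+ 2 / 4) * l ->
  A2 <= ((a + h) ^+ 2 + h ^+ 2 / 4) * l ->
  A3 <= ((a - h) ^+ 2 + h ^+ 2 / 4) * l ->
  w = expR (A1 - 2 * a * (a + h) * l)
    - expR (A2 - 2 * a * (a + h) * l - 2 * h * (a + h) * l)
    - expR (A3 - 2 * a * (a + h) * l + 2 * h * (a - h) * l) ->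
  expR (- ((1 - h) * l)) / 2 <= w <= 1.
Proof.
move=> h0 h4 hl -> A1l A1u A2u A3u ->.
have h2 : 0 < h ^+ 2 by rewrite exprn_gt0.
have l0 : 0 < l by rewrite -(pmulr_rgt0 _ h2); lra.
(* A lower bound for the exponent of the main term, equal to [(- (a + h) ^ 2 + 3 * h ^ 2 / 4) * l].
   Both subtracted exponents lie at least [h ^ 2 * l / 2] below it, so each subtracted term is at
   most a quarter of [e ^ X]. *)
pose X := ((1 - 2 * h) ^+ 2 - h ^+ 2 / 4 - 2 * (1 - 2 * h) * (1 - 2 * h + h)) * l.
have e4 : expR (- (h ^+ 2 * l / 2)) <= 1 / 4 :> R.
  rewrite expRN -div1r ler_pdivrMr ?expR_gt0//.
  have -> : h ^+ 2 * l / 2 = h ^+ 2 * l / 4 + h ^+ 2 * l / 4 by lra.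
  rewrite expRD; have := expR_ge1Dx (h ^+ 2 * l / 4); nra.
have E1 : expR X <= expR (A1 - 2 * (1 - 2 * h) * (1 - 2 * h + h) * l).
  by rewrite ler_expR /X; lra.
have tail y : y <= X - h ^+ 2 * l / 2 -> expR y <= expR X / 4.
  move=> yX; apply: (@le_trans _ _ (expR (X - h ^+ 2 * l / 2))).
    by rewrite ler_expR.
  rewrite expRD; have := ler_wpM2l (expR_ge0 X) e4; lra.
have E2 := tail (A2 - 2 * (1 - 2 * h) * (1 - 2 * h + h) * l
  - 2 * h * (1 - 2 * h + h) * l).
have E3 := tail (A3 - 2 * (1 - 2 * h) * (1 - 2 * h + h) * l
  + 2 * h * (1 - 2 * h - h) * l).
have {}E2 := E2 ltac:(rewrite /X; lra).
have {}E3 := E3 ltac:(rewrite /X; lra).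
have EX : expR (- ((1 - h) * l)) <= expR X.
  rewrite ler_expR -subr_ge0.
  rewrite (_ : _ - _ = (h - h ^+ 2 / 4) * l); last by rewrite /X; field.
  by apply: mulr_ge0; [nra|exact: ltW].
apply/andP; split; first by lra.
have E4 : expR (A1 - 2 * (1 - 2 * h) * (1 - 2 * h + h) * l) <= 1.
  rewrite expR_le1.
  have : 0 <= ((1 - 2 * h) * (1 - 2 * h + 2 * h) - h ^+ 2 / 4) * l.
    by apply: mulr_ge0; [nra|exact: ltW].
  lra.
have := expR_ge0 (A2 - 2 * (1 - 2 * h) * (1 - 2 * h + h) * l
  - 2 * h * (1 - 2 * h + h) * l).
have := expR_ge0 (A3 - 2 * (1 - 2 * h) * (1 - 2 * h + h) * l
  + 2 * h * (1 - 2 * h - h) * l).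
by lra.
Qed.

Variable P : probability (measurableTypeR R) R.
Variable PN : probability (seq_space R) R.
Hypothesis PN_power : is_power PN P.

(** With [b = (a + h) s] and [t = (a - h) s], the four exponentials combine to [1 - e ^ (a u (x -
    b)) * (1 - e ^ (h u (x - b)) - e ^ (- h u (x - t)))]. The last bracket is at most 1 and is
    nonpositive outside [[t, b]], so the combination is nonnegative everywhere and at least 1 below
    [t]. Its Poissonized mean is [1 - w] with the [w] of [window_weight], and [1 - w <= e ^ (- w)]
    gives the product bound. *)
Lemma lower_tail (M n : nat) (f : 'I_M -> R -> R) (s l h : R) :
  (0 < n)%N -> 0 < h -> h <= 1 / 4 -> 4 <= h ^+ 2 * l -> 0 < s ->
  (forall m, bdd_meas (f m : measurableTypeR R -> R)) ->
  (forall a m m', m != m' -> f m a = 0 \/ f m' a = 0) ->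
  (forall m y, 0 <= y -> y <= 1 ->
     (y ^+ 2 - h ^+ 2 / 4) * l <= n%:R * log_moment P (f m) (y * (2 * l / s)) <=
     (y ^+ 2 + h ^+ 2 / 4) * l) ->
  (PN [set x : seq_space R | forall m,
        (\sum_(i < n) centered P (f m) (x i) < (1 - 3 * h) * s)%R] <=
   (expR 1 * n%:R * expR (- (M%:R / 2 * expR (- ((1 - h) * l)))))%:E)%E.
Proof.
move=> n0 h0 h4 hl s0 bf df Ab.
have h2 : 0 < h ^+ 2 by rewrite exprn_gt0.
have l0 : 0 < l by rewrite -(pmulr_rgt0 _ h2); lra.
pose a : R := 1 - 2 * h.
set u := 2 * l / s in Ab.
have u0 : 0 < u by rewrite divr_gt0// mulr_gt0.
have us : u * s = 2 * l by rewrite /u divfK ?gt_eqF.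
clearbody u.
pose b := (a + h) * s. pose t := (1 - 3 * h) * s.
pose lam_ := [:: 0; a * u; (a + h) * u; (a - h) * u].
pose K_ := [:: 1; - expR (- (a * u * b)); expR (- (a * u * b) - h * u * b);
   expR (- (a * u * b) + h * u * t)].
pose K (r : 'I_4) : R := nth 0 K_ r.
pose lam (r : 'I_4) : R := nth 0 lam_ r.
have GE x : \sum_(r < 4) K r * expR (lam r * x) =
    1 - expR (a * u * (x - b)) *
      (1 - expR (h * u * (x - b)) - expR (- (h * u * (x - t)))).
  rewrite !big_ord_recl big_ord0 /K /lam /=.
  have e1 : expR (- (a * u * b)) * expR (a * u * x) = expR (a * u * (x - b)).
    by rewrite -expRD; congr expR; ring.
  have e2 : expR (- (a * u * b) - h * u * b) * expR ((a + h) * u * x) =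
      expR (a * u * (x - b)) * expR (h * u * (x - b)).
    by rewrite -!expRD; congr expR; ring.
  have e3 : expR (- (a * u * b) + h * u * t) * expR ((a - h) * u * x) =
      expR (a * u * (x - b)) * expR (- (h * u * (x - t))).
    by rewrite -!expRD; congr expR; ring.
  by rewrite mul0r expR0 mulNr e1 e2 e3; ring.
have a0 : 0 < a by rewrite /a; lra.
have au : 0 < a * u by rewrite mulr_gt0.
have hu : 0 < h * u by rewrite mulr_gt0.
have G0 x : 0 <= \sum_(r < 4) K r * expR (lam r * x).
  rewrite GE subr_ge0.
  have e1 := expR_ge0 (h * u * (x - b)).
  have e2 := expR_ge0 (- (h * u * (x - t))).
  have e3 := expR_ge0 (a * u * (x - b)).
  have [xb|bx] := leP x b.
    have : expR (a * u * (x - b)) <= 1.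
      by rewrite expR_le1 pmulr_rle0// subr_le0.
    nra.
  have : 1 <= expR (h * u * (x - b)).
    by rewrite -expR0 ler_expR mulr_ge0 ?subr_ge0 ?(ltW bx) ?(ltW hu).
  nra.
have G1 x : x < t -> 1 <= \sum_(r < 4) K r * expR (lam r * x).
  move=> xt; rewrite GE.
  have e1 := expR_ge0 (h * u * (x - b)).
  have e3 := expR_ge0 (a * u * (x - b)).
  have : 1 <= expR (- (h * u * (x - t))).
    by rewrite -expR0 ler_expR oppr_ge0 pmulr_rle0// subr_le0 ltW.
  nra.
(* The initial offsets center the sums; they also turn each Poissonized exponent into [n] times a
   [log_moment]. *)
have := poisson_below PN_power bf df G0 G1 (fun m => - (n%:R * \int[P]_a f m a)) n0.
rewrite (_ : below_event _ _ _ _ = [set x : seq_space R | forall m,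
    \sum_(i < n) centered P (f m) (x i) < t]); last first.
  have E m (x : seq_space R) : - (n%:R * \int[P]_a f m a) + \sum_(i < n) f m (x i)
      = \sum_(i < n) centered P (f m) (x i).
    by rewrite sumrB sumr_const card_ord mulr_natl addrC.
  by apply/seteqP; split => x /= H m; have := H m; rewrite E.
move=> /le_trans; apply; rewrite lee_fin ler_wpM2l ?mulr_ge0 ?expR_ge0//.
have -> : expR (- (M%:R / 2 * expR (- ((1 - h) * l)))) =
   \prod_(m < M) expR (- (expR (- ((1 - h) * l)) / 2)).
  rewrite prodr_const card_ord -expRM_natl; congr expR; lra.
apply: ler_prod => m _.
have -> : \sum_(r < 4) K r * expR (lam r * - (n%:R * \int[P]_a0 f m a0) +
      n%:R * \int[P]_a0 (expR (lam r * f m a0) - 1)) =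
   \sum_(r < 4) K r * expR (n%:R * log_moment P (f m) (lam r)).
  apply: eq_bigr => r _; congr (_ * expR _).
  have [mf [C fC]] := bf m.
  by rewrite (log_momentE P mf fC); ring.
rewrite !big_ord_recl big_ord0 /K /lam /=.
have -> : log_moment P (f m) 0 = 0.
  rewrite /log_moment (_ : (fun _ => _) = fun=> 0) ?(expect_cst P)//.
  by apply/funext => y; rewrite !mul0r expR0 subrr subr0.
rewrite mulr0 expR0 mulr1 addr0.
set A1 := n%:R * log_moment P (f m) (a * u).
set A2 := n%:R * log_moment P (f m) ((a + h) * u).
set A3 := n%:R * log_moment P (f m) ((a - h) * u).
have /andP[A1l A1u] := Ab m a ltac:(lra) ltac:(rewrite /a; lra).
have /andP[_ A2u] := Ab m (a + h) ltac:(lra) ltac:(rewrite /a; lra).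
have /andP[_ A3u] := Ab m (a - h) ltac:(rewrite /a; lra) ltac:(rewrite /a; lra).
have [w wE] : exists w, w = expR (A1 - 2 * a * (a + h) * l)
    - expR (A2 - 2 * a * (a + h) * l - 2 * h * (a + h) * l)
    - expR (A3 - 2 * a * (a + h) * l + 2 * h * (a - h) * l) by eexists.
have /andP[w0 w1] := window_weight h0 h4 hl (erefl a) A1l A1u A2u A3u wE.
rewrite [X in _ <= X <= _](_ : _ = 1 - w); last first.
  have ub : u * b = 2 * (a + h) * l.
    by rewrite /b mulrCA us; ring.
  have ut : u * t = 2 * (a - h) * l.
    by rewrite /t mulrCA us /a; ring.
  have -> : - expR (- (a * u * b)) * expR A1 = - expR (A1 - 2 * a * (a + h) * l).
    by rewrite mulNr -expRD -mulrA ub; congr (- expR _); ring.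
  have -> : expR (- (a * u * b) - h * u * b) * expR A2 =
      expR (A2 - 2 * a * (a + h) * l - 2 * h * (a + h) * l).
    by rewrite -expRD -!mulrA ub; congr expR; ring.
  have -> : expR (- (a * u * b) + h * u * t) * expR A3 =
      expR (A3 - 2 * a * (a + h) * l + 2 * h * (a - h) * l).
    by rewrite -expRD -!mulrA ub ut; congr expR; ring.
  by rewrite wE; ring.
rewrite subr_ge0 w1 /=.
apply: le_trans (expR_ge1Dx _).
by rewrite lerD2l lerN2.
Qed.
End lower_tail.

Section lower_tail_scaled.
Variable R : realType.
Variable P : probability (measurableTypeR R) R.
Variable PN : probability (seq_space R) R.
Hypothesis PN_power : is_power PN P.

(** The tolerance [h ^ 2 / 4] in [lower_tail] is shared by two errors of relative size [h ^ 2 / 8]: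
    the variance against [p / 2 ^ j], and the exponential moment against its quadratic part. *)
Lemma lower_tail_scaled (p h C : R) : 0 < p -> 0 < h -> h <= 1 / 4 -> 0 <= C ->
  exists2 eta : R, 0 < eta & forall (M n j : nat) (f : 'I_M -> R -> R),
  (0 < n)%N -> 4 <= h ^+ 2 * (j%:R * ln 2) ->
  (forall m, measurable_fun [set: measurableTypeR R] (f m)) ->
  (forall m a, `|f m a| <= C) ->
  (forall a m m', m != m' -> f m a = 0 \/ f m' a = 0) ->
  (forall m, (1 - h ^+ 2 / 8) * (p / 2 ^+ j) <= \int[P]_a (f m a ^+ 2)) ->
  (forall m, \int[P]_a (f m a ^+ 2) <= p / 2 ^+ j) ->
  j%:R * 2 ^+ j / n%:R <= eta ->
  (PN [set x : seq_space R | forall m,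
      (\sum_(i < n) centered P (f m) (x i) < (1 - 3 * h) * threshold p j n)%R] <=
   (expR 1 * n%:R * expR (- (M%:R / 2 * expR (- ((1 - h) * (j%:R * ln 2))))))%:E)%E.
Proof.
move=> p0 h0 h4 C0.
have C1 : 0 < C + 1 by rewrite ltr_wpDl.
have h2 : 0 < h ^+ 2 by rewrite exprn_gt0.
have eps0 : 0 < h ^+ 2 / 8 by rewrite divr_gt0.
have [eta' eta0 Q] := expR_quadratic eps0.
exists (p * eta' ^+ 2 / (2 * ln 2 * (C + 1) ^+ 2)).
  by rewrite divr_gt0 ?mulr_gt0 ?exprn_gt0 ?ln2_gt0.
move=> M n j f n0 jl mf fC df vl vu jn.
have l0 : 0 < j%:R * ln 2 :> R by rewrite -(pmulr_rgt0 _ h2); lra.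
have N0' : 0 < n%:R :> R by rewrite ltr0n.
have tj0 : 0 < 2 ^+ j :> R by rewrite exprn_gt0.
have jE : j%:R = (j%:R * ln 2) / ln 2 :> R by rewrite mulfK// gt_eqF ?ln2_gt0.
have ln20 := ln2_gt0 R.
have lS0 : 0 < 2 * (j%:R * ln 2) * (n%:R / 2 ^+ j * p) :> R.
  by apply: mulr_gt0; [lra|rewrite mulr_gt0// divr_gt0].
have s0 : 0 < threshold p j n by rewrite sqrtr_gt0.
have s2 : threshold p j n ^+ 2 = 2 * (j%:R * ln 2) * (n%:R / 2 ^+ j * p).
  by rewrite sqr_sqrtr// ltW.
move: jn jl s2 l0; rewrite /threshold {1}jE.
move: s0; rewrite -/(threshold p j n); set s := threshold p j n.
set l := j%:R * ln 2; clearbody l s => s0 jn jl s2 l0.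
have u2 : (2 * l / s) ^+ 2 = 2 * l / (n%:R / 2 ^+ j * p).
  rewrite expr_div_n s2; field.
  by rewrite !gt_eqF.
have uC y : 0 <= y -> y <= 1 -> `|y * (2 * l / s)| * C <= eta'.
  move=> y0 y1.
  have us0 : 0 <= 2 * l / s by rewrite divr_ge0// ltW// mulr_gt0.
  rewrite ger0_norm; last exact: mulr_ge0.
  apply: (@le_trans _ _ (2 * l / s * (C + 1))).
    apply: ler_pM => //; [exact: mulr_ge0|exact: ler_piMl|lra].
  rewrite -(ler_pXn2r (n := 2)) ?nnegrE ?(ltW eta0) ?(mulr_ge0 us0 (ltW C1))//.
  rewrite exprMn u2.
  move: jn; rewrite ler_pdivlMr; last first.
    by rewrite !mulr_gt0 ?exprn_gt0.
  move=> jn; rewrite -(ler_pM2l p0); apply: le_trans jn.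
  rewrite le_eqVlt; apply/orP; left; apply/eqP; field.
  by rewrite !gt_eqF.
apply: (lower_tail PN_power n0 h0 h4 jl s0) => //.
  by move=> m; exact: bounded_bdd_meas (mf m) (fC m).
move=> m y y0 y1.
have /andP[ll lu] := log_moment_bounds P (mf m) (fC m) Q (uC y y0 y1).
have y2 : 0 <= y ^+ 2 by rewrite sqr_ge0.
have y21 : y ^+ 2 <= 1 by rewrite exprn_ile1.
set v := \int[P]_a _ in ll lu *.
have vE : n%:R * ((y * (2 * l / s)) ^+ 2 / 2 * v) = y ^+ 2 * l * (v * 2 ^+ j / p).
  by rewrite exprMn u2; field; rewrite !gt_eqF.
have v1 : v * 2 ^+ j / p <= 1.
  rewrite ler_pdivrMr// mul1r -ler_pdivlMr//; exact: vu.
have v2 : 1 - h ^+ 2 / 8 <= v * 2 ^+ j / p.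
  by rewrite ler_pdivlMr// -ler_pdivrMr// -mulrA; exact: vl.
set r := v * 2 ^+ j / p in vE v1 v2; clearbody r.
have h21 : h ^+ 2 <= 1 by rewrite exprn_ile1 ?(ltW h0)//; lra.
have yl : 0 <= y ^+ 2 * l by rewrite mulr_ge0 ?(ltW l0).
have yl1 : y ^+ 2 * l <= l by rewrite ler_piMl ?(ltW l0).
apply/andP; split.
  apply: le_trans (ler_wpM2l (ltW N0') ll).
  have -> : n%:R * ((1 - h ^+ 2 / 8) * ((y * (2 * l / s)) ^+ 2 / 2) * v) =
    (1 - h ^+ 2 / 8) * (n%:R * ((y * (2 * l / s)) ^+ 2 / 2 * v)) by ring.
  rewrite vE.
  have : (1 - h ^+ 2 / 8) * (y ^+ 2 * l) <= y ^+ 2 * l * r.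
    by rewrite mulrC ler_wpM2l.
  have e : 0 <= 1 - h ^+ 2 / 8 by lra.
  move=> /(ler_wpM2l e) H.
  have q2 : 0 <= (h ^+ 2 / 8) ^+ 2 * (y ^+ 2 * l) by rewrite mulr_ge0// sqr_ge0.
  have := ler_wpM2l (ltW eps0) yl1; lra.
apply: le_trans (ler_wpM2l (ltW N0') lu) _.
have -> : n%:R * ((1 + h ^+ 2 / 8) * ((y * (2 * l / s)) ^+ 2 / 2) * v) =
  (1 + h ^+ 2 / 8) * (n%:R * ((y * (2 * l / s)) ^+ 2 / 2 * v)) by ring.
rewrite vE.
have : y ^+ 2 * l * r <= y ^+ 2 * l by rewrite ler_piMr.
have e : 0 <= 1 + h ^+ 2 / 8 by lra.
move=> /(ler_wpM2l e) H.
have := ler_wpM2l (ltW eps0) yl1; lra.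
Qed.

End lower_tail_scaled.

(** * Densities and sums over the integers *)

Section lebesgue_density.
Variable R : realType.
Local Notation mu := (@lebesgue_measure R).
Local Open Scope ereal_scope.

Lemma measurable_affine (a b : R) :
  measurable_fun [set: measurableTypeR R] (fun x : R => (a * x + b)%R).
Proof. by apply: measurable_funD => //; exact: measurable_funM. Qed.

(** Lebesgue measure is [a] times its own image under the affine map: both measures agree on
    half-open intervals. *)
Lemma ge0_integral_affine (a b : R) (g : R -> \bar R) : (0 < a)%R ->
  measurable_fun [set: measurableTypeR R] g -> (forall x, 0 <= g x) ->
  \int[mu]_x g (a * x + b)%R = (a^-1)%:E * \int[mu]_x g x.
Proof.
move=> a0 mg g0.
pose T : measurableTypeR R -> measurableTypeR R := fun x => (a * x + b)%R.
have mT : measurable_fun setT T by exact: measurable_affine.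
pose pf : {measure set (measurableTypeR R) -> \bar R} :=
  measure_function_pushforward__canonical__measure_function_Measure mu mT.
pose m : {measure set (measurableTypeR R) -> \bar R} :=
  mscale (NngNum (ltW a0)) pf.
have mE A : measurable A -> mu A = m A.
  apply: lebesgue_measure_unique => //= _ [[c d] _ <-].
  rewrite /m/= /mscale/= /pf/= /pushforward.
  rewrite (_ : T @^-1` _ = `](c - b) / a, (d - b) / a]%classic)%R; last first.
    apply/seteqP; split => x /=; rewrite !in_itv/= ltr_pdivrMr// ler_pdivlMr//;
      by rewrite ltrBlDr lerBrDr [(x * a)%R]mulrC.
  rewrite !lebesgue_measure_itv/= !lte_fin ltr_pM2r ?invr_gt0// ltrD2r.
  case: ifP => _; last by rewrite mule0.
  rewrite -!EFinB -EFinM; congr (_%:E); field; by rewrite gt_eqF.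
have -> : \int[mu]_x g x = \int[m]_x g x.
  by apply: eq_measure_integral => A mA _; exact: mE.
rewrite ge0_integral_mscale//=.
rewrite muleA -EFinM mulVf ?gt_eqF// mul1e.
by rewrite ge0_integral_pushforward//= => [|y _]; rewrite ?preimage_setT.
Qed.

Variables (P : probability (measurableTypeR R) R) (p0 : R -> R).
Hypothesis p0_density : is_density p0 P.

Lemma density_integral_le (p : R) (g : R -> \bar R) : (0 <= p)%R ->
  (forall x, p0 x <= p)%R ->
  measurable_fun [set: measurableTypeR R] g -> (forall x, 0 <= g x) ->
  \int[P]_x g x <= p%:E * \int[mu]_x g x.
Proof.
move=> pge0 p0p mg g0.
have [mp0 p00 PE] := p0_density.
rewrite -(@ge0_integral_mscale _ _ _ mu setT measurableT (NngNum pge0))//.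
apply: ge0_le_measure_integral => // S mS.
rewrite [leLHS](PE S mS) /= /mscale/= -(integral_cst mu mS).
apply: ge0_le_integral => //=.
- by move=> x _; rewrite lee_fin.
- by apply/measurable_EFinP; exact: measurable_funTS.
- by move=> x _; rewrite lee_fin.
Qed.

Lemma density_integral_ge (c : R) (D : set R) (g : R -> \bar R) : (0 <= c)%R ->
  measurable (D : set (measurableTypeR R)) ->
  (forall x, D x -> c <= p0 x)%R ->
  measurable_fun [set: measurableTypeR R] g -> (forall x, 0 <= g x) ->
  (forall x, ~ D x -> g x = 0) ->
  c%:E * \int[mu]_x g x <= \int[P]_x g x.
Proof.
move=> c0 mD p0c mg g0 gD.
have [mp0 p00 PE] := p0_density.
have gE (m : {measure set (measurableTypeR R) -> \bar R}) :
    \int[m]_x g x = \int[m]_(x in D) g x.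
  rewrite [RHS]integral_mkcond; apply: eq_integral => x _.
  rewrite patchE; case: ifPn => // /negP xD.
  by apply: gD => Dx; apply: xD; exact: mem_set.
pose mD' : {measure set (measurableTypeR R) -> \bar R} := mrestr mu mD.
have -> : \int[mu]_x g x = \int[mD']_x g x.
  rewrite !gE; apply: eq_measure_integral => A mA AD.
  by rewrite /mD'/= /mrestr setIidl.
rewrite -(@ge0_integral_mscale _ _ _ mD' setT measurableT (NngNum c0))//.
apply: ge0_le_measure_integral => // S mS.
rewrite [leRHS](PE S mS) /= /mscale/= /mrestr -(integral_cst mu (measurableI _ _ mS mD)).
apply: (@le_trans _ _ (\int[mu]_(x in S `&` D) (p0 x)%:E)).
  apply: ge0_le_integral => //=.
  - exact: measurableI.
  - by apply/measurable_EFinP; exact: measurable_funTS.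
  - by move=> x [_ Dx]; rewrite lee_fin p0c.
apply: ge0_subset_integral => //=.
- exact: measurableI.
- by apply/measurable_EFinP; exact: measurable_funTS.
- by move=> x _; rewrite lee_fin.
Qed.

End lebesgue_density.

Section finite_sums_over_int.
Variable R : realType.

Lemma sum_seq_window (f : int -> R) (K : int) (L : nat) (s : seq int) :
  uniq s -> {subset [seq K + (nat_of_ord i)%:Z | i <- enum 'I_L] <= s} ->
  (forall k, f k != 0 -> exists2 i : 'I_L, True & k = K + i%:Z) ->
  \sum_(k <- s) f k = \sum_(i < L) f (K + i%:Z).
Proof.
move=> us sW fK; set W := [seq _ | _ <- _] in sW.
have uW : uniq W.
  by rewrite map_inj_uniq ?enum_uniq// => i i' /addrI [] /ord_inj.
rewrite (bigID (mem W))/= [X in _ + X]big1 ?addr0; last first.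
  move=> k kW; apply/eqP; apply: contraNT kW => /fK[i _ ->].
  by apply/mapP; exists i => //; rewrite mem_enum.
rewrite -big_filter (perm_big W) ?big_map ?big_enum//=.
apply: uniq_perm => //; first exact: filter_uniq.
by move=> k; rewrite mem_filter; apply: andb_idr => /sW.
Qed.

Lemma partial_sum_window (f : int -> R) (K : int) (L : nat) (A : {fset int}) :
  (forall k, f k != 0 -> exists2 i : 'I_L, True & k = K + i%:Z) ->
  ([fset (K + (nat_of_ord i)%:Z)%R | i in 'I_L] `<=` A)%fset ->
  partial_sum f A = \sum_(i < L) f (K + i%:Z).
Proof.
move=> fK WA; rewrite /partial_sum -(big_seq_fsetE _ _ xpredT f) /=.
rewrite -(big_fset_incl _ WA) //=.
  rewrite big_imfset /=; first by rewrite big_enum.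
  by move=> i i' _ _ /addrI [] /ord_inj.
move=> k _ kW; apply/eqP; apply: contraNT kW => /fK [i _ ->].
by apply/imfsetP; exists i.
Qed.

(** Every finite set containing the window has the same partial sum, so the limit along finite sets
    is reached. *)
Lemma zsum_window (f : int -> R) (K : int) (L : nat) :
  (forall k, f k != 0 -> exists2 i : 'I_L, True & k = K + i%:Z) ->
  zsum f = \sum_(i < L) f (K + i%:Z).
Proof.
move=> fK; rewrite /zsum /summability.sum; apply: lim_near_cst => //.
  exact: totally_filter.
exists [fset (K + (nat_of_ord i)%:Z)%R | i in 'I_L]%fset => // A /=.
exact: partial_sum_window.
Qed.

(** The cells []m, m + 1]] are open on the left, like the support []B1, B2]]. Within one cell no
    translate of [phi] crosses an end point of its support, where it may jump; hence [ceil - 1]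
    instead of the floor. *)
Lemma unit_part (y : R) : exists m : int, 0 < y - m%:~R <= 1.
Proof.
exists (Num.ceil y - 1); have := ceil_itv y.
rewrite intrB; lra.
Qed.

(** The cells []c + k, c + k + 1]] are disjoint, so at most one index contributes. The integers are
    enumerated through [pickle_inv] because the union bounds run over naturals. *)
Lemma sum_unit_intervals (c t : R) (K : nat) :
  \sum_(0 <= m < K) (if @pickle_inv int m is Some k then
     (c < t - k%:~R <= c + 1)%R%:R else 0) <= 1 :> R.
Proof.
rewrite big_mkord.
set F := (X in \sum_(i < K) X i).
have [m Fm|F0] := pickP (fun m : 'I_K => F m != 0); last first.
  by rewrite big1// => m _; apply/eqP; have := F0 m; case: eqP.
rewrite (bigD1 m)//= big1 ?addr0.
  by rewrite /F; case: pickle_inv => [k|//]; case: (_ && _).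
move=> m' mm'; apply: contra_neq_eq mm' => Fm'.
apply: val_inj => /=; move: Fm Fm'; rewrite /F.
case E: (@pickle_inv int m) => [k|]; last by rewrite eqxx.
case E': (@pickle_inv int m') => [k'|]; last by rewrite eqxx.
rewrite !pnatr_eq0 !eqb0 !negbK => /andP[a1 a2] /andP[b1 b2].
have kk' : k = k'.
  have h1 : (k%:~R : R) < k'%:~R + 1 by lra.
  have h2 : (k'%:~R : R) < k%:~R + 1 by lra.
  apply/eqP; rewrite eq_le; move: h1 h2.
  by rewrite -!(intrD _ _ 1) !ltr_int !ltzD1 => -> ->.
have := @pickle_invK int m; have := @pickle_invK int m'.
by rewrite E E' /= kk' => -> ->.
Qed.

End finite_sums_over_int.

Section uniform_continuity.
Variable R : realType.

Lemma unif_continuous_itv (f : R -> R) (a b : R) :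
  unif_continuous (f : subspace [set` `]a, b] : interval R] -> R) ->
  forall e, 0 < e -> exists2 d : R, 0 < d & forall x y,
    a < x <= b -> a < y <= b -> `|x - y| < d -> `|f x - f y| < e.
Proof.
move=> uf e e0.
have /unif_continuousP/(_ e e0)[d d0 ud] := uf.
exists d => // x y xab yab xy.
have := ud (x, y); rewrite /= ball_subspace_ball /subspace_ball.
have xin : x \in [set` `]a, b]] by apply: mem_set; rewrite /= in_itv.
rewrite xin; apply; split; first by rewrite /= in_itv.
exact: xy.
Qed.

Lemma unif_continuousR (f : R -> R) : unif_continuous f ->
  forall e, 0 < e -> exists2 d : R, 0 < d & forall x y,
    `|x - y| < d -> `|f x - f y| < e.
Proof.
move=> /unif_continuousP uf e e0.
have [d d0 ud] := uf e e0; exists d => // x y xy.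
exact: (ud (x, y)).
Qed.

(** Any point of the interval is joined to [b] by the same number [K] of steps shorter than [d], and
    [f] changes by less than 1 in each. *)
Lemma unif_continuous_itv_bounded (f : R -> R) (a b : R) :
  unif_continuous (f : subspace [set` `]a, b] : interval R] -> R) ->
  exists C, forall x, a < x <= b -> `|f x| <= C.
Proof.
move=> /unif_continuous_itv uf.
have [d d0 ud] := uf 1 ltr01.
pose K := (Num.truncn ((b - a) / d)).+1.
have K0 : (0 : R) < K%:R by rewrite ltr0n.
have Kd : (b - a) / K%:R < d.
  by rewrite ltr_pdivrMr// mulrC -ltr_pdivrMr// truncnS_gt.
exists (`|f b| + K%:R) => x /andP[ax xb].
pose x_ i := x + (b - x) / K%:R * i%:R.
have step i : (i <= K)%N -> `|f x - f (x_ i)| <= i%:R.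
  elim: i => [|i IH] iK.
    by rewrite /x_ mulr0 addr0 subrr normr0.
  have -> : f x - f (x_ i.+1) = (f x - f (x_ i)) + (f (x_ i) - f (x_ i.+1)) by ring.
  rewrite (le_trans (ler_normD _ _))// -natr1 lerD ?IH ?(ltnW iK)//.
  have bx : 0 <= (b - x) / K%:R by rewrite divr_ge0 ?subr_ge0// ltW.
  have xi k : (k <= K)%N -> a < x_ k <= b.
    move=> kK; apply/andP; split.
      by rewrite (lt_le_trans ax)// lerDl mulr_ge0.
    rewrite -lerBrDl mulrAC ler_pdivrMr// ler_wpM2l ?subr_ge0// ler_nat//.
  apply/ltW/ud; [exact/xi/ltnW|exact: xi|].
  rewrite distrC /x_ -natr1.
  have -> : x + (b - x) / K%:R * (i%:R + 1) - (x + (b - x) / K%:R * i%:R) =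
    (b - x) / K%:R by ring.
  rewrite ger0_norm//; apply: le_lt_trans Kd.
  by rewrite ler_wpM2r ?invr_ge0 ?(ltW K0)//; lra.
have := step K (leqnn _).
have -> : x_ K = b by rewrite /x_ divfK ?gt_eqF//; ring.
by have := ler_normD (f b) (f x - f b); rewrite subrKC; lra.
Qed.

End uniform_continuity.

(** * Translates of a compactly supported orthonormal function *)

Section compactly_supported.
Variable R : realType.
Local Notation mu := (@lebesgue_measure R).
Implicit Types f g : R -> R.

(** The counterpart of [bdd_meas] for Lebesgue measure, where boundedness alone does not give
    integrability. *)
Definition cpt_meas f := measurable_fun [set: measurableTypeR R] f /\
  exists C a : R, (forall x, `|f x| <= C) /\ (forall x, a < `|x| -> f x = 0).

Lemma cpt_meas_integrable f : cpt_meas f ->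
  mu.-integrable [set: measurableTypeR R] (EFin \o f).
Proof.
move=> [mf [C [a [fC fa]]]].
have mI : measurable (`[- a, a]%classic : set (measurableTypeR R)).
  exact: measurable_itv.
have fE : EFin \o f = (EFin \o f) \_ `[- a, a]%classic.
  apply/funext => x; rewrite patchE; case: ifPn => //.
  rewrite notin_setE /= in_itv/= -ler_norml => /negP.
  by rewrite -ltNge => /fa ->.
rewrite fE -integrable_mkcond//.
apply: measurable_bounded_integrable => //.
- rewrite /= lebesgue_measure_itv/=; case: ifP => _; last exact: ltry.
  by rewrite -EFinB ltry.
- exact: measurable_funTS.
- exists C; split; first exact: num_real.
  by move=> x Cx y _; apply: le_trans (fC y) (ltW Cx).
Qed.

Lemma cpt_measD f g : cpt_meas f -> cpt_meas g -> cpt_meas (fun x => f x + g x).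
Proof.
move=> [mf [C [a [fC fa]]]] [mg [D [b [gD gb]]]]; split.
  exact: measurable_funD.
exists (C + D), (Num.max a b); split => x.
  by rewrite (le_trans (ler_normD _ _))// lerD.
by rewrite gt_max => /andP[/fa -> /gb ->]; rewrite addr0.
Qed.

Lemma cpt_measM f g : cpt_meas f -> cpt_meas g -> cpt_meas (fun x => f x * g x).
Proof.
move=> [mf [C [a [fC fa]]]] [mg [D [b [gD gb]]]]; split.
  exact: measurable_funM.
exists (C * D), a; split => x.
  by rewrite normrM ler_pM.
by move=> /fa ->; rewrite mul0r.
Qed.

Lemma cpt_measZ (c : R) f : cpt_meas f -> cpt_meas (fun x => c * f x).
Proof.
move=> [mf [C [a [fC fa]]]]; split; first exact: measurable_funM.
exists (`|c| * C), a; split => x; first by rewrite normrM ler_wpM2l.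
by move=> /fa ->; rewrite mulr0.
Qed.

Lemma cpt_meas_norm f : cpt_meas f -> cpt_meas (fun x => `|f x|).
Proof.
move=> [mf [C [a [fC fa]]]]; split; first exact: measurableT_comp.
exists C, a; split => x; first by rewrite normr_id.
by move=> /fa ->; rewrite normr0.
Qed.

Lemma cpt_meas_shift (b : R) f : cpt_meas f -> cpt_meas (fun x => f (x - b)).
Proof.
move=> [mf [C [a [fC fa]]]]; split.
  by apply: (measurableT_comp mf); exact: measurable_funB.
exists C, (a + `|b|); split => // x xb; apply: fa.
by rewrite -ltrBrDr in xb; apply: lt_le_trans xb (lerB_dist _ _).
Qed.

Lemma cpt_meas0 : cpt_meas (fun=> 0).
Proof. by split=> //; exists 0, 0; split => // x; rewrite normr0. Qed.

Lemma cpt_meas_sum (I : Type) (s : seq I) (F : I -> R -> R) :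
  (forall i, cpt_meas (F i)) -> cpt_meas (fun x => \sum_(i <- s) F i x).
Proof.
move=> bF; elim: s => [|i s IH].
  rewrite (_ : (fun x => _) = fun=> 0); first exact: cpt_meas0.
  by apply/funext => x; rewrite big_nil.
rewrite (_ : (fun x => _) = fun x => F i x + \sum_(i <- s) F i x).
  exact: cpt_measD.
by apply/funext => x; rewrite big_cons.
Qed.

Lemma cpt_integralD f g : cpt_meas f -> cpt_meas g ->
  \int[mu]_x (f x + g x) = \int[mu]_x f x + \int[mu]_x g x.
Proof. by move=> bf bg; rewrite RintegralD//; exact: cpt_meas_integrable. Qed.

Lemma cpt_integralZ (c : R) f : cpt_meas f ->
  \int[mu]_x (c * f x) = c * \int[mu]_x f x.
Proof. by move=> bf; rewrite RintegralZl//; exact: cpt_meas_integrable. Qed.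

Lemma cpt_integral_sum (I : Type) (s : seq I) (F : I -> R -> R) :
  (forall i, cpt_meas (F i)) ->
  \int[mu]_x (\sum_(i <- s) F i x) = \sum_(i <- s) \int[mu]_x F i x.
Proof.
move=> bF; elim: s => [|i s IH].
  rewrite big_nil; under eq_Rintegral do rewrite big_nil.
  by rewrite Rintegral_cst// mul0r.
rewrite big_cons; under eq_Rintegral do rewrite big_cons.
by rewrite cpt_integralD ?IH//; exact: cpt_meas_sum.
Qed.

Lemma EFin_cpt_integral f : cpt_meas f ->
  ((\int[mu]_x f x)%:E = \int[mu]_x (f x)%:E)%E.
Proof.
move=> /cpt_meas_integrable bf; rewrite /Rintegral fineK//.
exact: integrable_fin_num.
Qed.

Lemma cpt_integral_shift_ge0 (b : R) f : cpt_meas f -> (forall x, 0 <= f x) ->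
  \int[mu]_x f (x - b) = \int[mu]_x f x.
Proof.
move=> bf f0; rewrite /Rintegral; congr fine.
under eq_integral do rewrite -[X in f (X - b)]mul1r.
rewrite (@ge0_integral_affine R 1 (- b) (EFin \o f))//.
- by rewrite invr1 mul1e.
- by apply/measurable_EFinP; exact: bf.1.
Qed.

(** The nonnegative case is applied to [f + |f|] and to [|f|], and the second identity is cancelled
    from the first. *)
Lemma cpt_integral_shift (b : R) f : cpt_meas f ->
  \int[mu]_x f (x - b) = \int[mu]_x f x.
Proof.
move=> bf; have nf := cpt_meas_norm bf.
have pf := cpt_measD bf nf.
have f0 x : 0 <= f x + `|f x| by have := ler_norm (- f x); rewrite normrN; lra.
have := cpt_integral_shift_ge0 b pf f0.
rewrite (cpt_integralD (cpt_meas_shift b bf) (cpt_meas_shift b nf)).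
rewrite (cpt_integral_shift_ge0 b nf) => [|x]; last exact: normr_ge0.
by rewrite cpt_integralD// => /addIr.
Qed.

End compactly_supported.

Section wavelet_window.
Variable R : realType.
Local Notation mu := (@lebesgue_measure R).
Variables (phi : R -> R) (B : int) (L : nat) (C : R).
Hypothesis mphi : measurable_fun [set: measurableTypeR R] phi.
Hypothesis phiC : forall x, `|phi x| <= C.
Hypothesis phi_supp : forall x, phi x != 0 -> B%:~R < x <= B%:~R + L%:R.
Hypothesis phi_orth : forall k l : int,
  \int[mu]_x (phi (x - k%:~R) * phi (x - l%:~R)) = (k == l)%:R.

Definition window_sum (u : 'I_L -> R) (t : R) := \sum_(i < L) u i * phi (t - i%:R).

Lemma cpt_meas_phi : cpt_meas phi.
Proof.
split=> //; exists C, (`|B%:~R| + L%:R); split => // x xa.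
apply/eqP; apply: contraTT xa => /phi_supp/andP[h1 h2].
have := ler_norm (B%:~R : R); have := ler_norm (- B%:~R : R); rewrite normrN => n1 n2.
by rewrite -leNgt ler_norml; apply/andP; split; have := ler0n R L; lra.
Qed.

Lemma cpt_meas_window_sum u : cpt_meas (window_sum u).
Proof.
apply: cpt_meas_sum => i; apply: cpt_measZ.
exact: cpt_meas_shift cpt_meas_phi.
Qed.

Lemma window_sum_norm2 u :
  (\int[mu]_t ((window_sum u t) ^+ 2)%:E = (\sum_i u i ^+ 2)%:E)%E.
Proof.
have cs (i : 'I_L) : cpt_meas (fun t => phi (t - i%:R)).
  exact: cpt_meas_shift cpt_meas_phi.
rewrite -EFin_cpt_integral; last first.
  exact: cpt_measM (cpt_meas_window_sum u) (cpt_meas_window_sum u).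
congr (_%:E).
have E t : window_sum u t ^+ 2 = \sum_(i < L) \sum_(i' < L)
    (u i * u i') * (phi (t - i%:R) * phi (t - i'%:R)).
  rewrite expr2 /window_sum mulr_suml; apply: eq_bigr => i _.
  by rewrite mulr_sumr; apply: eq_bigr => i' _; ring.
under eq_Rintegral do rewrite E.
rewrite cpt_integral_sum; last first.
  by move=> i; apply: cpt_meas_sum => i'; apply: cpt_measZ; exact: cpt_measM.
apply: eq_bigr => i _; rewrite cpt_integral_sum; last first.
  by move=> i'; apply: cpt_measZ; exact: cpt_measM.
rewrite (bigD1 i)//= big1 ?addr0.
  rewrite cpt_integralZ; last exact: cpt_measM.
  by rewrite (phi_orth i i) eqxx mulr1 expr2.
move=> i' ii'; rewrite cpt_integralZ; last exact: cpt_measM.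
rewrite (phi_orth i i') (_ : (_ == _) = false) ?mulr0//.
by apply/eqP => -[] /ord_inj ee; rewrite ee eqxx in ii'.
Qed.

Lemma window_sum_le u t : (forall i, `|u i| <= 1) -> `|window_sum u t| <= L%:R * C.
Proof.
move=> u1; rewrite (le_trans (ler_norm_sum _ _ _))//.
apply: (@le_trans _ _ (\sum_(i < L) C)).
  apply: ler_sum => i _; rewrite normrM -[leRHS]mul1r.
  by apply: ler_pM.
by rewrite sumr_const card_ord mulr_natl.
Qed.

Lemma window_sum_supp u t : window_sum u t != 0 ->
  B%:~R < t <= B%:~R + (L + L)%:R.
Proof.
move=> u0.
have [i /= ui|h] := pickP (fun i : 'I_L => phi (t - i%:R) != 0); last first.
  move: u0; rewrite /window_sum big1 ?eqxx// => i _.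
  by have := h i; case: eqP => //= -> _; rewrite mulr0.
have := phi_supp ui; have : i%:R <= L%:R :> R by rewrite ler_nat ltnW.
by rewrite natrD; have := ler0n R i; lra.
Qed.

(** The support of a window has length [2 L], hence is covered by [2 L] unit cells. At a fixed point
    each cell is met by one translate at most, and a squared value is at most [(L C) ^ 2]. *)
Lemma window_sum_sq_sum u t K : (forall i, `|u i| <= 1) ->
  \sum_(0 <= m < K) (if @pickle_inv int m is Some k then
    window_sum u (t - k%:~R) ^+ 2 else 0) <= (L%:R * C) ^+ 2 * (L + L)%:R.
Proof.
move=> u1.
pose I (l m : nat) : R := if @pickle_inv int m is Some k then
  (B%:~R + l%:R < t - k%:~R <= B%:~R + l%:R + 1)%R%:R else 0.
have C0 : 0 <= C by apply: le_trans (phiC 0).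
apply: (@le_trans _ _ (\sum_(0 <= m < K) (L%:R * C) ^+ 2 * \sum_(0 <= l < L + L) I l m)).
  apply: ler_sum => m _; rewrite /I; case: pickle_inv => [k|]; last first.
    by rewrite mulr_ge0 ?sqr_ge0// sumr_ge0.
  set s := t - k%:~R.
  have S0 : 0 <= \sum_(0 <= l < L + L) (B%:~R + l%:R < s <= B%:~R + l%:R + 1)%R%:R :> R.
    by rewrite sumr_ge0.
  have [->|/window_sum_supp sI] := eqVneq (window_sum u s) 0.
    by rewrite expr0n/= mulr_ge0// sqr_ge0.
  apply: (@le_trans _ _ ((L%:R * C) ^+ 2)).
    rewrite -real_normK ?num_real// lerXn2r// ?nnegrE ?mulr_ge0//.
    exact: window_sum_le.
  rewrite ler_peMr ?sqr_ge0//.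
  have [m' m'E] : exists l, (l < L + L)%N /\ B%:~R + l%:R < s <= B%:~R + l%:R + 1.
    have [[l|l] /andP[l1 l2]] := unit_part (s - B%:~R).
      exists l; split; last by move: l1 l2; rewrite -pmulrn; lra.
      by rewrite -(ltr_nat R); move: l1; rewrite -pmulrn; lra.
    by move: l2; rewrite NegzE intrN -pmulrn -natr1; have := ler0n R l; lra.
  have [m'L m's] := m'E.
  rewrite big_mkord (bigD1 (Ordinal m'L))//= m's lerDl sumr_ge0//.
rewrite -mulr_sumr ler_wpM2l ?sqr_ge0// exchange_big/=.
apply: (@le_trans _ _ (\sum_(0 <= l < L + L) 1)).
  by apply: ler_sum => l _; exact: sum_unit_intervals.
by rewrite big_mkord sumr_const card_ord.
Qed.

End wavelet_window.

(** * Partition of unity from the density of the spaces *)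

Section finite_projection.
Variable R : realType.
Local Notation mu := (@lebesgue_measure R).

Lemma Lnorm2_lt1 (h : R -> R) : (Lnorm mu 2%:E (EFin \o h) < 1)%E ->
  (\int[mu]_x (h x ^+ 2)%:E <= 1)%E.
Proof.
move=> h1.
have -> : (\int[mu]_x (h x ^+ 2)%:E = Lnorm mu 2%:E (EFin \o h) `^ 2)%E.
  rewrite powR_Lnorm//; apply: eq_integral => x _ /=.
  by rewrite powR_mulrn// real_normK// num_real.
have <- : ((1 : \bar R) `^ 2 = 1)%E by rewrite poweR1r.
have N0 := Lnorm_ge0 mu 2%:E (EFin \o h).
by apply: (@gt0_ler_poweR R 2) => //; rewrite ?in_itv/= ?N0 ?leey ?ltW.
Qed.

Lemma int_unit_unique (t : R) (m m' : int) :
  0 < t - m%:~R <= 1 -> 0 < t - m'%:~R <= 1 -> m = m'.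
Proof.
move=> /andP[a1 a2] /andP[b1 b2].
have h1 : (m%:~R : R) < m'%:~R + 1 by lra.
have h2 : (m'%:~R : R) < m%:~R + 1 by lra.
apply/eqP; rewrite eq_le; move: h1 h2.
by rewrite -!(intrD _ _ 1) !ltr_int !ltzD1 => -> ->.
Qed.

Variables (phi : R -> R) (f : R -> R).
Hypothesis cphi : cpt_meas phi.
Hypothesis cf : cpt_meas f.
Hypothesis phi_orth : forall k l : int,
  \int[mu]_x (phi (x - k%:~R) * phi (x - l%:~R)) = (k == l)%:R.

Let b (k : int) := \int[mu]_x (f x * phi (x - k%:~R)).

Lemma projection_error (s : seq int) (c : int -> R) : uniq s ->
  \int[mu]_x ((f x - \sum_(k <- s) c k * phi (x - k%:~R)) ^+ 2) =
  \int[mu]_x (f x ^+ 2) + \sum_(k <- s) (c k ^+ 2 - 2 * (c k * b k)).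
Proof.
move=> us.
have cs (k : int) : cpt_meas (fun x => phi (x - k%:~R)) by exact: cpt_meas_shift.
have cff : cpt_meas (fun x => f x ^+ 2) by exact: cpt_measM.
have c1 (k : int) : cpt_meas (fun x => (- (2 * c k)) * (f x * phi (x - k%:~R))).
  by apply: cpt_measZ; exact: cpt_measM.
have c2 (k l : int) : cpt_meas (fun x => (c k * c l) *
    (phi (x - k%:~R) * phi (x - l%:~R))).
  by apply: cpt_measZ; exact: cpt_measM.
have c3 (k : int) : cpt_meas (fun x => \sum_(l <- s) (c k * c l) *
    (phi (x - k%:~R) * phi (x - l%:~R))).
  by apply: cpt_meas_sum => l; exact: c2.
have E x : (f x - \sum_(k <- s) c k * phi (x - k%:~R)) ^+ 2 =
   f x ^+ 2 + \sum_(k <- s) ((- (2 * c k)) * (f x * phi (x - k%:~R)) +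
     \sum_(l <- s) (c k * c l) * (phi (x - k%:~R) * phi (x - l%:~R))).
  rewrite big_split/= sqrrB -addrA; congr (_ + _).
  congr (_ + _).
    rewrite mulr_sumr -sumrMnl -sumrN; apply: eq_bigr => k _.
    by rewrite -mulr_natl; ring.
  rewrite expr2 mulr_suml; apply: eq_bigr => k _.
  by rewrite mulr_sumr; apply: eq_bigr => l _; ring.
under eq_Rintegral do rewrite E.
rewrite cpt_integralD//; last first.
  by apply: cpt_meas_sum => k; exact: cpt_measD.
congr (_ + _); rewrite cpt_integral_sum; last by move=> k; exact: cpt_measD.
apply: eq_big_seq => k ks; rewrite cpt_integralD// cpt_integralZ; last exact: cpt_measM.
rewrite cpt_integral_sum// (bigD1_seq k)//= cpt_integralZ; last exact: cpt_measM.
rewrite (phi_orth k k) eqxx big1 ?addr0; first by rewrite mulr1 /b; ring.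
move=> l lk; rewrite cpt_integralZ; last exact: cpt_measM.
by rewrite (phi_orth k l) eq_sym (negbTE lk) mulr0.
Qed.

Lemma projection_optimal (s : seq int) (c : int -> R) : uniq s ->
  \int[mu]_x ((f x - \sum_(k <- s) b k * phi (x - k%:~R)) ^+ 2) <=
  \int[mu]_x ((f x - \sum_(k <- s) c k * phi (x - k%:~R)) ^+ 2).
Proof.
move=> us; rewrite !projection_error// lerD2l; apply: ler_sum => k _.
by have := sqr_ge0 (c k - b k); nra.
Qed.

End finite_projection.

Section partition_of_unity.
Variable R : realType.
Local Notation mu := (@lebesgue_measure R).
Variables (phi : R -> R) (B : int) (L : nat) (C : R).
Hypothesis mphi : measurable_fun [set: measurableTypeR R] phi.
Hypothesis phiC : forall x, `|phi x| <= C.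
Hypothesis phi_supp : forall x, phi x != 0 -> B%:~R < x <= B%:~R + L%:R.
Hypothesis phi_father : father_wavelet phi.
Hypothesis phi_unif : forall e, 0 < e -> exists2 d : R, 0 < d & forall x y,
  B%:~R < x <= B%:~R + L%:R -> B%:~R < y <= B%:~R + L%:R ->
  `|x - y| < d -> `|phi x - phi y| < e.

Let beta : int := B + L%:Z - 1.
Let c := \int[mu]_x phi x.

(* At [m + th] with [0 < th <= 1] the only translates of [phi] that can be nonzero
   are those by [m - beta + i] with [i < L]; their values are [unit_value i th]. *)
Definition unit_value (i : nat) (th : R) := phi (th + beta%:~R - i%:R).

Let betaE : beta%:~R = B%:~R + L%:R - 1 :> R.
Proof. by rewrite /beta intrB intrD. Qed.

Let G (th : R) := \sum_(i < L) unit_value i th.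

Let cphi : cpt_meas phi. Proof. exact: cpt_meas_phi phi_supp. Qed.

Lemma unit_value_mem (i : 'I_L) (th : R) : 0 < th <= 1 ->
  B%:~R < th + beta%:~R - i%:R <= B%:~R + L%:R.
Proof.
move=> /andP[t0 t1]; rewrite betaE.
have : (i.+1%:R : R) <= L%:R by rewrite ler_nat.
by rewrite -natr1; have := ler0n R i; lra.
Qed.

Lemma window_nonzero (m : int) (th : R) (k : int) : 0 < th <= 1 ->
  phi (m%:~R + th - k%:~R) != 0 ->
  exists2 i : 'I_L, True & k = m - beta + i%:Z.
Proof.
move=> /andP[t0 t1] /phi_supp/andP[h1 h2].
have k1 : m - beta <= k.
  rewrite -ltzD1 -(ltr_int R) !intrD mulrNz betaE; lra.
have k2 : k - (m - beta) < L%:Z.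
  by rewrite -(ltr_int R) intrB [(m - beta)%:~R]intrB betaE; lra.
have [l lE] : exists l : nat, k - (m - beta) = l%:Z.
  by move: k1; rewrite -subr_ge0; case: (k - (m - beta)) => // l _; exists l.
have lL : (l < L)%N by rewrite -ltz_nat -lE.
by exists (Ordinal lL) => //=; rewrite -lE subrKC.
Qed.

Let q (s : R) := if 0 < s <= 1 then (1 - c * G s) ^+ 2 else 0.

Let ind (N : nat) (x : R) : R := if 0 < x <= N%:R then 1 else 0.

Let cind N : cpt_meas (ind N).
Proof.
split.
  have -> : ind N = \1_(`]0, N%:R]%classic : set (measurableTypeR R)).
    apply/funext => x; rewrite indicE /ind; case: ifP => xN.
      by rewrite mem_set// /= in_itv.
    by rewrite memNset// /= in_itv/= xN.
  exact: measurable_indic.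
exists 1, N%:R; split => x.
  by rewrite /ind; case: ifP => _; rewrite ?normr1 ?normr0.
move=> Nx; rewrite /ind; case: ifP => // /andP[x0 xN].
by move: Nx; rewrite gtr0_norm// ltNge xN.
Qed.

Let cq : cpt_meas q.
Proof.
have -> : q = fun s => (ind 1 s * (1 - c * G s)) * (ind 1 s * (1 - c * G s)).
  apply/funext => s; rewrite /q /ind.
  by case: ifP => _; rewrite ?mul1r ?mul0r// expr2.
suff cg : cpt_meas (fun s => ind 1 s * (1 - c * G s)) by exact: cpt_measM.
have -> : (fun s => ind 1 s * (1 - c * G s)) =
  fun s => ind 1 s + (- c) * (ind 1 s * G s) by apply/funext => s; ring.
apply: cpt_measD => //; apply: cpt_measZ; apply: cpt_measM => //.
apply: cpt_meas_sum => i.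
have := cpt_meas_shift (i%:R - beta%:~R) cphi; congr cpt_meas.
by apply/funext => s; rewrite /unit_value; congr (phi _); ring.
Qed.

Let q_ge0 s : 0 <= q s.
Proof. by rewrite /q; case: ifP => // _; exact: sqr_ge0. Qed.

Let L2_ind N : L2 (ind N).
Proof.
rewrite /L2/=; apply/andP; split; apply: mem_set => /=.
  exact: (cind N).1.
rewrite /finite_norm unlock; apply: poweR_lty.
have -> : (\int[mu]_x `|(EFin \o ind N) x| `^ 2 = \int[mu]_x (ind N x * ind N x)%:E)%E.
  apply: eq_integral => x _ /=.
  by rewrite powR_mulrn// real_normK ?num_real// expr2.
by rewrite -EFin_cpt_integral ?ltry//; exact: cpt_measM.
Qed.

(** The indicator of []0, M]] is within 1 of some [g0 (2 ^ j x)]. Rescaling multiplies the squared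
    error by [2 ^ j], and truncating the series of [g0] adds an error of at most 1, so the total is
    at most [2 * 2 ^ j + 2 <= 4 * 2 ^ j]. The finite index set is enlarged so that it contains every
    translate meeting a cell of []0, N]]. *)
Let approx M : exists (j : nat) (s : seq int) (a : int -> R),
  [/\ uniq s, {subset [seq - beta + (nat_of_ord i)%:Z | i <- enum 'I_(2 ^ j * M + L)%N] <= s} &
    \int[mu]_x ((ind (2 ^ j * M)%N x - \sum_(k <- s) a k * phi (x - k%:~R)) ^+ 2)
      <= 4 * 2 ^+ j].
Proof.
have [_ _ _ dens] := phi_father.
have [j [g [[g0 [L2g0 [a [_ acvg]]] ->] fg]]] := dens _ (L2_ind M) 1 ltr01.
have mg0 : measurable_fun [set: measurableTypeR R] g0.
  by move: L2g0; rewrite /L2/= => /andP[/set_mem].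
have tj0 : 0 < 2 ^+ j :> R by rewrite exprn_gt0.
set N := (2 ^ j * M)%N.
have nb : nbhs (0%E : \bar R) [set z : \bar R | (z < 1)%E].
  by apply: open_nbhs_nbhs; split; [exact: open_ereal_lt_ereal|exact: lte01].
have [A0 _ A0P] := acvg _ nb.
pose A := (A0 `|` [fset (- beta + (nat_of_ord i)%:Z)%R | i in 'I_(N + L)])%fset.
have := A0P A; rewrite /= fsubsetUl => /(_ isT) /Lnorm2_lt1.
have psE x : partial_sum (fun k : int => a k * phi (x - k%:~R)) A =
    \sum_(k <- A) a k * phi (x - k%:~R).
  by rewrite /partial_sum -(big_seq_fsetE _ _ xpredT (fun k : int => a k * phi (x - k%:~R))).
pose h0 x := \sum_(k <- A) a k * phi (x - k%:~R).
have ch0 : cpt_meas h0.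
  by apply: cpt_meas_sum => k; apply: cpt_measZ; exact: cpt_meas_shift.
under eq_integral do rewrite psE -/(h0 _).
move=> gh.
have fg' : (\int[mu]_x ((ind N x - g0 x) ^+ 2)%:E <= (2 ^+ j)%:E)%E.
  have := Lnorm2_lt1 fg.
  have -> : (\int[mu]_x ((ind M x - g0 (2 ^+ j * x)) ^+ 2)%:E =
    \int[mu]_x ((ind N (2 ^+ j * x + 0)%R - g0 (2 ^+ j * x + 0)%R) ^+ 2)%:E)%E.
    apply: eq_integral => x _; rewrite addr0; congr ((_ - _) ^+ 2)%:E.
    by rewrite /ind /N natrM natrX pmulr_rgt0// ler_pM2l.
  rewrite (@ge0_integral_affine R (2 ^+ j) 0 (fun x => ((ind N x - g0 x) ^+ 2)%:E))//.
  - by rewrite lee_pdivrMl// mule1.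
  - apply/measurable_EFinP; apply: measurable_funX; apply: measurable_funB => //.
    exact: (cind N).1.
  - by move=> x; rewrite lee_fin sqr_ge0.
exists j, A, a; split; first exact: fset_uniq.
  move=> _ /mapP[i _ ->]; rewrite !inE; apply/orP; right.
  by apply/imfsetP; exists i.
rewrite -lee_fin EFin_cpt_integral; last first.
  have cd : cpt_meas (fun x => ind N x + (- 1) * h0 x).
    by apply: cpt_measD => //; exact: cpt_measZ.
  have := cpt_measM cd cd; congr cpt_meas.
  by apply/funext => x; rewrite mulN1r -expr2.
apply: (@le_trans _ _ (\int[mu]_x ((2 * (ind N x - g0 x) ^+ 2)%:E +
    (2 * (g0 x - h0 x) ^+ 2)%:E))%E).
  apply: ge0_le_integral => //=.
  - by move=> x _; rewrite lee_fin sqr_ge0.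
  - apply/measurable_EFinP; apply: measurable_funX; apply: measurable_funB.
      exact: (cind N).1.
    exact: ch0.1.
  - apply/measurable_EFinP; apply: measurable_funD; apply: measurable_funM => //;
      apply: measurable_funX; apply: measurable_funB => //.
      exact: (cind N).1.
    exact: ch0.1.
  - move=> x _; rewrite -EFinD lee_fin -/(h0 x).
    by have := sqr_ge0 (ind N x - g0 x - (g0 x - h0 x)); nra.
rewrite ge0_integralD//=; first last.
  - apply/measurable_EFinP; apply: measurable_funM => //.
    apply: measurable_funX; apply: measurable_funB => //; exact: ch0.1.
  - by move=> x _; rewrite lee_fin mulr_ge0// sqr_ge0.
  - apply/measurable_EFinP; apply: measurable_funM => //.
    apply: measurable_funX; apply: measurable_funB => //; exact: (cind N).1.
  - by move=> x _; rewrite lee_fin mulr_ge0// sqr_ge0.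
under eq_integral do rewrite EFinM.
rewrite ge0_integralZl//=; first last.
  - by move=> x _; rewrite lee_fin sqr_ge0.
  - apply/measurable_EFinP.
    apply: measurable_funX; apply: measurable_funB => //; exact: (cind N).1.
under [X in (_ + X <= _)%E]eq_integral do rewrite EFinM.
rewrite ge0_integralZl//=; first last.
  - by move=> x _; rewrite lee_fin sqr_ge0.
  - apply/measurable_EFinP.
    apply: measurable_funX; apply: measurable_funB => //; exact: ch0.1.
apply: (@le_trans _ _ (2%:E * (2 ^+ j)%:E + 2%:E * 1)%E).
  by apply: leeD; apply: lee_wpmul2l => //; rewrite lee_fin.
rewrite mule1 -EFinM -EFinD lee_fin.
have : 1 <= 2 ^+ j :> R by rewrite exprn_ege1// ler1n.
lra.
Qed.


Let I := \int[mu]_s q s.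

Let orth (k l : int) : \int[mu]_x (phi (x - k%:~R) * phi (x - l%:~R)) = (k == l)%:R.
Proof. by have [_ -> _ _] := phi_father. Qed.

(* Since the V_j are dense and nested, the indicator of ]0, 2^j M] is approximated
   in [V_j] with squared error at most [4 * 2 ^ j]; on every unit cell away from the
   end points its projection is [c * G], which contributes [I] to the error. *)
Let middle M : (M%:R - (L + L)%:R) * I <= 4.
Proof.
have [j [s [a [us sW H]]]] := approx M.
set N := (2 ^ j * M)%N in sW H.
have {H} := le_trans (projection_optimal cphi (cind N) orth a us) H.
set b := fun k : int => \int[mu]_x (ind N x * phi (x - k%:~R)).
move=> H.
have tj0 : 0 < 2 ^+ j :> R by rewrite exprn_gt0.
have I0 : 0 <= I by apply: Rintegral_ge0.
have bc (m i : nat) : (L <= m < N - L)%N -> (i < L)%N -> b (m%:Z - beta + i%:Z) = c.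
  move=> /andP[Lm mN] iL; rewrite /b /c.
  rewrite -(cpt_integral_shift (m%:Z - beta + i%:Z)%:~R cphi).
  apply: eq_Rintegral => x _.
  have [->|/phi_supp/andP[h1 h2]] := eqVneq (phi (x - (m%:Z - beta + i%:Z)%:~R)) 0.
    by rewrite mulr0.
  rewrite /ind (_ : _ && _) ?mul1r//.
  move: h1 h2; rewrite intrD intrB betaE -!pmulrn => h1 h2.
  have e1 : (L%:R : R) <= m%:R by rewrite ler_nat.
  have e2 : (m%:R + 1 + L%:R : R) <= N%:R.
    by rewrite natr1 -natrD ler_nat; move: mN; rewrite ltn_subRL addnC.
  have e3 : (i%:R + 1 : R) <= L%:R by rewrite natr1 ler_nat.
  have e4 := ler0n R i.
  by apply/andP; split; lra.
have cqs (m : nat) : cpt_meas (fun x => q (x - m%:R)) by exact: cpt_meas_shift.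
have key x : \sum_(L <= m < N - L) q (x - m%:R) <=
    (ind N x - \sum_(k <- s) b k * phi (x - k%:~R)) ^+ 2.
  have [/hasP[m]|/hasPn no] := boolP (has (fun m : nat => 0 < x - m%:R <= 1)
      (index_iota L (N - L))); last first.
    rewrite big1_seq ?sqr_ge0// => m /andP[_ /no].
    by rewrite /q => /negbTE ->.
  rewrite mem_index_iota => mLN xm.
  rewrite (bigD1_seq m) ?mem_index_iota ?iota_uniq//= big1 ?addr0; last first.
    move=> m' m'm; rewrite /q; case: ifP => // xm'.
    have := @int_unit_unique R x m m'; rewrite -!pmulrn => /(_ xm xm')[] mm'.
    by rewrite mm' eqxx in m'm.
  have xE : x = m%:Z%:~R + (x - m%:R) by rewrite -pmulrn subrKC.
  rewrite (@sum_seq_window R _ (m%:Z - beta) L)//; first last.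
  - move=> k; rewrite mulf_eq0 negb_or => /andP[_].
    by rewrite {1}xE; exact: window_nonzero.
  - move=> _ /mapP[i _ ->]; apply: sW.
    have miN : (m + i < N + L)%N.
      rewrite -addSn leq_add ?(ltnW (ltn_ord i))//.
      by case/andP: mLN => _ /leq_trans; apply; exact: leq_subr.
    apply/mapP; exists (Ordinal miN); rewrite ?mem_enum//=.
    by rewrite PoszD; ring.
  rewrite /q xm.
  have [/andP[Lm mN] /andP[x0 x1]] := (mLN, xm).
  have -> : ind N x = 1.
    rewrite /ind (_ : _ && _)//; apply/andP; split.
      by have := ler0n R m; lra.
    have : (m.+1%:R : R) <= N%:R by rewrite ler_nat (leq_trans mN)// leq_subr.
    by rewrite -natr1; lra.
  rewrite le_eqVlt; apply/orP; left; apply/eqP; congr ((_ - _) ^+ 2).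
  rewrite /G mulr_sumr; apply: eq_bigr => i _.
  rewrite bc//; congr (_ * phi _).
  by rewrite intrD intrB -!pmulrn; ring.
have cp : cpt_meas (fun x => ind N x - \sum_(k <- s) b k * phi (x - k%:~R)).
  have cb : cpt_meas (fun x => \sum_(k <- s) b k * phi (x - k%:~R)).
    by apply: cpt_meas_sum => k; apply: cpt_measZ; exact: cpt_meas_shift.
  have := cpt_measD (cind N) (cpt_measZ (- 1) cb); congr cpt_meas.
  by apply/funext => x; rewrite mulN1r.
have csum : cpt_meas (fun x => \sum_(L <= m < N - L) q (x - m%:R)).
  exact: cpt_meas_sum.
have := le_Rintegral measurableT (cpt_meas_integrable csum)
  (cpt_meas_integrable (cpt_measM cp cp)) (fun x _ => key x).
move=> /le_trans /(_ H); rewrite cpt_integral_sum//.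
under eq_bigr do rewrite cpt_integral_shift//.
rewrite -/I big_const_nat iter_addr_0 -[I *+ _]mulr_natl => NI.
have NLI : (N%:R - (L + L)%:R) * I <= (N - L - L)%:R * I.
  by rewrite ler_wpM2r// lerBlDr -natrD ler_nat -subnDA addnC -leq_subLR.
rewrite -(ler_pM2l tj0) [2 ^+ j * 4]mulrC; apply: le_trans NI.
apply: le_trans NLI; rewrite mulrA ler_wpM2r// mulrBr /N natrM natrX lerD2l lerN2.
by rewrite ler_peMl// exprn_ege1// ler1n.
Qed.

(** In [middle] the factor of [I] is unbounded in [M] while the right-hand side is fixed. *)
Let I_eq0 : I = 0.
Proof.
have I0 : 0 <= I by apply: Rintegral_ge0.
apply/eqP; rewrite eq_le I0 andbT leNgt; apply/negP => Ip.
have := middle (L + L + (Num.truncn (4 / I)).+1); rewrite natrD addrAC subrr add0r.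
by rewrite -ler_pdivlMr// leNgt truncnS_gt.
Qed.

(** [I = 0] gives the identity only almost everywhere. A defect [eta] at [th] would persist, with
    size at least [|eta| / 2], on an interval []th - dl, th]] by uniform continuity, and make [I]
    positive. *)
Lemma partition_of_unity (th : R) : 0 < th <= 1 ->
  c * \sum_(i < L) unit_value i th = 1.
Proof.
move=> t01; apply/eqP; rewrite -/(G th) eq_sym -subr_eq0; apply/negP => /negP cG.
set eta := 1 - c * G th in cG.
have eta0 : 0 < `|eta| by rewrite normr_gt0.
(* A change of each of the [L] values by at most [e] moves [c * G] by at most [|eta| / 2]. *)
pose e := `|eta| / (2 * ((`|c| + 1) * (L%:R + 1))).
have K0 : 0 < (`|c| + 1) * (L%:R + 1).
  by rewrite mulr_gt0// ltr_wpDl// ler0n.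
have e0 : 0 < e by rewrite divr_gt0// mulr_gt0.
have [d d0 ud] := phi_unif e0.
pose dl := Num.min d th.
have [t0 t1] := andP t01.
have dl0 : 0 < dl by rewrite lt_min d0.
have near s : th - dl < s <= th -> (`|eta| / 2) ^+ 2 <= q s.
  move=> /andP[s1 s2].
  have s01 : 0 < s <= 1.
    rewrite (le_trans s2 t1) andbT (le_lt_trans _ s1)// subr_ge0.
    by rewrite ge_min lexx orbT.
  rewrite /q s01 -[leRHS]real_normK ?num_real// lerXn2r ?nnegrE ?divr_ge0//.
  have GG : `|c * G th - c * G s| <= `|eta| / 2.
    rewrite -mulrBr normrM /G -sumrB.
    apply: (@le_trans _ _ (`|c| * (L%:R * e))).
      rewrite ler_wpM2l// (le_trans (ler_norm_sum _ _ _))//.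
      apply: (@le_trans _ _ (\sum_(i < L) e)); last first.
        by rewrite sumr_const card_ord mulr_natl.
      apply: ler_sum => i _; apply/ltW/ud; try exact: unit_value_mem.
      have -> : th + beta%:~R - i%:R - (s + beta%:~R - i%:R) = th - s by ring.
      rewrite ger0_norm ?subr_ge0//.
      have : dl <= d by rewrite ge_min lexx.
      by move: s1; rewrite ltrBlDr; lra.
    have -> : `|eta| / 2 = (`|c| + 1) * (L%:R + 1) * e.
      by rewrite /e; field; rewrite !gt_eqF// ltr_wpDl// ler0n.
    rewrite mulrA ler_wpM2r ?(ltW e0)//.
    by have := normr_ge0 c; have := ler0n R L; nra.
  have -> : 1 - c * G s = eta + (c * G th - c * G s) by rewrite /eta; ring.
  by have := lerB_normD eta (c * G th - c * G s); lra.
have : (((`|eta| / 2) ^+ 2)%:E * dl%:E <= I%:E)%E.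
  have -> : dl%:E = (\int[mu]_s (\1_(`]th - dl, th]%classic : set R) s)%:E)%E.
    have muI : mu `]th - dl, th]%classic = dl%:E.
      rewrite lebesgue_measure_itv/= lte_fin ltrBlDr ltrDl dl0.
      by rewrite -EFinB opprB addrCA subrr addr0.
    by rewrite integral_indic ?setIT//=; exact: measurable_itv.
  rewrite /I EFin_cpt_integral// -ge0_integralZl//=; last first.
    by apply/measurable_EFinP; exact: measurable_indic.
  apply: ge0_le_integral => //=.
  - apply/measurable_EFinP; apply: measurable_funM => //; exact: measurable_indic.
  - by apply/measurable_EFinP; exact: cq.1.
  - move=> x _; rewrite -EFinM lee_fin indicE.
    have [xin|_] := boolP (x \in _); last by rewrite mulr0.
    rewrite mulr1 near//; move: xin => /set_mem; rewrite /= in_itv//.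
rewrite I_eq0 -EFinM lee_fin leNgt mulr_gt0// exprn_gt0// divr_gt0//.
Qed.

(** Cauchy-Schwarz, obtained from the sum of all squared differences [(v i - v k) ^ 2]. It bounds
    the denominators of the theorem away from zero and shows that the integral [c] does not
    vanish. *)
Lemma sum_unit_value_sq (th : R) : 0 < th <= 1 ->
  1 <= c ^+ 2 * L%:R * \sum_(i < L) unit_value i th ^+ 2.
Proof.
move=> /partition_of_unity h.
set v := fun i : 'I_L => unit_value i th.
have h2 : c ^+ 2 * (\sum_(i < L) v i) ^+ 2 = 1 by rewrite -exprMn h expr1n.
rewrite -[leLHS]h2 -mulrA ler_wpM2l ?sqr_ge0//.
have : 0 <= \sum_(i < L) \sum_(k < L) (v i - v k) ^+ 2.
  by apply: sumr_ge0 => i _; apply: sumr_ge0 => k _; exact: sqr_ge0.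
have -> : \sum_(i < L) \sum_(k < L) (v i - v k) ^+ 2 =
   2 * (L%:R * (\sum_(i < L) v i ^+ 2) - (\sum_(i < L) v i) ^+ 2).
  have E i : \sum_(k < L) (v i - v k) ^+ 2 = L%:R * v i ^+ 2
      + (- 2 * (\sum_(k < L) v k)) * v i + \sum_(k < L) v k ^+ 2.
    transitivity (\sum_(k < L) (v i ^+ 2 + (- 2 * v i) * v k + v k ^+ 2)).
      by apply: eq_bigr => k _; ring.
    by rewrite !big_split/= sumr_const card_ord -mulr_sumr -[_ *+ L]mulr_natl; ring.
  under eq_bigr do rewrite E.
  rewrite !big_split/= -!mulr_sumr sumr_const card_ord -[_ *+ L]mulr_natl.
  by ring.
by lra.
Qed.

End partition_of_unity.

(** * Almost sure bounds *)

Section borel_cantelli_square.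
Context d (T : measurableType d) (R : realType) (P : probability T R).

Lemma sum_inverse_squares_le (n : nat) :
  \sum_(0 <= r < n.+1) (r.+1%:R ^- 2) <= 2 - n.+1%:R^-1 :> R.
Proof.
elim: n => [|n IH]; first by rewrite big_nat1 expr1n; lra.
rewrite big_nat_recr//=; have n1 : 0 < n.+1%:R :> R by rewrite ltr0n.
have n2E : n.+2%:R = n.+1%:R + 1 :> R by rewrite natr1.
have n2 : 0 < n.+2%:R :> R by rewrite ltr0n.
suff h : n.+2%:R ^- 2 <= n.+1%:R^-1 - n.+2%:R^-1 :> R.
  by apply: le_trans (lerD IH h) _; rewrite addrA subrK.
have -> : n.+1%:R^-1 - n.+2%:R^-1 = n.+1%:R^-1 * n.+2%:R^-1 :> R.
  have -> : n.+1%:R^-1 - n.+2%:R^-1 = (n.+2%:R - n.+1%:R) / (n.+1%:R * n.+2%:R) :> R.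
    by field; rewrite !gt_eqF//; have := ler0n R n; lra.
  by rewrite n2E addrAC subrr add0r div1r invfM.
rewrite expr2 invfM ler_wpM2r ?invr_ge0 ?(ltW n2)// lef_pV2 ?posrE//.
by rewrite ler_nat.
Qed.

Lemma borel_cantelli_square (E : nat -> set T) (K : R) (r0 : nat) :
  (forall r, measurable (E r)) ->
  (forall r, (r0 <= r)%N -> (P (E r) <= (K * r.+1%:R ^- 2)%:E)%E) ->
  {ae P, forall x, exists r1, forall r, (r1 <= r)%N -> ~ E r x}.
Proof.
move=> mE EK; pose F r := E (r + r0)%N.
have mF r : measurable (F r) by exact: mE.
have FK r : (P (F r) <= (`|K| * r.+1%:R ^- 2)%:E)%E.
  apply: (le_trans (EK _ (leq_addl _ _))); rewrite lee_fin.
  apply: (@le_trans _ _ (`|K| * (r + r0).+1%:R ^- 2)).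
    by rewrite ler_wpM2r ?ler_norm// invr_ge0 exprn_ge0.
  rewrite ler_wpM2l// lef_pV2 ?posrE ?exprn_gt0 ?ltr0n//.
  by rewrite lerXn2r ?nnegrE// ler_nat ltnS leq_addr.
have sF : (\sum_(r <oo) P (F r) < +oo)%E.
  apply: (@le_lt_trans _ _ (`|K| * 2)%:E); last exact: ltry.
  apply: lime_le; first exact: is_cvg_nneseries.
  apply: nearW => n; apply: (@le_trans _ _ (\sum_(0 <= r < n.+1) P (F r))%E).
    by rewrite big_nat_recr//= leeDl.
  apply: (@le_trans _ _ (\sum_(0 <= r < n.+1) (`|K| * r.+1%:R ^- 2)%:E)%E).
    by apply: lee_sum => r _.
  rewrite sumEFin lee_fin -mulr_sumr ler_wpM2l//.
  apply: (le_trans (sum_inverse_squares_le n)).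
  by rewrite gerBl invr_ge0.
have mL : measurable (lim_sup_set F).
  by apply: bigcapT_measurable => n; apply: bigcup_measurable.
exists (lim_sup_set F); split => //; first exact: lim_sup_set_cvg0.
move=> x /= nx n _; apply: contrapT => nF; apply: nx.
exists (n + r0)%N => r nr Er; apply: nF; exists (r - r0)%N => /=.
  by rewrite leq_subRL ?(leq_trans (leq_addl n r0) nr)// addnC.
by rewrite /F subnK // (leq_trans (leq_addl n r0) nr).
Qed.

End borel_cantelli_square.

Section coordinates.
Variable R : realType.
Variable P : probability (measurableTypeR R) R.
Variable PN : probability (seq_space R) R.
Hypothesis PN_power : is_power PN P.

Lemma bdd_meas_coord (g : R -> R) (l : nat) :
  bdd_meas (g : measurableTypeR R -> R) ->
  bdd_meas (fun x : seq_space R => g (x l)).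
Proof.
move=> [mg [C gC]]; split; last by exists C => x.
exact: measurableT_comp mg (measurable_coord l).
Qed.

Lemma expect_coord (g : R -> R) (l : nat) :
  bdd_meas (g : measurableTypeR R -> R) ->
  \int[PN]_x g (x l) = \int[P]_a g a.
Proof.
move=> bg; rewrite /Rintegral; congr fine.
pose X (x : seq_space R) : measurableTypeR R := x l.
have mX : measurable_fun setT X by exact: measurable_coord.
have ig := bdd_meas_integrable PN (bdd_meas_coord l bg).
pose Q : {measure set (measurableTypeR R) -> \bar R} :=
  measure_function_pushforward__canonical__measure_function_Measure PN mX.
have -> : (\int[P]_a (g a)%:E = \int[Q]_a (g a)%:E)%E.
  apply: eq_measure_integral => A mA _.
  exact: (esym (power_coord PN_power l mA)).
rewrite (@integral_pushforward _ _ _ _ _ X mX PN setT (EFin \o g))//.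
by apply/measurable_EFinP; exact: bg.1.
Qed.

End coordinates.

Section scaled_windows.
Variable R : realType.
Local Notation mu := (@lebesgue_measure R).
Variables (phi : R -> R) (B : int) (L : nat) (C : R).
Hypothesis mphi : measurable_fun [set: measurableTypeR R] phi.
Hypothesis phiC : forall x, `|phi x| <= C.
Hypothesis phi_supp : forall x, phi x != 0 -> B%:~R < x <= B%:~R + L%:R.
Hypothesis phi_orth : forall k l : int,
  \int[mu]_x (phi (x - k%:~R) * phi (x - l%:~R)) = (k == l)%:R.
Variables (P : probability (measurableTypeR R) R) (p0 : R -> R) (p : R).
Hypothesis p0_density : is_density p0 P.
Hypothesis p_ge0 : 0 <= p.
Hypothesis p0_le : forall x, p0 x <= p.
Variable u : 'I_L -> R.
Hypothesis u1 : \sum_i u i ^+ 2 = 1.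

Definition scaled_window (j : nat) (k : int) (x : R) :=
  window_sum phi u (2 ^+ j * x - k%:~R).

(* All integer translates as one family indexed by [nat]; indices that encode
   no integer give the zero function. *)
Definition window_family (j m : nat) (x : R) :=
  if @pickle_inv int m is Some k then scaled_window j k x else 0.

Lemma coef_le1 i : `|u i| <= 1.
Proof.
rewrite -(ler_pXn2r (n := 2)) ?nnegrE// expr1n real_normK ?num_real// -u1.
by rewrite (bigD1 i)//= lerDl sumr_ge0// => k _; exact: sqr_ge0.
Qed.

Let cw := cpt_meas_window_sum mphi phiC phi_supp u.

Lemma measurable_scaled_window j k :
  measurable_fun [set: measurableTypeR R] (scaled_window j k).
Proof.
have -> : scaled_window j k = window_sum phi u \o (fun x => 2 ^+ j * x + (- k%:~R)).
  by [].
exact: measurableT_comp cw.1 (measurable_affine _ _).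
Qed.

Lemma scaled_window_le j k x : `|scaled_window j k x| <= L%:R * C.
Proof. by apply: window_sum_le => //; exact: coef_le1. Qed.

Lemma bdd_meas_scaled_window j k :
  bdd_meas (scaled_window j k : measurableTypeR R -> R).
Proof.
exact: bounded_bdd_meas (measurable_scaled_window j k) (scaled_window_le j k).
Qed.

Let sq_bdd j k : bdd_meas ((fun x => scaled_window j k x ^+ 2) : measurableTypeR R -> R).
Proof. by apply: bdd_measM; exact: bdd_meas_scaled_window. Qed.

Lemma scaled_window_norm2 j k :
  (\int[mu]_x ((scaled_window j k x) ^+ 2)%:E = (2 ^- j)%:E)%E.
Proof.
rewrite /scaled_window.
rewrite (@ge0_integral_affine R (2 ^+ j) (- k%:~R)
  (fun t => (window_sum phi u t ^+ 2)%:E)).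
- by rewrite (window_sum_norm2 mphi phiC phi_supp phi_orth) u1 mule1.
- by rewrite exprn_gt0.
- by apply/measurable_EFinP; apply: measurable_funX; exact: cw.1.
- by move=> x; rewrite lee_fin sqr_ge0.
Qed.

Lemma scaled_window_var_le j k :
  \int[P]_x (scaled_window j k x ^+ 2) <= p / 2 ^+ j.
Proof.
rewrite -lee_fin (EFin_expect P (sq_bdd j k)).
rewrite [leRHS]EFinM -(scaled_window_norm2 j k).
apply: (density_integral_le p0_density) => //.
- by apply/measurable_EFinP; exact: (sq_bdd j k).1.
- by move=> x; rewrite lee_fin sqr_ge0.
Qed.

Lemma scaled_window_var_ge j k (c : R) (D : set R) : 0 <= c ->
  measurable (D : set (measurableTypeR R)) ->
  (forall x, D x -> c <= p0 x) ->
  (forall x, scaled_window j k x != 0 -> D x) ->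
  c / 2 ^+ j <= \int[P]_x (scaled_window j k x ^+ 2).
Proof.
move=> c0 mD Dc wD.
rewrite -lee_fin (EFin_expect P (sq_bdd j k)).
rewrite [leLHS]EFinM -(scaled_window_norm2 j k).
apply: (density_integral_ge p0_density c0 mD) => //.
- by apply/measurable_EFinP; exact: (sq_bdd j k).1.
- by move=> x; rewrite lee_fin sqr_ge0.
- move=> x nD; have [->|/wD//] := eqVneq (scaled_window j k x) 0.
  by rewrite expr0n.
Qed.

Lemma scaled_window_supp j k x : scaled_window j k x != 0 ->
  B%:~R + k%:~R < 2 ^+ j * x <= B%:~R + k%:~R + (L + L)%:R.
Proof. by move=> /(window_sum_supp phi_supp); lra. Qed.

Lemma measurable_window_family j m :
  measurable_fun [set: measurableTypeR R] (window_family j m).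
Proof.
rewrite /window_family; case: pickle_inv => [k|]; last exact: measurable_cst.
exact: measurable_scaled_window.
Qed.

Lemma window_family_le j m x : `|window_family j m x| <= L%:R * C.
Proof.
rewrite /window_family; case: pickle_inv => [k|]; first exact: scaled_window_le.
by rewrite normr0 mulr_ge0// (le_trans _ (phiC 0)).
Qed.

Lemma window_family_var_le j m :
  \int[P]_x (window_family j m x ^+ 2) <= p / 2 ^+ j.
Proof.
rewrite /window_family; case: pickle_inv => [k|]; first exact: scaled_window_var_le.
under eq_Rintegral do rewrite expr0n/=.
by rewrite (expect_cst P) divr_ge0// exprn_ge0.
Qed.

(** The pointwise bound on the sum of squares is averaged over [P]. It does not depend on [j], so
    its ratio to the largest variance [p / 2 ^ j] is of order [2 ^ j]: the effective number of
    windows in the union bound. *)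
Lemma window_family_var_sum j K :
  \sum_(0 <= m < K) \int[P]_x (window_family j m x ^+ 2)
    <= (L%:R * C) ^+ 2 * (L + L)%:R.
Proof.
have bw m : bdd_meas ((fun x => window_family j m x ^+ 2) : measurableTypeR R -> R).
  have bf := bounded_bdd_meas (measurable_window_family j m) (window_family_le j m).
  exact: bdd_measM.
rewrite -(@expect_sum _ (measurableTypeR R))//.
apply: expect_le_cst => [|x]; first exact: bdd_meas_sum.
apply: le_trans (window_sum_sq_sum phiC phi_supp (2 ^+ j * x) K coef_le1).
apply: ler_sum => m _; rewrite /window_family.
by case: pickle_inv => [k|] /=; rewrite ?expr0n.
Qed.

End scaled_windows.

(** * Almost sure upper bound over all translates *)

Section eventual_bounds.
Variable R : realType.
Variable P : probability (measurableTypeR R) R.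
Variable PN : probability (seq_space R) R.
Hypothesis PN_power : is_power PN P.
Variables (j : nat -> nat) (tau : R) (n0 : nat).
Hypothesis j_nondecr : {homo j : m n / (m <= n)%N}.
Hypothesis j_oo : forall A : R, exists n1, forall n, (n1 <= n)%N -> A <= (j n)%:R.
Hypothesis j_slow : forall eta : R, 0 < eta -> exists n1, forall n, (n1 <= n)%N ->
  (j n)%:R * 2 ^+ j n / n%:R <= eta.
Hypothesis j_fast : forall A : R, exists n1, forall n, (n1 <= n)%N ->
  A * ln (ln n%:R) <= (j n)%:R.
Hypothesis j_doubling : forall n, (n0 <= n)%N -> (j (2 * n)%N)%:R - (j n)%:R <= tau.

(* Blocks whose end points have ratio at most [1 + 1 / q]: by the maximal inequality,
   the right end point controls all partial sums of a block. *)
Lemma block_decomposition (q n : nat) : (0 < q)%N -> (q <= n)%N ->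
  exists r a : nat, [/\ (a < q)%N, (q * 2 ^ r <= n)%N, (n <= 2 * (q * 2 ^ r))%N,
    (n <= (q + a + 1) * 2 ^ r)%N & ((q + a + 1) * 2 ^ r * q <= n * (q + 1))%N].
Proof.
move=> q0 qn; pose r := trunc_log 2 (n %/ q).
have nq : (0 < n %/ q)%N by rewrite divn_gt0.
have /andP[r1 r2] := trunc_log_bounds (isT : 1 < 2)%N nq.
have h1 : (q * 2 ^ r <= n)%N by rewrite mulnC -leq_divRL.
have h2 : (n < 2 * (q * 2 ^ r))%N.
  by rewrite mulnCA -expnS mulnC -ltn_divLR.
have p2 : (0 < 2 ^ r)%N by rewrite expn_gt0.
have b1 : (q <= n %/ 2 ^ r)%N by rewrite leq_divRL.
have b2 : (n %/ 2 ^ r < 2 * q)%N by rewrite ltn_divLR// -mulnA.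
have e1 := leq_divM n (2 ^ r).
have e2 := ltn_ceil n p2.
exists r, (n %/ 2 ^ r - q)%N; rewrite subnKC//.
split => //.
- by rewrite ltn_subLR// addnn -mul2n.
- exact: ltnW.
- by rewrite addn1 ltnW.
- rewrite mulnDl mul1n mulnDl [(n * _)%N]mulnDr muln1.
  by apply: leq_add; [rewrite leq_mul2r e1 orbT|rewrite mulnC].
Qed.

Lemma ler_threshold (p : R) (i N n : nat) (a b : R) : 0 <= p -> 0 <= a -> 0 <= b ->
  a ^+ 2 * N%:R <= b ^+ 2 * n%:R ->
  a * threshold p i N <= b * threshold p i n.
Proof.
move=> p0 a0 b0 ab.
have X0 (k : nat) : 0 <= 2 * (i%:R * ln 2) * (k%:R / 2 ^+ i * p) :> R.
  by rewrite !mulr_ge0// ?invr_ge0 ?exprn_ge0// ltW// ln2_gt0.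
rewrite -(ler_pXn2r (n := 2)) ?nnegrE ?mulr_ge0 ?sqrtr_ge0//.
rewrite !exprMn !sqr_sqrtr//.
have K0 : 0 <= 2 * (i%:R * ln 2) * (p / 2 ^+ i) :> R.
  by rewrite !mulr_ge0// ?invr_ge0 ?exprn_ge0// ltW// ln2_gt0.
have := ler_wpM2l K0 ab.
by congr (_ <= _); ring.
Qed.

(** The exponent is halved. One half absorbs the factor [l]. For the other, [ln N] with
    [N = q 2 ^ r] is at least of order [r], and [j >= A ln (ln N)] with [A = 4 / (del ln 2)] turns
    it into at most [(ln N) ^ (- 2)]. *)
Lemma decay_summable (del K : R) (q : nat) : 0 < del -> 0 <= K -> (0 < q)%N ->
  exists K' : R, exists r0 : nat, forall r (l : R), (r0 <= r)%N ->
    (j (q * 2 ^ r))%:R * ln 2 <= l ->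
    K * l * expR (- (del * l)) <= K' * r.+1%:R ^- 2.
Proof.
move=> del0 K0 q0.
have ln20 := ln2_gt0 R.
have [n1 jf] := j_fast (4 / (del * ln 2)).
exists (K * (2 / del) * (4 / ln 2 ^+ 2)), (maxn n1 1) => r l.
rewrite geq_max => /andP[n1r r1] jl.
set N := (q * 2 ^ r)%N in jl.
have rN : (r <= N)%N.
  by apply: (leq_trans (ltnW (ltn_expl r (isT : 1 < 2)%N))); rewrite leq_pmull.
have N0 : (0 : R) < N%:R by rewrite ltr0n muln_gt0 q0 expn_gt0.
have lnN : r.+1%:R * ln 2 / 2 <= ln N%:R :> R.
  apply: (@le_trans _ _ (r%:R * ln 2)).
    have : (1 : R) <= r%:R by rewrite ler1n.
    by rewrite -natr1; nra.
  rewrite mulr_natl -lnXn// ler_ln ?posrE ?exprn_gt0//.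
  by rewrite -natrX ler_nat leq_pmull.
have z0 : 0 < r.+1%:R * ln 2 / 2 :> R by rewrite divr_gt0// mulr_gt0// ltr0n.
have lnN0 : 0 < ln N%:R :> R by apply: lt_le_trans lnN.
have key : 2 * ln (ln N%:R) <= del * l / 2.
  have := jf N (leq_trans n1r rN); set y := ln (ln _) => jy.
  have : 4 / (del * ln 2) * y * ln 2 <= l.
    by apply: le_trans jl; rewrite ler_wpM2r// ltW.
  have -> : 4 / (del * ln 2) * y * ln 2 = 4 * y / del by field; rewrite !gt_eqF.
  by rewrite ler_pdivrMr//; lra.
have e1 : l * expR (- (del * l / 2)) <= 2 / del.
  rewrite ler_pdivlMr// expRN -mulrAC ler_pdivrMr ?expR_gt0//.
  by have := expR_ge1Dx (del * l / 2); lra.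
have e2 : expR (- (del * l / 2)) <= 4 / ln 2 ^+ 2 * r.+1%:R ^- 2.
  apply: (@le_trans _ _ (expR (- (2 * ln (ln N%:R))))).
    by rewrite ler_expR lerN2.
  rewrite expRN expRM_natl lnK ?posrE//.
  have -> : 4 / ln 2 ^+ 2 * r.+1%:R ^- 2 = (r.+1%:R * ln 2 / 2) ^- 2 :> R.
    field; rewrite !gt_eqF//; have := ler0n R r; lra.
  by rewrite lef_pV2 ?posrE ?exprn_gt0// lerXn2r ?nnegrE ?(ltW z0) ?(ltW lnN0).
have -> : K * l * expR (- (del * l)) =
   K * ((l * expR (- (del * l / 2))) * expR (- (del * l / 2))).
  rewrite (_ : - (del * l) = - (del * l / 2) + - (del * l / 2)); last by field.
  by rewrite expRD; ring.
rewrite -!mulrA ler_wpM2l//.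
apply: (@le_trans _ _ (2 / del * expR (- (del * l / 2)))).
  by rewrite !mulrA ler_wpM2r ?expR_ge0// -mulrA.
have d2 : 0 <= 2 / del by rewrite divr_ge0// ltW.
apply: le_trans (ler_wpM2l d2 e2) _.
by rewrite !mulrA.
Qed.

Variables (p C D : R) (g : nat -> nat -> R -> R).
Hypothesis p0 : 0 < p.
Hypothesis C0 : 0 <= C.
Hypothesis mg : forall i m, measurable_fun [set: measurableTypeR R] (g i m).
Hypothesis gC : forall i m a, `|g i m a| <= C.
Hypothesis gV : forall i m, \int[P]_a (g i m a ^+ 2) <= p / 2 ^+ i.
Hypothesis gD : forall i K, \sum_(0 <= m < K) \int[P]_a (g i m a ^+ 2) <= D.

Lemma eventual_upper_bound (del : R) : 0 < del ->
  {ae PN, forall x : seq_space R, exists n1, forall n, (n1 <= n)%N -> forall m,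
    \sum_(l < n) centered P (g (j n) m) (x l) <= (1 + del) * threshold p (j n) n}.
Proof.
move=> del0; pose d := del / 2.
have d0 : 0 < d by rewrite divr_gt0.
have gap : 0 < (1 + del) ^+ 2 - (1 + d) ^+ 2 by rewrite /d; nra.
(* Large enough that [(1 + d) ^ 2 * (1 + 1 / q) <= (1 + del) ^ 2]: the loss from replacing [n] by
   the end of its block fits between [d] and [del]. *)
pose q := (Num.truncn ((1 + d) ^+ 2 / ((1 + del) ^+ 2 - (1 + d) ^+ 2))).+1.
have q0 : (0 < q)%N by [].
have qP : (1 + d) ^+ 2 * (q + 1)%:R <= (1 + del) ^+ 2 * q%:R.
  have := truncnS_gt ((1 + d) ^+ 2 / ((1 + del) ^+ 2 - (1 + d) ^+ 2)).
  by rewrite -/q ltr_pdivrMr// natrD; lra.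
pose T := (Num.truncn tau).+1.
have [eta eta0 UT] := upper_tail_scaled PN_power D p0 d0 C0.
(* The candidate values of [j n] on the dyadic range from [q 2 ^ r] to [2 q 2 ^ r]. The cap keeps
   the values that are not attained under the growth condition at the right end point. *)
pose J r i := minn (j (q * 2 ^ r) + i) (j (2 * (q * 2 ^ r))).
pose N r a := ((q + a + 1) * 2 ^ r)%N.
pose E a i r := \bigcup_m max_event (centered P (g (J r i) m)) (N r a) 0
  ((1 + d) * threshold p (J r i) (N r a)).
have mE a i r : measurable (E a i r).
  apply: bigcup_measurable => m _; apply: measurable_max_event.
  exact: measurable_centered.
have rq r : (r <= q * 2 ^ r)%N.
  by apply: (leq_trans (ltnW (ltn_expl r (isT : 1 < 2)%N))); rewrite leq_pmull.
have jJ r i : (j (q * 2 ^ r) <= J r i)%N.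
  by rewrite leq_min leq_addr j_nondecr// leq_pmull.
have D0 : 0 <= D by have := gD 0 0; rewrite big_nil.
have aeE a i : {ae PN, forall x, exists r1, forall r, (r1 <= r)%N -> ~ E a i r x}.
  have K0 : 0 <= 4 * (1 + d) ^+ 2 * (D / p).
    exact: mulr_ge0 (mulr_ge0 (ler0n R 4) (sqr_ge0 _)) (divr_ge0 D0 (ltW p0)).
  have [K' [r0 decay]] := decay_summable d0 K0 q0.
  have [n1 jA] := j_oo (3 / ln 2).
  (* Half of [eta], because the condition is used at [2 q 2 ^ r] while the block may end already
     near [q 2 ^ r]. *)
  have [n2 jS] := j_slow (divr_gt0 eta0 (ltr0n R 2)).
  apply: (borel_cantelli_square (K := K') (r0 := maxn r0 (maxn n1 n2))) => // r.
  rewrite !geq_max => /andP[r0r /andP[n1r n2r]].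
  have jr : 3 <= (J r i)%:R * ln 2 :> R.
    rewrite -ler_pdivrMr ?ln2_gt0//.
    apply: (le_trans (jA _ (leq_trans n1r (rq r)))).
    by rewrite ler_nat.
  apply: (le_trans (UT (fun m => g (J r i) m) (J r i) (N r a) _ jr _ _ _ _ _)) => //.
  - by rewrite muln_gt0 expn_gt0 addn1.
  - have N20 : (0 : R) < (2 * (q * 2 ^ r))%:R by rewrite ltr0n !muln_gt0 expn_gt0.
    have NN : (q * 2 ^ r <= N r a)%N by rewrite leq_mul2r -addnA leq_addr orbT.
    have N0 : (0 : R) < (N r a)%:R by rewrite ltr0n muln_gt0 expn_gt0 addn1.
    have := jS (2 * (q * 2 ^ r))%N (leq_trans n2r (leq_trans (rq r) (leq_pmull _ _))).
    move=> /(_ isT); rewrite !ler_pdivrMr// => h.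
    apply: (@le_trans _ _ ((j (2 * (q * 2 ^ r)))%:R * 2 ^+ j (2 * (q * 2 ^ r)))).
      apply: ler_pM; rewrite ?exprn_ge0// ?ler_nat ?geq_minr//.
      by rewrite ler_weXn2l ?ler1n// geq_minr.
    apply: (le_trans h); rewrite natrM mulrA divfK// ler_wpM2l ?(ltW eta0)//.
    by rewrite ler_nat.
  - by rewrite lee_fin decay// ler_wpM2r ?ler_nat// ltW ?ln2_gt0.
have : {ae PN, forall x, forall a i, exists r1, forall r, (r1 <= r)%N -> ~ E a i r x}.
  by apply: ae_foralln => a; apply: ae_foralln => i; exact: aeE.
apply: filterS => x xE.
(* Only finitely many pairs [(a, i)] occur, so one rank serves all: there are [q] blocks per dyadic
   range, and [j] grows by at most [tau] on it. *)
have [r1 xr1] : exists r1, forall a i, (a < q)%N -> (i < T.+1)%N ->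
    forall r, (r1 <= r)%N -> ~ E a i r x.
  have /choice[h hP] : forall ai : nat * nat, exists r1, forall r, (r1 <= r)%N ->
      ~ E ai.1 ai.2 r x by move=> [a i]; exact: xE.
  exists (\max_(a < q) \max_(i < T.+1) h (nat_of_ord a, nat_of_ord i)) => a i aq iT r hr.
  apply: (hP (a, i)); apply: leq_trans hr.
  apply: leq_trans (leq_bigmax (Ordinal aq)).
  exact: (@leq_bigmax _ (fun i : 'I_T.+1 => h (a, nat_of_ord i)) (Ordinal iT)).
exists (maxn q (maxn (2 * (q * 2 ^ r1)) (2 * (q * 2 ^ n0)))) => n.
rewrite !geq_max => /and3P[qn r1n n0n] m.
have [r [a [aq h1 h2 h3 h4]]] := block_decomposition q0 qn.
have rle k : (2 * (q * 2 ^ k) <= n)%N -> (k <= r)%N.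
  move=> /leq_trans /(_ h2); rewrite !leq_pmul2l// leq_exp2l//.
have r1r := rle _ r1n.
have n0r : (n0 <= q * 2 ^ r)%N by apply: leq_trans (rle _ n0n) (rq r).
have jn1 := j_nondecr h1. have jn2 := j_nondecr h2.
pose i := (j n - j (q * 2 ^ r))%N.
have iT : (i < T.+1)%N.
  rewrite ltnS -(ler_nat R) natrB//.
  apply: (@le_trans _ _ tau); last by rewrite ltW// truncnS_gt.
  apply: le_trans (j_doubling n0r); rewrite lerD2r ler_nat//.
have Ji : J r i = j n by rewrite /J /i subnKC//; apply/minn_idPl.
have nE : ~ E a i r x by exact: xr1.
apply: (@le_trans _ _ ((1 + d) * threshold p (j n) (N r a))).
  rewrite leNgt; apply/negP => lt; apply: nE; exists m => //.
  by rewrite Ji; exists n; rewrite // add0r ltW.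
apply: ler_threshold; rewrite ?(ltW p0)//; try by rewrite addr_ge0 ?ler01 ?ltW.
have qr0 : (0 : R) < q%:R by rewrite ltr0n.
rewrite -(ler_pM2r qr0) -mulrA -natrM.
have h4' : ((N r a * q)%:R : R) <= (n * (q + 1))%:R by rewrite ler_nat.
apply: le_trans (ler_wpM2l (sqr_ge0 _) h4') _.
rewrite natrM mulrCA mulrAC [leRHS]mulrC -[leRHS]mulrC mulrC -mulrA.
have n00 := ler0n R n.
by have := ler_wpM2r n00 qP; lra.
Qed.

End eventual_bounds.

(** * Almost sure lower bound near the maximum of the density *)

Section eventual_lower_bound.
Variable R : realType.
Local Notation mu := (@lebesgue_measure R).
Variables (phi : R -> R) (B : int) (L : nat) (C : R).
Hypothesis L0 : (0 < L)%N.
Hypothesis mphi : measurable_fun [set: measurableTypeR R] phi.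
Hypothesis phiC : forall x, `|phi x| <= C.
Hypothesis phi_supp : forall x, phi x != 0 -> B%:~R < x <= B%:~R + L%:R.
Hypothesis phi_orth : forall k l : int,
  \int[mu]_x (phi (x - k%:~R) * phi (x - l%:~R)) = (k == l)%:R.
Variables (P : probability (measurableTypeR R) R) (p0 : R -> R) (p : R).
Hypothesis p0_density : is_density p0 P.
Hypothesis p_gt0 : 0 < p.
Hypothesis p0_le : forall x, p0 x <= p.
Hypothesis p0_sup : forall e, 0 < e -> exists x, p - e < p0 x.
Hypothesis p0_cont : forall e, 0 < e -> exists2 d : R, 0 < d & forall x y,
  `|x - y| < d -> `|p0 x - p0 y| < e.
Variable PN : probability (seq_space R) R.
Hypothesis PN_power : is_power PN P.
Variables (j : nat -> nat).
Hypothesis j_oo : forall A : R, exists n1, forall n, (n1 <= n)%N -> A <= (j n)%:R.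
Hypothesis j_slow : forall eta : R, 0 < eta -> exists n1, forall n, (n1 <= n)%N ->
  (j n)%:R * 2 ^+ j n / n%:R <= eta.
Hypothesis j_fast : forall A : R, exists n1, forall n, (n1 <= n)%N ->
  A * ln (ln n%:R) <= (j n)%:R.
Variable u : 'I_L -> R.
Hypothesis u1 : \sum_i u i ^+ 2 = 1.

Let L2 : (0 : R) < (L + L)%:R. Proof. by rewrite ltr0n addn_gt0 L0. Qed.

(** By uniform continuity [p0 >= c] on a ball whose radius [d] does not depend on the scale.
    Magnified by [2 ^ i] it has length [2 d 2 ^ i], and intervals of length [2 L] placed side by
    side in it are the supports of the windows. *)
Lemma packed_windows (c : R) : c < p -> 0 <= c -> exists2 b : R, 0 < b &
  forall i, b^-1 <= i%:R -> exists (M : nat) (k : 'I_M -> int),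
  [/\ b * 2 ^+ i <= M%:R,
      forall m, c / 2 ^+ i <= \int[P]_x (scaled_window phi u i (k m) x ^+ 2) &
      forall a m m', m != m' ->
        scaled_window phi u i (k m) a = 0 \/ scaled_window phi u i (k m') a = 0].
Proof.
move=> cp c0; have e0 : 0 < (p - c) / 2 by rewrite divr_gt0 ?subr_gt0.
have [x0 x0P] := p0_sup e0.
have [d d0 dP] := p0_cont e0.
have Dc x : `|x - x0| < d -> c <= p0 x.
  by move=> /dP; rewrite ltr_norml => /andP[h _]; lra.
pose b := Num.min 1 (d / (4 * (L + L)%:R)).
have b0 : 0 < b by rewrite lt_min ltr01 divr_gt0// mulr_gt0.
exists b => // i bi.
pose t : R := 2 ^+ i.
have ti : (i%:R : R) <= t by rewrite /t -natrX ler_nat ltnW// ltn_expl.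
have t0 : 0 < t by rewrite exprn_gt0.
have bt : 1 <= b * t by rewrite -ler_pdivrMl// mulr1; apply: le_trans ti.
have b1 : b <= 1 by rewrite ge_min lexx.
have b2 : b * (4 * (L + L)%:R) <= d.
  by rewrite -ler_pdivlMr ?mulr_gt0// ge_min lexx orbT.
(* The subtracted 2 leaves room for rounding the left end of the magnified ball up to the integer
   [z]. *)
pose M := Num.truncn ((t * (2 * d) - 2) / (L + L)%:R).
have LL : (1 : R) <= (L + L)%:R by rewrite ler1n addn_gt0 L0.
have td : 4 * (L + L)%:R <= t * d.
  have := ler_wpM2l (ltW t0) b2.
  have l4 : 0 <= 4 * (L + L)%:R :> R by rewrite mulr_ge0.
  by have := ler_wpM2r l4 bt; lra.
have M1 : M%:R * (L + L)%:R <= t * (2 * d) - 2.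
  rewrite -ler_pdivlMr// truncn_le// divr_ge0//; lra.
have M2 : t * (2 * d) - 2 < (M%:R + 1) * (L + L)%:R.
  by rewrite natr1 -ltr_pdivrMr// truncnS_gt.
pose z := Num.ceil (t * (x0 - d)).
have /andP[z1 z2] := ceil_itv (t * (x0 - d)).
rewrite -/z in z1 z2.
pose k (m : 'I_M) : int := z - B + ((L + L) * m)%:Z.
have kE m : B%:~R + (k m)%:~R = z%:~R + (L + L)%:R * m%:R :> R.
  by rewrite /k intrD intrB -pmulrn natrM; ring.
exists M, k; split.
- rewrite -/t -(ler_pM2r L2).
  have : b * (4 * (L + L)%:R) * t <= d * t by rewrite ler_wpM2r// ltW.
  by lra.
- move=> m; apply: (@scaled_window_var_ge R phi B L C mphi phiC phi_supp
    phi_orth P p0 p0_density u u1 i (k m) c (ball x0 d)) => //.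
  + exact: measurable_ball.
  + by move=> x; rewrite -ball_normE /= distrC; exact: Dc.
  + move=> x /(scaled_window_supp phi_supp); rewrite kE -/t => /andP[w1 w2].
    have mM : (m%:R + 1) * (L + L)%:R <= M%:R * (L + L)%:R :> R.
      by rewrite ler_wpM2r ?(ltW L2)// natr1 ler_nat.
    have m0 : 0 <= (L + L)%:R * m%:R :> R by rewrite mulr_ge0.
    rewrite -ball_normE /= distrC ltr_norml; apply/andP; split.
      by rewrite -(ltr_pM2l t0); lra.
    by rewrite -(ltr_pM2l t0); lra.
- move=> a m m' mm'.
  have [->|h] := eqVneq (scaled_window phi u i (k m) a) 0; first by left.
  have [->|h'] := eqVneq (scaled_window phi u i (k m') a) 0; first by right.
  exfalso; move: (scaled_window_supp phi_supp h) (scaled_window_supp phi_supp h').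
  rewrite !kE => /andP[a1 a2] /andP[b1' b2'].
  move/eqP: mm'; apply; apply/ord_inj/eqP; rewrite eqn_leq.
  have e1 : (L + L)%:R * m%:R < (L + L)%:R * (m'%:R + 1) :> R by lra.
  have e2 : (L + L)%:R * m'%:R < (L + L)%:R * (m%:R + 1) :> R by lra.
  by move: e1 e2; rewrite !ltr_pM2l// !natr1 !ltr_nat !ltnS => -> ->.
Qed.

Lemma eventual_lower_bound (h : R) : 0 < h -> h <= 1 / 4 ->
  {ae PN, forall x : seq_space R, exists n1, forall n, (n1 <= n)%N -> exists k : int,
    (1 - 3 * h) * threshold p (j n) n <=
    \sum_(l < n) centered P (scaled_window phi u (j n) k) (x l)}.
Proof.
move=> h0 h4.
have h2 : 0 < h ^+ 2 by rewrite exprn_gt0.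
have h21 : h ^+ 2 <= 1 by rewrite exprn_ile1 ?(ltW h0)//; lra.
have C0 : 0 <= L%:R * C by rewrite mulr_ge0// (le_trans _ (phiC 0)).
have [eta eta0 LT] := lower_tail_scaled PN_power p_gt0 h0 h4 C0.
have cp : (1 - h ^+ 2 / 8) * p < p by rewrite gtr_pMl//; lra.
have c0 : 0 <= (1 - h ^+ 2 / 8) * p by rewrite mulr_ge0 ?(ltW p_gt0)//; lra.
have [b b0 pack] := packed_windows cp c0.
have ln20 := ln2_gt0 R.
have [n1 J1] := j_oo b^-1.
have [n2 J2] := j_oo (4 / (h ^+ 2 * ln 2)).
have [n3 J3] := j_slow eta0.
(* This gives [e ^ (h l) >= (ln n) ^ 2], and [n5] gives [ln n >= 6 / b]. Together
   [(b / 2) * e ^ (h l) >= 3 ln n], so the probability is at most [e * n * n ^ (- 3)]. *)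
have [n4 J4] := j_fast (2 / (h * ln 2)).
pose n5 := (Num.truncn (expR (6 / b : R))).+1.
pose nn := maxn n1 (maxn n2 (maxn n3 (maxn n4 n5))).
pose G n := [set x : seq_space R | exists k : int,
    (1 - 3 * h) * threshold p (j n) n <=
    \sum_(l < n) centered P (scaled_window phi u (j n) k) (x l)].
have EX n : exists E : set (seq_space R), [/\ measurable E,
   ~` E `<=` G n & ((nn <= n)%N -> (PN E <= (4 * expR 1 * n.+1%:R ^- 2)%:E)%E)].
  (* Below [nn] the exceptional event is the whole space, as no bound is asked there. The constant 4
     comes from [(n + 1) ^ 2 <= 4 n ^ 2]. *)
  case: (leqP nn n) => [nnn|_]; last by exists setT; split => //; rewrite setCT.
  move: (nnn); rewrite /nn !geq_max => /and5P[l1 l2 l3 l4 l5].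
  have [M [k [kM kv kd]]] := pack (j n) (J1 n l1).
  exists [set x : seq_space R | forall m,
      \sum_(l < n) centered P (scaled_window phi u (j n) (k m)) (x l) <
      (1 - 3 * h) * threshold p (j n) n]; split.
  - have bf m : bdd_meas (centered P (scaled_window phi u (j n) (k m))
        : measurableTypeR R -> R).
      apply: bdd_measB; last exact: bdd_meas_cst.
      exact: (bdd_meas_scaled_window mphi phiC phi_supp u1 (j n) (k m)).
    have := measurable_below_event ((1 - 3 * h) * threshold p (j n) n) bf n (fun=> 0).
    congr measurable; apply/seteqP; split => x /= H m; have := H m; by rewrite add0r.
  - move=> x /= /existsNP[m /negP]; rewrite -leNgt => H; by exists (k m).
  - move=> _.
    have n0 : (0 < n)%N by apply: leq_trans l5.
    have n0' : 0 < n%:R :> R by rewrite ltr0n.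
    have jl : 4 <= h ^+ 2 * ((j n)%:R * ln 2).
      have := J2 n l2; rewrite ler_pdivrMr ?mulr_gt0//; lra.
    have := LT M n (j n) (fun m => scaled_window phi u (j n) (k m)) n0 jl
      (fun m => measurable_scaled_window mphi phiC phi_supp u (j n) (k m))
      (fun m => scaled_window_le phiC u1 (j n) (k m)) kd.
    move=> /(_ _ _ (J3 n l3)) H; apply: (le_trans (H _ _)).
    + by move=> m; rewrite mulrA; exact: kv.
    + move=> m; exact: (scaled_window_var_le mphi phiC phi_supp phi_orth
        p0_density (ltW p_gt0) p0_le u1 (j n) (k m)).
    rewrite lee_fin.
    set l := (j n)%:R * ln 2.
    have lnn : 6 / b <= ln n%:R.
      rewrite -[leLHS]expRK ler_ln ?posrE ?expR_gt0//.
      by apply: ltW; apply: lt_le_trans (truncnS_gt _) _; rewrite ler_nat.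
    have lnn0 : 0 < ln n%:R :> R by apply: lt_le_trans lnn; rewrite divr_gt0.
    have hl : 2 * ln (ln n%:R) <= h * l.
      have := J4 n l4; set y := ln (ln _) => jy.
      have : 2 / (h * ln 2) * y * (h * ln 2) <= (j n)%:R * (h * ln 2).
        by rewrite ler_wpM2r// mulr_ge0 ?(ltW h0) ?(ltW ln20).
      have -> : 2 / (h * ln 2) * y * (h * ln 2) = 2 * y.
        by field; rewrite !gt_eqF.
      by rewrite /l; lra.
    have ehl : ln n%:R ^+ 2 <= expR (h * l).
      apply: (@le_trans _ _ (expR (2 * ln (ln n%:R)))); last by rewrite ler_expR.
      by rewrite expRM_natl lnK ?posrE.
    have Mh : 3 * ln n%:R <= M%:R / 2 * expR (- ((1 - h) * l)).
      apply: (@le_trans _ _ (b * 2 ^+ j n / 2 * expR (- ((1 - h) * l)))).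
        have -> : b * 2 ^+ j n / 2 * expR (- ((1 - h) * l)) = b / 2 * expR (h * l).
          rewrite -(expR_ln2 R) -/l (_ : h * l = l + - ((1 - h) * l)); last by ring.
          by rewrite expRD; ring.
        have bb : 0 <= b / 2 by rewrite divr_ge0// ltW.
        apply: le_trans (ler_wpM2l bb ehl).
        rewrite ler_pdivrMr// in lnn.
        by have := ler_wpM2l (ltW lnn0) lnn; lra.
      by rewrite ler_wpM2r ?expR_ge0// ler_wpM2r// invr_ge0.
    have e1 := expR_gt0 (1 : R).
    apply: (@le_trans _ _ (expR 1 * n%:R * n%:R ^- 3)).
      rewrite ler_wpM2l ?mulr_ge0 ?(ltW e1)//.
      apply: (@le_trans _ _ (expR (- (3 * ln n%:R)))); first by rewrite ler_expR lerN2.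
      by rewrite expRN expRM_natl lnK ?posrE.
    have -> : expR 1 * n%:R * n%:R ^- 3 = expR 1 * n%:R ^- 2 :> R.
      by field; rewrite gt_eqF.
    rewrite [4 * _]mulrC -mulrA ler_wpM2l ?(ltW e1)//.
    rewrite ler_pdivlMr ?exprn_gt0// mulrC ler_pdivrMr ?exprn_gt0//.
    have -> : 4 * n%:R ^+ 2 = (2 * n%:R) ^+ 2 :> R by ring.
    rewrite lerXn2r ?nnegrE ?mulr_ge0// -natrM ler_nat mul2n -addnn.
    by rewrite -addn1 leq_add2l.
have /choice[E EP] := EX.
have := @borel_cantelli_square _ _ _ PN E (4 * expR 1) nn
  (fun n => let: And3 a _ _ := EP n in a) (fun n => let: And3 _ _ c := EP n in c).
apply: filterS => x [n6 H]; exists n6 => n /H nE.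
by have [_ + _] := EP n; apply.
Qed.

End eventual_lower_bound.

(** * The wavelet estimator *)

Section wavelet_deviation.
Variable R : realType.
Local Notation mu := (@lebesgue_measure R).
Variables (phi : R -> R) (B : int) (L : nat) (C : R).
Hypothesis L0 : (0 < L)%N.
Hypothesis mphi : measurable_fun [set: measurableTypeR R] phi.
Hypothesis phiC : forall x, `|phi x| <= C.
Hypothesis phi_supp : forall x, phi x != 0 -> B%:~R < x <= B%:~R + L%:R.
Variables (P : probability (measurableTypeR R) R).
Variable PN : probability (seq_space R) R.
Hypothesis PN_power : is_power PN P.

Local Notation uv := (unit_value phi B L).
Local Notation beta := (B + L%:Z - 1).

Let bphi i k : bdd_meas ((fun a => phi (2 ^+ i * a - k%:~R)) : measurableTypeR R -> R).
Proof.
split; last by exists C => a.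
have -> : (fun a => phi (2 ^+ i * a - k%:~R)) = phi \o (fun a => 2 ^+ i * a + (- k%:~R)).
  by [].
exact: measurableT_comp mphi (measurable_affine _ _).
Qed.

Definition translate_sum (i n : nat) (x : seq_space R) (k : int) :=
  \sum_(l < n) centered P (fun a => phi (2 ^+ i * a - k%:~R)) (x l).

Lemma sum_centered_scaled_window (u : 'I_L -> R) i n (x : seq_space R) k :
  \sum_(l < n) centered P (scaled_window phi u i k) (x l) =
  \sum_(m < L) u m * translate_sum i n x (k + m%:Z).
Proof.
have wE a : scaled_window phi u i k a =
    \sum_(m < L) u m * phi (2 ^+ i * a - (k + m%:Z)%:~R).
  by apply: eq_bigr => m _; congr (_ * phi _); rewrite intrD -pmulrn; ring.
have cE a : centered P (scaled_window phi u i k) a =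
    \sum_(m < L) u m * centered P (fun a => phi (2 ^+ i * a - (k + m%:Z)%:~R)) a.
  rewrite /centered wE.
  have -> : \int[P]_b scaled_window phi u i k b =
      \sum_(m < L) u m * \int[P]_b phi (2 ^+ i * b - (k + m%:Z)%:~R).
    under eq_Rintegral do rewrite wE.
    rewrite (@expect_sum _ (measurableTypeR R)).
      by apply: eq_bigr => m _; rewrite (expectZ _ _ (bphi _ _)).
    by move=> m; apply: bdd_measZ; exact: bphi.
  by rewrite -sumrB; apply: eq_bigr => m _; rewrite mulrBr.
under eq_bigr do rewrite cE.
by rewrite exchange_big/=; apply: eq_bigr => m _; rewrite mulr_sumr.
Qed.

Section representation.
Variables (y th : R) (m : int).
Hypothesis th01 : 0 < th <= 1.
Hypothesis yE : y = m%:~R + th.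

Let valE (i : 'I_L) : phi (y - (m - beta + i%:Z)%:~R) = uv i th.
Proof.
by rewrite /unit_value yE; congr phi; rewrite !intrD !mulrNz !intrD -!pmulrn; ring.
Qed.

Lemma wavelet_kernel_window (z : R) : wavelet_kernel phi y z =
  \sum_(i < L) uv i th * phi (z - (m - beta + i%:Z)%:~R).
Proof.
rewrite /wavelet_kernel (@zsum_window _ _ (m - beta) L).
  by apply: eq_bigr => i _; rewrite valE.
move=> k; rewrite mulf_eq0 negb_or yE => /andP[+ _].
exact: (window_nonzero phi_supp th01).
Qed.

Lemma wavelet_norm_window :
  zsum (fun k : int => phi (y - k%:~R) ^+ 2) = \sum_(i < L) uv i th ^+ 2.
Proof.
rewrite (@zsum_window _ _ (m - beta) L).
  by apply: eq_bigr => i _; rewrite valE.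
move=> k; rewrite expf_eq0/= yE.
exact: (window_nonzero phi_supp th01).
Qed.

End representation.

Lemma wavelet_estimator_centered (j : nat -> nat) n (x : seq_space R)
    (y th : R) (m : int) : 0 < th <= 1 -> 2 ^+ j n * y = m%:~R + th ->
  wavelet_estimator phi j n x y
    - fine 'E_PN[fun x' => wavelet_estimator phi j n x' y] =
  2 ^+ j n / n%:R *
    \sum_(i < L) uv i th * translate_sum (j n) n x (m - beta + i%:Z).
Proof.
move=> th01 yE; rewrite -sum_centered_scaled_window.
pose g := scaled_window phi (fun i : 'I_L => uv i th) (j n) (m - beta).
have bg : bdd_meas (g : measurableTypeR R -> R).
  have -> : g = fun a => \sum_(i < L) uv i th * phi (2 ^+ j n * a - (m - beta + i%:Z)%:~R).
    apply/funext => a; apply: eq_bigr => i _; congr (_ * phi _).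
    by rewrite [(m - beta + i%:Z)%:~R]intrD -pmulrn; ring.
  by apply: bdd_meas_sum => i; apply: bdd_measZ; exact: bphi.
have E x' : wavelet_estimator phi j n x' y =
    2 ^+ j n / n%:R * \sum_(l < n) g (x' l).
  rewrite /wavelet_estimator mulr_sumr [RHS]mulr_sumr; apply: eq_bigr => l _.
  rewrite (wavelet_kernel_window th01 yE) mulrA [n%:R^-1 * _]mulrC; congr (_ * _).
  apply: eq_bigr => i _; congr (_ * phi _).
  by rewrite [(m - beta + i%:Z)%:~R]intrD -pmulrn; ring.
have -> : fine 'E_PN[fun x' => wavelet_estimator phi j n x' y] =
    2 ^+ j n / n%:R * \sum_(l < n) \int[P]_a g a.
  rewrite unlock -/(Rintegral _ _ _); under eq_Rintegral do rewrite E.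
  have bc l := bdd_meas_coord l bg.
  rewrite expectZ; last by apply: bdd_meas_sum => l; exact: bc.
  congr (_ * _); rewrite expect_sum; last by move=> l; exact: bc.
  by apply: eq_bigr => l _; exact: expect_coord.
by rewrite E -mulrBr -sumrB.
Qed.

End wavelet_deviation.

(** * From finitely many phases to all *)

Section grid_approximation.
Variable R : realType.
Variables (phi : R -> R) (B : int) (L : nat) (C : R).
Hypothesis phiC : forall x, `|phi x| <= C.
Hypothesis phi_unif : forall e, 0 < e -> exists2 d : R, 0 < d & forall x y,
  B%:~R < x <= B%:~R + L%:R -> B%:~R < y <= B%:~R + L%:R ->
  `|x - y| < d -> `|phi x - phi y| < e.
Local Notation uv := (unit_value phi B L).

Definition unit_norm (th : R) := Num.sqrt (\sum_(i < L) uv i th ^+ 2).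

Variable kap : R.
Hypothesis kap0 : 0 < kap.
Hypothesis kapP : forall th, 0 < th <= 1 -> kap <= \sum_(i < L) uv i th ^+ 2.

Lemma unit_norm_gt0 th : 0 < th <= 1 -> 0 < unit_norm th.
Proof. by move=> /kapP h; rewrite sqrtr_gt0 (lt_le_trans kap0). Qed.

Lemma unit_norm_sqr th : unit_norm th ^+ 2 = \sum_(i < L) uv i th ^+ 2.
Proof. by rewrite sqr_sqrtr// sumr_ge0// => i _; exact: sqr_ge0. Qed.

Lemma normalized_unit_norm th : 0 < th <= 1 ->
  \sum_(i < L) (uv i th / unit_norm th) ^+ 2 = 1.
Proof.
move=> /unit_norm_gt0 h; under eq_bigr do rewrite expr_div_n.
by rewrite -mulr_suml unit_norm_sqr divff// -unit_norm_sqr gt_eqF// exprn_gt0.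
Qed.

Definition grid_point (G g : nat) : R := g.+1%:R / G%:R.

Lemma grid_point_mem G g : (g < G)%N -> 0 < grid_point G g <= 1.
Proof.
move=> gG; have G0 : (0 : R) < G%:R by rewrite ltr0n (leq_trans _ gG).
apply/andP; split; first by rewrite divr_gt0// ltr0n.
by rewrite /grid_point ler_pdivrMr// mul1r ler_nat.
Qed.

Lemma grid_approximation (del : R) : 0 < del -> exists G : nat,
  forall (Z : int -> R) (t : R), (forall k, `|Z k| <= t) ->
  (forall g, (g < G)%N -> forall k, `|\sum_(i < L) uv i (grid_point G g) /
      unit_norm (grid_point G g) * Z (k + i%:Z)| <= t) ->
  forall th k, 0 < th <= 1 ->
    `|\sum_(i < L) uv i th * Z (k + i%:Z)| <= (1 + del) * t * unit_norm th.
Proof.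
move=> del0.
have C0 : 0 <= C by apply: le_trans (phiC 0).
have sk0 : 0 < Num.sqrt kap by rewrite sqrtr_gt0.
have L0 := ler0n R L.
have LC0 : 0 <= L%:R * C by rewrite mulr_ge0.
(* The first bound controls the change of the squared norm, which is at least [kap]; the second
   controls the sum of the coefficient differences. The added 1 keeps the denominators positive. *)
pose e := Num.min (del * kap / (2 * (L%:R * C) + 1)) (del * Num.sqrt kap / (2 * L%:R + 1)).
have e0 : 0 < e.
  by rewrite lt_min !divr_gt0 ?mulr_gt0//; lra.
have e1 : 2 * (L%:R * C) * e <= del * kap.
  have : e <= del * kap / (2 * (L%:R * C) + 1) by rewrite ge_min lexx.
  by rewrite ler_pdivlMr; lra.
have e2 : L%:R * e <= del / 2 * Num.sqrt kap.
  have : e <= del * Num.sqrt kap / (2 * L%:R + 1) by rewrite ge_min lexx orbT.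
  by rewrite ler_pdivlMr; lra.
have [d d0 ud] := phi_unif e0.
pose G := (Num.truncn d^-1).+1.
have G0 : (0 : R) < G%:R by rewrite ltr0n.
have Gd : G%:R^-1 < d.
  by rewrite -[ltRHS]invrK ltf_pV2 ?posrE ?invr_gt0// truncnS_gt.
exists G => Z t Zt Zg th k th01; have [th0 th1] := andP th01.
have t0 : 0 <= t by apply: le_trans (Zt 0).
have [g gG [g1 g2]] : exists2 g, (g < G)%N & g%:R < th * G%:R /\ th * G%:R <= g.+1%:R.
  have thG : 0 < th * G%:R by rewrite mulr_gt0.
  have thG1 : th * G%:R <= G%:R by rewrite ler_piMl// ltW.
  have [[g|g] /andP[g1 g2]] := unit_part (th * G%:R).
    rewrite -pmulrn in g1 g2; exists g; first by rewrite -(ltr_nat R); lra.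
    by split; [lra|rewrite -[g.+1%:R]natr1; lra].
  by move: g2; rewrite NegzE intrN -pmulrn -[g.+1%:R]natr1; have := ler0n R g; lra.
set s := grid_point G g.
have s01 : 0 < s <= 1 by exact: grid_point_mem.
have ths : `|th - s| < d.
  rewrite distrC ger0_norm; last by rewrite subr_ge0 ler_pdivlMr.
  apply: lt_trans Gd; rewrite ltrBlDr -(ltr_pM2r G0) mulrDl mulVf ?gt_eqF//.
  by rewrite /s /grid_point divfK ?gt_eqF// -[g.+1%:R]natr1; lra.
have uvs (i : 'I_L) : `|uv i th - uv i s| <= e.
  apply/ltW/ud; try exact: unit_value_mem.
  by rewrite (_ : _ - _ = th - s)//; ring.
set T := \sum_(i < L) uv i th ^+ 2.
have Tk : kap <= T by exact: kapP.
have Ns : unit_norm s <= (1 + del / 2) * unit_norm th.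
  rewrite -(ler_pXn2r (n := 2)) ?nnegrE ?mulr_ge0 ?sqrtr_ge0//; last by lra.
  rewrite exprMn !unit_norm_sqr -/T.
  have : \sum_(i < L) uv i s ^+ 2 - T <= \sum_(i < L) (e * (2 * C)).
    rewrite -sumrB; apply: ler_sum => i _; rewrite subr_sqr.
    apply: le_trans (ler_norm _) _; rewrite normrM ler_pM//.
      by rewrite distrC uvs.
    by apply: le_trans (ler_normD _ _) _; rewrite mulr_natl mulr2n lerD// phiC.
  rewrite sumr_const card_ord -mulr_natl => h.
  have : del * kap <= del * T by rewrite ler_wpM2l// ltW.
  have T0 : 0 < T by apply: lt_le_trans Tk.
  have : 0 <= (del / 2) ^+ 2 * T by rewrite mulr_ge0 ?sqr_ge0// ltW.
  lra.
have Nk : Num.sqrt kap <= unit_norm th by rewrite ler_sqrt ?(le_trans (ltW kap0)).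
have -> : \sum_(i < L) uv i th * Z (k + i%:Z) =
    unit_norm s * (\sum_(i < L) uv i s / unit_norm s * Z (k + i%:Z)) +
    \sum_(i < L) (uv i th - uv i s) * Z (k + i%:Z).
  rewrite mulr_sumr -big_split/=; apply: eq_bigr => i _.
  by field; rewrite gt_eqF ?unit_norm_gt0.
apply: le_trans (ler_normD _ _) _.
apply: (@le_trans _ _ ((1 + del / 2) * unit_norm th * t + del / 2 * Num.sqrt kap * t)).
  apply: lerD.
    rewrite normrM ger0_norm ?sqrtr_ge0// ler_pM ?sqrtr_ge0//.
    exact: Zg.
  apply: le_trans (ler_norm_sum _ _ _) _.
  apply: (@le_trans _ _ (\sum_(i < L) (e * t))).
    by apply: ler_sum => i _; rewrite normrM ler_pM.
  by rewrite sumr_const card_ord -[_ *+ L]mulr_natl mulrA ler_wpM2r.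
have : del / 2 * t * Num.sqrt kap <= del / 2 * t * unit_norm th.
  by rewrite ler_wpM2l// mulr_ge0// divr_ge0// ltW.
lra.
Qed.

End grid_approximation.

Section uniform_deviation.
Variable R : realType.
Local Notation mu := (@lebesgue_measure R).
Variables (phi : R -> R) (B : int) (L : nat) (C : R).
Hypothesis L0 : (0 < L)%N.
Hypothesis mphi : measurable_fun [set: measurableTypeR R] phi.
Hypothesis phiC : forall x, `|phi x| <= C.
Hypothesis phi_supp : forall x, phi x != 0 -> B%:~R < x <= B%:~R + L%:R.
Hypothesis phi_orth : forall k l : int,
  \int[mu]_x (phi (x - k%:~R) * phi (x - l%:~R)) = (k == l)%:R.
Hypothesis phi_unif : forall e, 0 < e -> exists2 d : R, 0 < d & forall x y,
  B%:~R < x <= B%:~R + L%:R -> B%:~R < y <= B%:~R + L%:R ->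
  `|x - y| < d -> `|phi x - phi y| < e.
Variable kap : R.
Hypothesis kap0 : 0 < kap.
Local Notation uv := (unit_value phi B L).
Hypothesis kapP : forall th, 0 < th <= 1 -> kap <= \sum_(i < L) uv i th ^+ 2.
Variables (P : probability (measurableTypeR R) R) (p0 : R -> R) (p : R).
Hypothesis p0_density : is_density p0 P.
Hypothesis p_gt0 : 0 < p.
Hypothesis p0_le : forall x, p0 x <= p.
Variable PN : probability (seq_space R) R.
Hypothesis PN_power : is_power PN P.
Variables (j : nat -> nat) (tau : R) (n0 : nat).
Hypothesis j_nondecr : {homo j : m n / (m <= n)%N}.
Hypothesis j_oo : forall A : R, exists n1, forall n, (n1 <= n)%N -> A <= (j n)%:R.
Hypothesis j_slow : forall eta : R, 0 < eta -> exists n1, forall n, (n1 <= n)%N ->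
  (j n)%:R * 2 ^+ j n / n%:R <= eta.
Hypothesis j_fast : forall A : R, exists n1, forall n, (n1 <= n)%N ->
  A * ln (ln n%:R) <= (j n)%:R.
Hypothesis j_doubling : forall n, (n0 <= n)%N -> (j (2 * n)%N)%:R - (j n)%:R <= tau.

(** The opposite sign is obtained by applying the one-sided bound to [- u], which is again a unit
    vector. *)
Lemma eventual_two_sided_bound (u : 'I_L -> R) (del : R) : \sum_i u i ^+ 2 = 1 ->
  0 < del ->
  {ae PN, forall x : seq_space R, exists n1, forall n, (n1 <= n)%N -> forall k : int,
    `|\sum_(i < L) u i * translate_sum phi P (j n) n x (k + i%:Z)|
      <= (1 + del) * threshold p (j n) n}.
Proof.
move=> u1 del0; have C0 : 0 <= L%:R * C by rewrite mulr_ge0// (le_trans _ (phiC 0)).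
have one_sided (v : 'I_L -> R) : \sum_i v i ^+ 2 = 1 ->
  {ae PN, forall x : seq_space R, exists n1, forall n, (n1 <= n)%N -> forall k : int,
    \sum_(i < L) v i * translate_sum phi P (j n) n x (k + i%:Z)
      <= (1 + del) * threshold p (j n) n}.
  move=> v1.
  have := eventual_upper_bound PN_power j_nondecr j_oo j_slow j_fast j_doubling
    p_gt0 C0 (measurable_window_family mphi phiC phi_supp v)
    (window_family_le phiC v1)
    (window_family_var_le mphi phiC phi_supp phi_orth p0_density (ltW p_gt0) p0_le v1)
    (window_family_var_sum mphi phiC phi_supp P v1) del0.
  apply: filterS => x [n1 H]; exists n1 => n nn k.
  rewrite -(sum_centered_scaled_window mphi phiC).
  have := H n nn (choice.pickle k).
  by rewrite /window_family pickleK_inv.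
have u1' : \sum_i (- u i) ^+ 2 = 1 by under eq_bigr do rewrite sqrrN.
apply: filterS2 (one_sided _ u1) (one_sided _ u1') => x [n1 H1] [n2 H2].
exists (maxn n1 n2) => n; rewrite geq_max => /andP[nn1 nn2] k.
rewrite ler_norml H1// andbT lerNl.
apply: le_trans (H2 n nn2 k); rewrite -sumrN le_eqVlt; apply/orP; left; apply/eqP.
by apply: eq_bigr => i _; rewrite mulNr.
Qed.

Lemma eventual_uniform_bound (del : R) : 0 < del ->
  {ae PN, forall x : seq_space R, exists n1, forall n, (n1 <= n)%N ->
    forall th (k : int), 0 < th <= 1 ->
    `|\sum_(i < L) uv i th * translate_sum phi P (j n) n x (k + i%:Z)|
      <= (1 + del) ^+ 2 * threshold p (j n) n * unit_norm phi B L th}.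
Proof.
move=> del0.
have [G GP] := grid_approximation phiC phi_unif kap0 kapP del0.
(* For a coordinate vector the two-sided bound controls each single [translate_sum], the crude bound
   that [grid_approximation] asks for. *)
pose e0 (i : 'I_L) : R := (i == Ordinal L0)%:R.
have e01 : \sum_i e0 i ^+ 2 = 1.
  rewrite (bigD1 (Ordinal L0))//= big1 => [|i i0].
    by rewrite /e0 eqxx expr1n addr0.
  by rewrite /e0 (negbTE i0) expr0n.
have ae0 := eventual_two_sided_bound e01 del0.
have aeg : {ae PN, forall x : seq_space R, forall g, (g < G)%N ->
   exists n1, forall n, (n1 <= n)%N -> forall k : int,
   `|\sum_(i < L) uv i (grid_point R G g) / unit_norm phi B L (grid_point R G g)
       * translate_sum phi P (j n) n x (k + i%:Z)| <= (1 + del) * threshold p (j n) n}.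
  apply: ae_foralln => g; have [gG|Gg] := ltnP g G; last first.
    by apply: aeW.
  have := eventual_two_sided_bound
    (normalized_unit_norm kap0 kapP (grid_point_mem R gG)) del0.
  by apply: filterS => x Hx _.
apply: filterS2 ae0 aeg => x [n1 H1] H2.
have [n2 H3] : exists n2, forall g, (g < G)%N -> forall n, (n2 <= n)%N -> forall k : int,
   `|\sum_(i < L) uv i (grid_point R G g) / unit_norm phi B L (grid_point R G g)
       * translate_sum phi P (j n) n x (k + i%:Z)| <= (1 + del) * threshold p (j n) n.
  have /choice[h hP] : forall g, exists n1, (g < G)%N ->
      forall n, (n1 <= n)%N -> forall k : int,
   `|\sum_(i < L) uv i (grid_point R G g) / unit_norm phi B L (grid_point R G g)
       * translate_sum phi P (j n) n x (k + i%:Z)| <= (1 + del) * threshold p (j n) n.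
    move=> g; have [gG|_] := ltnP g G; last by exists 0%N.
    by have [n3 Hn] := H2 g gG; exists n3.
  exists (\max_(g < G) h g) => g gG n hn; apply: (hP g gG).
  exact: leq_trans (leq_bigmax (Ordinal gG)) hn.
exists (maxn n1 n2) => n; rewrite geq_max => /andP[nn1 nn2] th k th01.
rewrite expr2 -[(1 + del) * _ * _]mulrA; apply: GP => //.
  move=> k'; have := H1 n nn1 k'.
  rewrite (bigD1 (Ordinal L0))//= big1 => [|i i0].
    by rewrite /e0 eqxx mul1r !addr0.
  by rewrite /e0 (negbTE i0) mul0r.
by move=> g gG k'; apply: H3.
Qed.

End uniform_deviation.

(** * Passage to the limit *)

Section limits.
Variable R : realType.

(** [2 ^ i / n] is the factor in front of the centered sums in the estimator, so the normalization
    of the theorem carries the threshold exactly to [sqrt p]. *)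
Lemma threshold_scale (p : R) (i n : nat) : 0 <= p -> (0 < n)%N -> (0 < i)%N ->
  Num.sqrt (n%:R / (2 * ln 2 * i%:R * 2 ^+ i)) * (2 ^+ i / n%:R * threshold p i n)
  = Num.sqrt p.
Proof.
move=> p0 n0 i0.
have n0' : 0 < n%:R :> R by rewrite ltr0n.
have i0' : 0 < i%:R :> R by rewrite ltr0n.
have ti : 0 < 2 ^+ i :> R by rewrite exprn_gt0.
have ln20 := ln2_gt0 R.
have A0 : 0 <= n%:R / (2 * ln 2 * i%:R * 2 ^+ i) :> R.
  by rewrite divr_ge0 ?(ltW n0')// !mulr_ge0// ltW.
have X0 : 0 <= 2 * (i%:R * ln 2) * (n%:R / 2 ^+ i * p).
  by rewrite !mulr_ge0 ?invr_ge0// ltW.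
have t0 : 0 <= 2 ^+ i / n%:R :> R by rewrite divr_ge0// ltW.
rewrite /threshold -[2 ^+ i / n%:R]ger0_norm// -sqrtr_sqr -!sqrtrM ?sqr_ge0//.
congr Num.sqrt; field.
by rewrite !gt_eqF.
Qed.

(** The errors are indexed by naturals so that countably many almost sure statements can be
    intersected. [i.+4] matches the condition [h <= 1 / 4] of the lower bound, and
    [(1 + a) ^ 2 <= 1 + 3 a] for [a <= 1] puts both sides within [3 a s]. *)
Lemma cvg_between (F : nat -> \bar R) (s : R) : 0 <= s ->
  (forall i : nat, exists n1, forall n, (n1 <= n)%N ->
    (((1 - 3 * i.+4%:R^-1) * s)%:E <= F n)%E) ->
  (forall i : nat, exists n1, forall n, (n1 <= n)%N ->
    (F n <= ((1 + i.+1%:R^-1) ^+ 2 * s)%:E)%E) ->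
  F n @[n --> \oo] --> s%:E.
Proof.
move=> s0 lo hi.
have fin i : exists n1, forall n, (n1 <= n)%N -> exists v : R, [/\ F n = v%:E,
    (1 - 3 * i.+4%:R^-1) * s <= v & v <= (1 + i.+1%:R^-1) ^+ 2 * s].
  have [n1 H1] := lo i; have [n2 H2] := hi i.
  exists (maxn n1 n2) => n; rewrite geq_max => /andP[/H1 + /H2].
  by case: (F n) => // v; rewrite !lee_fin => h1 h2; exists v.
apply/fine_cvgP; split.
  have [n1 H] := fin 0%N; exists n1 => // n /= /H [v [-> _ _]] //.
apply/cvgrPdist_lt => e e0.
pose i := Num.truncn (3 * s / e).
have iP : 3 * s / i.+1%:R < e.
  by rewrite ltr_pdivrMr ?ltr0n// [e * _]mulrC -ltr_pdivrMr// truncnS_gt.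
have [n1 H] := fin i; exists n1 => // n /= /H [v [-> h1 h2]] /=.
apply: le_lt_trans iP; rewrite ler_norml.
set a := i.+1%:R^-1 in h2 *.
have a0 : 0 < a by rewrite invr_gt0 ltr0n.
have a1 : a <= 1 by rewrite invf_le1 ?ltr0n// ler1n.
have b1 : i.+4%:R^-1 <= a by rewrite lef_pV2 ?posrE ?ltr0n// ler_nat -addn3 leq_addr.
have as0 : 0 <= a * s by rewrite mulr_ge0// ltW.
have aas : a * (a * s) <= a * s by rewrite ler_piMl.
have bas : i.+4%:R^-1 * s <= a * s by rewrite ler_wpM2r.
set b := i.+4%:R^-1 in h1 b1 bas; clearbody a b.
have -> : 3 * s * a = 3 * (a * s) by ring.
move: h1 h2; rewrite mulrBl mul1r -mulrA => h1.
have -> : (1 + a) ^+ 2 * s = s + 2 * (a * s) + a * (a * s) by ring.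
by move=> h2; apply/andP; split; lra.
Qed.

Lemma cvgn_pinfty_ge (f : nat -> R) : f n @[n --> \oo] --> +oo ->
  forall A : R, exists n1, forall n, (n1 <= n)%N -> A <= f n.
Proof.
move=> /cvgryPge foo A; have [n1 _ H] := foo A.
by exists n1 => n nn; exact: H.
Qed.

Lemma cvgn_nat_ge (j : nat -> nat) : j n @[n --> \oo] --> \oo ->
  forall A : R, exists n1, forall n, (n1 <= n)%N -> A <= (j n)%:R.
Proof.
move=> joo A.
have [n1 _ H] := joo _ (nbhs_infty_ge (Num.truncn A).+1).
exists n1 => n nn; apply: ltW; apply: lt_le_trans (truncnS_gt A) _.
by rewrite ler_nat; exact: H.
Qed.

Lemma slow_growth (j : nat -> nat) :
  (n%:R / ((j n)%:R * 2 ^+ j n) : R) @[n --> \oo] --> +oo ->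
  forall eta : R, 0 < eta -> exists n1, forall n, (n1 <= n)%N ->
    (j n)%:R * 2 ^+ j n / n%:R <= eta.
Proof.
move=> /cvgn_pinfty_ge joo eta eta0.
have [n1 H] := joo eta^-1; exists n1 => n nn.
have h := H n nn; have i0 : 0 < eta^-1 by rewrite invr_gt0.
(* Being positive, the quotient is not the default value 0 of a division by zero, so it can be
   inverted. *)
have x0 := lt_le_trans i0 h.
by move: h; rewrite -[leRHS]invrK lef_pV2 ?posrE ?invr_gt0// invf_div.
Qed.

Lemma fast_growth (j : nat -> nat) :
  ((j n)%:R / ln (ln n%:R) : R) @[n --> \oo] --> +oo ->
  forall A : R, exists n1, forall n, (n1 <= n)%N -> A * ln (ln n%:R) <= (j n)%:R.
Proof.
move=> /cvgn_pinfty_ge joo A; have [n1 H] := joo A.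
(* Beyond [e ^ e] one has [ln n > 1], so [ln (ln n)] is positive and the division can be cleared. *)
pose n2 := (Num.truncn (expR (expR 1) : R)).+1.
exists (maxn n1 n2) => n; rewrite geq_max => /andP[nn1 nn2].
have := H n nn1; rewrite ler_pdivlMr// ln_gt0//.
have e1 : 1 < expR 1 :> R by rewrite expR_gt1.
apply: lt_le_trans e1 _.
rewrite -[leLHS]expRK ler_ln ?posrE ?expR_gt0//; last first.
  by rewrite ltr0n (leq_trans _ nn2).
apply: ltW; apply: lt_le_trans (truncnS_gt _) _.
by rewrite ler_nat.
Qed.

End limits.

Section bounded_density.
Variable R : realType.
Variables (P : probability (measurableTypeR R) R) (p0 : R -> R).
Hypothesis p0_density : is_density p0 P.
Hypothesis p0_bounded : bounded_fun p0.

Let has_sup_p0 : has_sup (range p0).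
Proof.
split; first by exists (p0 0), 0.
have [M [_ HM]] := p0_bounded.
exists (M + 1) => _ [x _ <-].
by apply: le_trans (ler_norm _) _; apply: (HM (M + 1)) => //; rewrite ltrDl.
Qed.

Lemma density_le_sup x : p0 x <= sup (range p0).
Proof. by apply: sup_upper_bound => //; exists x. Qed.

Lemma density_near_sup e : 0 < e -> exists x, sup (range p0) - e < p0 x.
Proof.
move=> e0; have [_ [x _ <-] h] := sup_adherent e0 has_sup_p0.
by exists x.
Qed.

Lemma density_sup_gt0 : 0 < sup (range p0).
Proof.
have [_ p00 PE] := p0_density.
rewrite ltNge; apply/negP => s0.
have p0E x : p0 x = 0.
  by apply/eqP; rewrite eq_le p00 (le_trans (density_le_sup x)).
have := PE setT measurableT; rewrite [LHS](probability_setT P).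
under eq_integral do rewrite p0E.
by rewrite integral0 => /eqP; rewrite onee_eq0.
Qed.

Lemma sup_norm_density : sup_norm p0 = (sup (range p0))%:E.
Proof.
have [_ p00 _] := p0_density.
apply/eqP; rewrite eq_le; apply/andP; split.
  apply: ge_ereal_sup => _ [x _ <-].
  by rewrite lee_fin ger0_norm// density_le_sup.
apply/lee_addgt0Pr => e e0; have [x hx] := density_near_sup e0.
apply: (@le_trans _ _ ((p0 x)%:E + e%:E)%E).
  by rewrite -EFinD lee_fin; lra.
rewrite leeD2r//; apply: ereal_sup_ubound; exists x => //.
by rewrite ger0_norm.
Qed.

End bounded_density.

Theorem theorem2 (R : realType)
  (phi : R -> R) (p : R) (B1 B2 : int)
  (P : probability (measurableTypeR R) R)
  (PN : probability (seq_space R) R)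
  (p0 : R -> R)
  (j : nat -> nat) (tau : R) (n0 : nat)
  (phi_father : father_wavelet phi)
  (p_ge1 : 1 <= p)
  (phi_bpv : (p_variation p phi < +oo)%E)
  (B1_lt_B2 : B1 < B2)
  (phi_supp : forall x : R, x \notin `]B1%:~R, B2%:~R] -> phi x = 0)
  (phi_unif : unif_continuous
     (phi : subspace [set` `]B1%:~R, B2%:~R] : interval R] -> R))
  (PN_power : is_power PN P)
  (p0_density : is_density p0 P)
  (p0_bounded : bounded_fun p0)
  (p0_unif : unif_continuous p0)
  (j_nondecr : {homo j : m n / (m <= n)%N})
  (j_oo : j n @[n --> \oo] --> \oo)
  (j_slow : (n%:R / ((j n)%:R * 2 ^+ j n) : R) @[n --> \oo] --> +oo)
  (j_fast : ((j n)%:R / ln (ln n%:R) : R) @[n --> \oo] --> +oo)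
  (tau_ge1 : 1 <= tau)
  (j_doubling : forall n, (n0 <= n)%N -> (j (2 * n)%N)%:R - (j n)%:R <= tau) :
  {ae PN, forall x : seq_space R,
    ((Num.sqrt (n%:R / (2 * ln 2 * (j n)%:R * 2 ^+ j n)))%:E *
     sup_norm (fun y : R =>
       ((wavelet_estimator phi j n x y
          - fine 'E_PN[fun x' => wavelet_estimator phi j n x' y])
       / Num.sqrt (zsum (fun k => phi (2 ^+ j n * y - k%:~R) ^+ 2)))%R))%E
    @[n --> \oo] --> (sup_norm p0 `^ 2^-1)%E}.
Proof.
have [L2phi _ _ _] := phi_father.
have phi_orth (k l : int) : \int[lebesgue_measure]_x
    (phi (x - k%:~R) * phi (x - l%:~R)) = (k == l)%:R.
  by have [_ -> _ _] := phi_father.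
have mphi : measurable_fun [set: measurableTypeR R] phi.
  by move: L2phi; rewrite /L2/= => /andP[/set_mem].
have [L [L0 BE]] : exists L : nat, (0 < L)%N /\ B2 = B1 + L%:Z.
  have : 0 < B2 - B1 by rewrite subr_gt0.
  case E : (B2 - B1) => [L|//] L0; exists L; split; first by rewrite -ltz_nat.
  by rewrite -E subrKC.
have B2E : B2%:~R = B1%:~R + L%:R :> R by rewrite BE intrD -pmulrn.
have unif := unif_continuous_itv phi_unif; rewrite B2E in unif.
have supp x : phi x != 0 -> B1%:~R < x <= B1%:~R + L%:R.
  by apply: contra_neqT => h; apply: phi_supp; rewrite in_itv/= B2E.
have [C phiC] : exists C, forall x, `|phi x| <= C.
  have [C HC] := unif_continuous_itv_bounded phi_unif.
  exists `|C| => x; have [->|/supp xB] := eqVneq (phi x) 0; first by rewrite normr0.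
  by apply: le_trans (ler_norm C); apply: HC; rewrite B2E.
have [kap kap0 kapP] : exists2 kap : R, 0 < kap & forall th, 0 < th <= 1 ->
    kap <= \sum_(i < L) unit_value phi B1 L i th ^+ 2.
  have H := sum_unit_value_sq mphi phiC supp phi_father unif.
  set c := (\int[lebesgue_measure]_x phi x) in H.
  have c0 : 0 < c ^+ 2 * L%:R.
    have := H 1; rewrite ltr01 lexx => /(_ isT) h.
    rewrite lt_neqAle eq_sym mulr_ge0 ?sqr_ge0// andbT.
    by apply: contraTneq h => ->; rewrite mul0r -ltNge ltr01.
  exists (c ^+ 2 * L%:R)^-1; first by rewrite invr_gt0.
  by move=> th /H h; rewrite -[leLHS]mul1r ler_pdivrMr// mulrC.
set p1 := sup (range p0).
have p1_gt0 : 0 < p1 by exact: density_sup_gt0 p0_density p0_bounded.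
have p0_le := density_le_sup p0_bounded.
have p0_sup := density_near_sup p0_bounded.
have p0_cont := unif_continuousR p0_unif.
have jge := @cvgn_nat_ge R j j_oo.
have jslow := slow_growth j_slow.
have jfast := fast_growth j_fast.
have -> : (sup_norm p0 `^ 2^-1 = (Num.sqrt p1)%:E)%E.
  by rewrite (sup_norm_density p0_density p0_bounded) poweR_EFin powR12_sqrt// ltW.
have [n1 jn1] := jge 1.
(* For the lower bound a single phase is enough; [th = 1] is taken, and [u] is the unit vector
   belonging to it. *)
pose u (i : 'I_L) := unit_value phi B1 L i 1 / unit_norm phi B1 L 1.
have one01 : 0 < (1 : R) <= 1. by rewrite ltr01/=.
have u1 : \sum_(i < L) u i ^+ 2 = 1.
  by apply: (normalized_unit_norm kap0 kapP (th := 1)); exact: one01.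
have N0 := unit_norm_gt0 kap0 kapP.
have upper : {ae PN, forall x : seq_space R, forall i : nat, exists n2, forall n,
    (n2 <= n)%N -> forall th (k : int), 0 < th <= 1 ->
    `|\sum_(m < L) unit_value phi B1 L m th * translate_sum phi P (j n) n x (k + m%:Z)|
      <= (1 + i.+1%:R^-1) ^+ 2 * threshold p1 (j n) n * unit_norm phi B1 L th}.
  apply: ae_foralln => i.
  apply: (eventual_uniform_bound L0 mphi phiC supp phi_orth unif kap0 kapP
    p0_density p1_gt0 p0_le PN_power j_nondecr jge jslow jfast j_doubling).
  by rewrite invr_gt0 ltr0n.
have lower : {ae PN, forall x : seq_space R, forall i : nat, exists n2, forall n,
    (n2 <= n)%N -> exists k : int, (1 - 3 * i.+4%:R^-1) * threshold p1 (j n) n <=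
    \sum_(l < n) centered P (scaled_window phi u (j n) k) (x l)}.
  apply: ae_foralln => i.
  apply: (eventual_lower_bound L0 mphi phiC supp phi_orth p0_density p1_gt0 p0_le
    p0_sup p0_cont PN_power jge jslow jfast u1).
    by rewrite invr_gt0 ltr0n.
  by rewrite div1r lef_pV2 ?posrE ?ltr0n// ler_nat.
apply: filterS2 upper lower => x upper lower.
pose dev n (y : R) := (wavelet_estimator phi j n x y
    - fine 'E_PN[fun x' => wavelet_estimator phi j n x' y])
  / Num.sqrt (zsum (fun k => phi (2 ^+ j n * y - k%:~R) ^+ 2)).
rewrite -[X in X @ \oo --> _]/(fun n =>
  ((Num.sqrt (n%:R / (2 * ln 2 * (j n)%:R * 2 ^+ j n)))%:E * sup_norm (dev n))%E).
have devE n y th m : 0 < th <= 1 -> 2 ^+ j n * y = m%:~R + th ->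
    dev n y = 2 ^+ j n / n%:R * ((\sum_(i < L) unit_value phi B1 L i th *
      translate_sum phi P (j n) n x (m - (B1 + L%:Z - 1) + i%:Z)) / unit_norm phi B1 L th).
  move=> th01 yE; rewrite /dev (wavelet_estimator_centered mphi phiC supp PN_power x th01 yE).
  by rewrite (wavelet_norm_window supp th01 yE) mulrA.
have A0 n : 0 <= Num.sqrt (n%:R / (2 * ln 2 * (j n)%:R * 2 ^+ j n)) :> R.
  exact: sqrtr_ge0.
apply: cvg_between; first exact: sqrtr_ge0.
  move=> i; have [n2 H] := lower i.
  exists (maxn n2 (maxn n1 1)) => n; rewrite !geq_max => /and3P[nn2 nn1 n_gt0].
  have jn0 : (0 < j n)%N by rewrite -(ler_nat R) jn1.
  have [k Hk] := H n nn2.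
  (* The point at which the deviation reads off window [k] with phase 1; the shift by [B1 + L - 1]
     undoes the one in [devE]. *)
  pose y : R := ((k + (B1 + L%:Z - 1))%:~R + 1) / 2 ^+ j n.
  have yE : 2 ^+ j n * y = (k + (B1 + L%:Z - 1))%:~R + 1.
    by rewrite /y mulrC divfK// gt_eqF// exprn_gt0.
  have dy : 2 ^+ j n / n%:R * ((1 - 3 * i.+4%:R^-1) * threshold p1 (j n) n) <= dev n y.
    rewrite (devE n y 1 _ one01 yE) ler_wpM2l ?divr_ge0 ?exprn_ge0//.
    apply: (le_trans Hk); rewrite (sum_centered_scaled_window mphi phiC) mulr_suml.
    rewrite le_eqVlt; apply/orP; left; apply/eqP; apply: eq_bigr => m _.
    by rewrite addrK /u mulrAC.
  rewrite -(threshold_scale (ltW p1_gt0) n_gt0 jn0) mulrCA EFinM.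
  apply: lee_wpmul2l; first by rewrite lee_fin.
  apply: (@le_trans _ _ (`|dev n y|)%:E).
    by rewrite lee_fin (le_trans _ (ler_norm _))// mulrCA.
  by apply: ereal_sup_ubound; exists y.
move=> i; have [n2 H] := upper i.
exists (maxn n2 (maxn n1 1)) => n; rewrite !geq_max => /and3P[nn2 nn1 n_gt0].
have jn0 : (0 < j n)%N by rewrite -(ler_nat R) jn1.
rewrite -(threshold_scale (ltW p1_gt0) n_gt0 jn0) mulrCA EFinM.
apply: lee_wpmul2l; first by rewrite lee_fin.
apply: ge_ereal_sup => _ [y _ <-]; rewrite lee_fin.
have [m th01] := unit_part (2 ^+ j n * y).
have yE : 2 ^+ j n * y = m%:~R + (2 ^+ j n * y - m%:~R) by rewrite subrKC.
rewrite (devE n y _ m th01 yE) normrM ger0_norm ?divr_ge0 ?exprn_ge0//.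
rewrite mulrCA ler_wpM2l ?divr_ge0 ?exprn_ge0//.
rewrite normrM normfV (gtr0_norm (N0 _ th01)).
by rewrite ler_pdivrMr ?(N0 _ th01)//; exact: H.
Qed.
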